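(* Let $V$ be a vertex operator algebra such that: (1) $V$ is $C_1$-cofinite; (2) there exists a positive integer $N$ such that $|\Re(n_1)-\Re(n_2)|\le N$ for the lowest weights $n_1$ and $n_2$ of any two irreducible $V$-modules and such that $A_N(V)$ is finite dimensional; (3) every irreducible $V$-module is $\mathbb R$-graded and $C_1$-cofinite as a $V$-module. Let $\mathcal C$ be the category of grading-restricted generalized $V$-modules (which under (1) and (2) coincides with the category of finite length generalized $V$-modules). Let $z\in\mathbb C^\times$ and let $W_1$ and $W_2$ be objects of $\mathcal C$. Then the generalized $V$-module $W_1\,\square_{P(z)}W_2\subset (W_1\otimes W_2)^*$ (defined using the category $\mathcal C$) is also an object of $\mathcal C$.
   Context: $V=\coprod_{n\in\mathbb Z}V_{(n)}$ is a vertex operator algebra over $\mathbb C$, $Y(u,x)=\sum_{n\in\mathbb Z}u_nx^{-n-1}$, $V_+=\coprod_{n>0}V_{(n)}$. Generalized modules: A generalized $V$-module is a $\mathbb C$-graded space $W=\coprod_{n\in\mathbb C}W_{[n]}$ with a vertex operator map $Y_W:V\otimes W\to W((x))$ satisfying all axioms for $V$-modules except the two grading-restriction conditions, and with $W_{[n]}$ required only to be the generalized eigenspace of $L(0)$ with eigenvalue $n$. It is lower truncated if $W_{[n]}=0$ when $\Re(n)$ is sufficiently negative; grading restricted if it is lower truncated and $\dim W_{[n]}<\infty$ for all $n$; a (ordinary) $V$-module if it is grading restricted and $L(0)$ acts semisimply. The lowest weight of an irreducible $V$-module $W$ is the $n_0$ with $W_{[n_0]}\ne0$ and $W=\coprod_{k\in\mathbb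 N}W_{[n_0+k]}$. $W$ is of finite length if it has a finite filtration by generalized submodules with irreducible $V$-modules as successive quotients. $W'=\coprod_n W_{[n]}^*$ is the contragredient, $\overline W=\prod_nW_{[n]}$, and $\pi_n:\overline W\to W_{[n]}$ is the projection. Cofiniteness: $V$ is $C_1$-cofinite (in the sense of Li) if $V/C_1^a(V)$ is finite dimensional, $C_1^a(V)$ being the span of $u_{-1}v$ ($u,v\in V_+$) and $L(-1)v$ ($v\in V$). A $V$-module $W$ is $C_1$-cofinite if $W/C_1(W)$ is finite dimensional, $C_1(W)$ being the span of $u_{-1}w$ ($u\in V_+$, $w\in W$). $A_n(V)=V/O_n(V)$ is the (Zhu, Dong–Li–Mason) associative algebra with product induced by $u*_nv=\sum_{m=0}^n(-1)^m\binom{m+n}{n}\mathrm{Res}_x\,x^{-n-m-1}Y((1+x)^{L(0)+n}u,x)v$, where $O_n(V)$ is spanned by $\mathrm{Res}_x\,x^{-2n-2}Y((1+x)^{L(0)+n}u,x)v$ and $(L(-1)+L(0))u$ for $u,v\in V$. $P(z)$-intertwining maps: Let $W_1,W_2,W_3$ be generalized $V$-modules with vertex operator maps $Y_1,Y_2,Y_3$, and let $\delta(x)=\sum_{n\in\mathbb Z}x^n$ (binomials $(a+b)^n$ are expanded in nonnegative powers of $b$). A $P(z)$-intertwining map of type ${W_3\choose W_1W_2}$ is a linear map $I:W_1\otimes W_2\to\overline{W_3}$ such that for all $w_1,w_2$ and $n\in\mathbb C$, $\pi_{n-m}(I(w_1\otimes w_2))=0$ for $m\in\mathbb N$ sufficiently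 large, and for all $v\in V$, $$x_0^{-1}\delta\Big(\frac{x_1-z}{x_0}\Big)Y_3(v,x_1)I(w_1\otimes w_2)=z^{-1}\delta\Big(\frac{x_1-x_0}{z}\Big)I(Y_1(v,x_0)w_1\otimes w_2)+x_0^{-1}\delta\Big(\frac{z-x_1}{-x_0}\Big)I(w_1\otimes Y_2(v,x_1)w_2).$$ Definition of $W_1\,\square_{P(z)}W_2$: For an object $W$ of $\mathcal C$ and a $P(z)$-intertwining map $I$ of type ${W\choose W_1W_2}$, each $w'\in W'$ gives $I'(w')\in(W_1\otimes W_2)^*$, $I'(w')(w_1\otimes w_2)=\langle w',I(w_1\otimes w_2)\rangle$. Then $W_1\,\square_{P(z)}W_2$ is the sum (equivalently union) in $(W_1\otimes W_2)^*$ of all the subspaces $I'(W')$ over all objects $W$ of $\mathcal C$ and all such $I$. It carries the generalized $V$-module structure given by $$(Y'_{P(z)}(v,x)\lambda)(w_1\otimes w_2)=\lambda(w_1\otimes Y_2(e^{xL(1)}(-x^{-2})^{L(0)}v,x^{-1})w_2)+\mathrm{Res}_{x_0}z^{-1}\delta\Big(\frac{x^{-1}-x_0}{z}\Big)\lambda(Y_1(e^{xL(1)}(-x^{-2})^{L(0)}v,x_0)w_1\otimes w_2),$$ for which all the maps $I':W'\to W_1\,\square_{P(z)}W_2$ are homomorphisms. (The symbol $\square$ is just notation for this operation; in the literature it is printed as a box with a diagonal stroke from upper left to lower right.) *)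

(* Defs.v *)
From HB Require Import structures.
From mathcomp Require Import all_boot all_order all_algebra.
From mathcomp Require Import boolp classical_sets functions cardinality fsbigop.
From mathcomp Require Import reals.
From mathcomp Require Import complex.

Set Implicit Arguments.
Unset Strict Implicit.
Unset Printing Implicit Defensive.

Import Order.TTheory GRing.Theory Num.Theory.
Local Open Scope classical_set_scope.
Local Open Scope ring_scope.

(* Complex numbers are [R[i]] for [R : realType].

   A vertex operator map is given by its modes: [Y v n] is the operator v_n of
   Y(v,x) = \sum_n v_n x^(-n-1).  Identities between formal series are written
   coefficient by coefficient.  All sums over [setT] below are sums
   [\sum_(i \in A) F i] of fsbigop; in every use only finitely many terms are
   nonzero. *)

Definition binomz (F : fieldType) (a : int) (i : nat) : F :=
  (\prod_(j < i) (a%:~R - j%:R)) / i`!%:R.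

(* Coefficient of a^(k-i) b^i in (a - b)^k, expanded in nonnegative powers
   of b. *)
Definition subx (F : fieldType) (k : int) (i : nat) : F :=
  (-1) ^+ i * binomz F k i.

Section LinearAlgebra.
Context {F : fieldType}.

Definition span (W : lmodType F) (A : set W) : set W :=
  [set w | exists (n : nat) (a : 'I_n -> F) (x : 'I_n -> W),
     (forall i, A (x i)) /\ w = \sum_(i < n) a i *: x i].

Definition fin_dim (W : lmodType F) (A : set W) :=
  exists s : seq W, A `<=` span [set` s].

(* For a subspace [A]: the quotient W / A is finite dimensional. *)
Definition fin_codim (W : lmodType F) (A : set W) :=
  exists s : seq W, forall w, span (A `|` [set` s]) w.

(* A grading of W by I, encoded by its projections [pi n]: W -> W_n. *)
Record is_grading (I : choiceType) (W : lmodType F) (pi : I -> W -> W) : Prop :=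
  IsGrading {
    grading_linear : forall n, linear (pi n);
    grading_orth : forall m n w,
      pi m (pi n w) = if m == n then pi n w else 0;
    grading_finite : forall w, finite_set [set n | pi n w != 0];
    grading_sum : forall w, \sum_(n \in [set: I]) pi n w = w }.

Definition homog (I : Type) (W : lmodType F) (pi : I -> W -> W) (n : I) :
    set W :=
  [set w | pi n w = w].

End LinearAlgebra.

(* A subspace, as a type. *)
Section SpanType.
Context {F : fieldType} {W : lmodType F} (A : set W).

Definition span_pred : pred W := fun w => `[< span A w >].

Lemma span_submod_closed : submod_closed span_pred.
Proof.
split=> [|c u v /asboolP[m [a [x [Ax ->]]]] /asboolP[n [b [y [Ay ->]]]]].
  apply/asboolP; exists 0%N, (fun=> 0), (fun=> 0).
  by split=> [[]//|]; rewrite big_ord0.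
apply/asboolP; exists (m + n)%N.
pose ca i := match fintype.split i with inl j => c * a j | inr j => b j end.
pose cx i := match fintype.split i with inl j => x j | inr j => y j end.
exists ca, cx; split=> [i|].
  by rewrite /cx; case: (fintype.split i).
rewrite big_split_ord scaler_sumr; congr (_ + _); apply: eq_bigr => i _.
  by rewrite /ca /cx (unsplitK (inl i)) scalerA.
by rewrite /ca /cx (unsplitK (inr i)).
Qed.

HB.instance Definition _ := GRing.isSubmodClosed.Build F W span_pred
  span_submod_closed.

Record span_type := SpanType { span_val :> W; _ : span_val \in span_pred }.
HB.instance Definition _ := [isSub for span_val].
HB.instance Definition _ := [Choice of span_type by <:].
HB.instance Definition _ := [SubChoice_isSubLmodule of span_type by <:].

End SpanType.

Section VOA.
Context {R : realType}.

(* The module axioms that do not involve the grading, for a map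
   Y_W : V (x) W -> W((x)), where V carries the vertex operator map [Y], the
   vacuum [vac], the conformal vector [om] and the central charge [c]. *)
Section Action.
Variables (V W : lmodType R[i]) (Y : V -> int -> V -> V) (vac om : V)
  (c : R[i]) (YW : V -> int -> W -> W).

(* Coefficient of x_0^(-l-1) x_1^(-m-1) x_2^(-n-1) in the Jacobi identity
     x_0^-1 delta((x_1-x_2)/x_0) Y_W(u,x_1) Y_W(v,x_2)
     - x_0^-1 delta((x_2-x_1)/(-x_0)) Y_W(v,x_2) Y_W(u,x_1)
     = x_2^-1 delta((x_1-x_0)/x_2) Y_W(Y(u,x_0)v,x_2). *)
Definition jacobi_identity :=
  forall (u v : V) (w : W) (l m n : int),
    \sum_(i \in [set: nat])
       subx _ l i *: YW u (m + l - i%:Z) (YW v (n + i%:Z) w)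
    - \sum_(i \in [set: nat])
       ((-1) ^ l * subx _ l i) *: YW v (n + l - i%:Z) (YW u (m + i%:Z) w)
    = \sum_(i \in [set: nat])
       subx _ (i%:Z - m - 1) i *: YW (Y u (l + i%:Z) v) (m + n - i%:Z) w.

(* L(n), from Y_W(om,x) = \sum_n L(n) x^(-n-2). *)
Definition Lop (n : int) : W -> W := YW om (n + 1).

Definition virasoro_relations :=
  forall (m n : int) (w : W),
    Lop m (Lop n w) - Lop n (Lop m w)
    = (m - n)%:~R *: Lop (m + n) w
      + (if m + n == 0 then ((m ^+ 3 - m)%:~R / 12%:R * c) *: w else 0).

End Action.

Record vertex_action (V W : lmodType R[i]) (Y : V -> int -> V -> V)
    (vac om : V) (c : R[i]) (YW : V -> int -> W -> W) : Prop :=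
  VertexAction {
    act_linear_l : forall n w, linear (fun v => YW v n w);
    act_linear_r : forall v n, linear (YW v n);
    act_truncation : forall v w, exists N : int,
      forall n : int, N <= n -> YW v n w = 0;
    act_vacuum : forall n w, YW vac n w = if n == -1 then w else 0;
    act_jacobi : jacobi_identity Y YW;
    act_virasoro : virasoro_relations om c YW;
    (* (d/dx) Y_W(v,x) = Y_W(L(-1)v,x) *)
    act_derivative : forall v n w,
      YW (Lop om Y (-1) v) n w = - n%:~R *: YW v (n - 1) w }.

Record is_voa (V : lmodType R[i]) (pi : int -> V -> V)
    (Y : V -> int -> V -> V) (vac om : V) (c : R[i]) : Prop :=
  IsVOA {
    voa_grading : is_grading pi;
    voa_fin_dim : forall n, fin_dim (homog pi n);
    voa_trunc : exists N : int, forall n : int, n < N -> forall v, pi n v = 0;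
    voa_vac_weight : homog pi 0 vac;
    voa_om_weight : homog pi 2 om;
    voa_action : vertex_action Y vac om c Y;
    voa_creation : forall v,
      Y v (-1) vac = v /\ forall n : int, 0 <= n -> Y v n vac = 0;
    voa_L0 : forall n v, homog pi n v -> Lop om Y 0 v = n%:~R *: v }.

End VOA.

Record voa (R : realType) := MkVOA {
  voa_space :> lmodType R[i];
  voa_pi : int -> voa_space -> voa_space;
  voa_Y : voa_space -> int -> voa_space -> voa_space;
  voa_vac : voa_space;
  voa_om : voa_space;
  voa_c : R[i];
  voa_axioms : is_voa voa_pi voa_Y voa_vac voa_om voa_c }.

Section Modules.
Context {R : realType} (V : voa R).

Record is_gmodule (W : lmodType R[i]) (pi : R[i] -> W -> W)
    (YW : V -> int -> W -> W) : Prop :=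
  IsGmodule {
    gmod_grading : is_grading pi;
    gmod_action :
      vertex_action (@voa_Y _ V) (voa_vac V) (voa_om V) (voa_c V) YW;
    (* W_[n] is the generalized eigenspace of L(0) with eigenvalue n. *)
    gmod_L0 : forall n w, homog pi n w <->
      exists k : nat, iter k (fun x => Lop (voa_om V) YW 0 x - n *: x) w = 0 }.

Record gmodule := MkGmodule {
  gmod_space :> lmodType R[i];
  gmod_pi : R[i] -> gmod_space -> gmod_space;
  gmod_Y : V -> int -> gmod_space -> gmod_space;
  gmod_axioms : is_gmodule gmod_pi gmod_Y }.

Definition lower_truncated (W : gmodule) :=
  exists r : R, forall n : R[i], complex.Re n < r ->
    forall w : W, gmod_pi n w = 0.

Definition grading_restricted (W : gmodule) :=
  lower_truncated W /\ forall n, fin_dim (homog (@gmod_pi W) n).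

Definition L0_semisimple (W : gmodule) :=
  forall n (w : W), homog (@gmod_pi W) n w ->
    Lop (voa_om V) (@gmod_Y W) 0 w = n *: w.

Definition is_module (W : gmodule) := grading_restricted W /\ L0_semisimple W.

(* Such a subspace is L(0)-stable, hence automatically graded. *)
Definition submodule (W : gmodule) (S : set W) :=
  [/\ S 0, forall (a : R[i]) x y, S x -> S y -> S (a *: x + y)
    & forall v n w, S w -> S (gmod_Y v n w)].

Definition irreducible_module (W : gmodule) :=
  [/\ is_module W, exists w : W, w != 0
    & forall S : set W, submodule S -> S = [set 0] \/ S = setT].

Definition lowest_weight (W : gmodule) (n0 : R[i]) :=
  (exists w : W, gmod_pi n0 w != 0) /\
  forall (n : R[i]) (w : W), gmod_pi n w != 0 -> exists k : nat, n = n0 + k%:R.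

Definition real_graded (W : gmodule) :=
  forall (n : R[i]) (w : W), gmod_pi n w != 0 -> complex.Im n = 0.

Definition Vplus : set V :=
  [set v | forall n : int, n <= 0 -> voa_pi n v = 0].

Definition C1a : set V := span
  [set x | (exists u v, [/\ Vplus u, Vplus v & x = voa_Y u (-1) v])
        \/ (exists v, x = Lop (voa_om V) (@voa_Y _ V) (-1) v)].

Definition voa_C1_cofinite := fin_codim C1a.

Definition C1 (W : gmodule) : set W := span
  [set x | exists u (w : W), Vplus u /\ x = gmod_Y u (-1) w].

Definition C1_cofinite (W : gmodule) := fin_codim (@C1 W).

(* Res_x x^(-2n-2) Y((1+x)^(L(0)+n) u, x) v: on the component of u of weight a,
   (1+x)^(L(0)+n) is \sum_i binom(a+n,i) x^i. *)
Definition circ (n : nat) (u v : V) : V :=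
  \sum_(a \in [set: int]) \sum_(i \in [set: nat])
    binomz _ (a + n%:Z) i *: voa_Y (voa_pi a u) (i%:Z - (2 * n)%:Z - 2) v.

Definition O_ (n : nat) : set V := span
  [set x | (exists u v, x = circ n u v)
        \/ (exists u, x = Lop (voa_om V) (@voa_Y _ V) (-1) u
                          + Lop (voa_om V) (@voa_Y _ V) 0 u)].

(* A_n(V) = V / O_n(V); its product plays no role for its dimension. *)
Definition A_finite_dimensional (n : nat) := fin_codim (O_ n).

(* The algebraic completion \prod_n W_[n]. *)
Definition completion (W : gmodule) : set (R[i] -> W) :=
  [set f | forall n, homog (@gmod_pi W) n (f n)].

(* v_n extended to the completion. *)
Definition completion_Y (W : gmodule) (v : V) (n : int) (f : R[i] -> W) :
    R[i] -> W :=
  fun p => \sum_(q \in [set: R[i]]) gmod_pi p (gmod_Y v n (f q)).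

(* W' = \coprod_n W_[n]^*: functionals on W that vanish on all but finitely
   many W_[n]. *)
Definition contragredient (W : gmodule) : set (W -> R[i]^o) :=
  [set f | linear f /\
     finite_set [set n | exists2 w : W, homog (@gmod_pi W) n w & f w != 0]].

Definition pairing (W : gmodule) (w' : W -> R[i]^o) (f : R[i] -> W) : R[i]^o :=
  \sum_(n \in [set: R[i]]) w' (f n).

(* The coefficient of x_0^(-k-1) x_1^(-m-1), projected to weight p, of the
   defining identity
     x_0^-1 delta((x_1-z)/x_0) Y_3(v,x_1) I(w1 (x) w2)
     = z^-1 delta((x_1-x_0)/z) I(Y_1(v,x_0) w1 (x) w2)
       + x_0^-1 delta((z-x_1)/(-x_0)) I(w1 (x) Y_2(v,x_1) w2).
   A linear map on W1 (x) W2 is given as a bilinear map. *)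
Record intertwining_map (z : R[i]) (W1 W2 W3 : gmodule)
    (I : W1 -> W2 -> R[i] -> W3) : Prop :=
  IntertwiningMap {
    int_linear_l : forall w2 p, linear (fun w1 => I w1 w2 p);
    int_linear_r : forall w1 p, linear (fun w2 => I w1 w2 p);
    int_completion : forall w1 w2, completion (I w1 w2);
    int_truncation : forall w1 w2 (n : R[i]), exists M : nat,
      forall m : nat, (M <= m)%N -> I w1 w2 (n - m%:R) = 0;
    int_jacobi : forall (v : V) w1 w2 (k m : int) (p : R[i]),
      \sum_(i \in [set: nat])
         (subx _ k i * z ^+ i)
           *: completion_Y v (m + k - i%:Z) (I w1 w2) p
      = \sum_(i \in [set: nat])
         (subx _ (i%:Z - m - 1) i * z ^ (m - i%:Z))
           *: I (gmod_Y v (k + i%:Z) w1) w2 p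
        + \sum_(i \in [set: nat])
         ((-1) ^ k * subx _ k i * z ^ (k - i%:Z))
           *: I w1 (gmod_Y v (m + i%:Z) w2) p }.

Section Box.
Variables (obj : gmodule -> Prop) (z : R[i]) (W1 W2 : gmodule).

(* The union of all I'(W').  Elements of (W1 (x) W2)^* are represented by
   bilinear forms, inside the vector space of all functions W1 -> W2 -> C;
   every I'(w') is bilinear. *)
Definition box_generators : set (W1 -> W2 -> R[i]^o) :=
  [set la | exists (W : gmodule) (I : W1 -> W2 -> R[i] -> W) w',
     [/\ obj W, intertwining_map z I, contragredient w'
       & la = fun w1 w2 => pairing w' (I w1 w2)]].

(* W1 box_P(z) W2, defined using the category whose objects satisfy [obj]:
   the sum of the subspaces I'(W'). *)
Definition box := span_type box_generators.

(* The coefficient of x^(j-2a) contributed by the weight a component of v to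
   e^(x L(1)) (-x^-2)^(L(0)) v. *)
Definition theta (v : V) (a : int) (j : nat) : V :=
  ((-1) ^ a / j`!%:R) *: iter j (Lop (voa_om V) (@voa_Y _ V) 1) (voa_pi a v).

(* Coefficient of x^(-n-1) in Y'_P(z)(v,x) la.  In the second summand, the
   term z^(-k-1) (x^-1 - x_0)^k of the delta function contributes through its
   power x_0^i, paired by Res_(x_0) with the mode i of Y_1. *)
Definition box_Y (v : V) (n : int) (la : W1 -> W2 -> R[i]^o) :
    W1 -> W2 -> R[i]^o := fun w1 w2 =>
  \sum_(a \in [set: int]) \sum_(j \in [set: nat])
    (la w1 (gmod_Y (theta v a j) (2 * a - j%:Z - n - 2) w2)
     + \sum_(i \in [set: nat])
         let k := i%:Z + j%:Z - 2 * a + n + 1 in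
         (subx _ k i * z ^ (- k - 1)) *: la (gmod_Y (theta v a j) i%:Z w1) w2).

End Box.

End Modules.

(* Main.v *)
(* The box product B is the union of the images of the contragredients W' under
   the maps I', which are V-homomorphisms; so the module axioms for B follow from
   those for contragredient modules, and L(0) is locally finite on B.

   Finiteness of B uses the C_1-cofiniteness of W_1 and W_2.  Let B_0 be the space
   of functionals in B annihilated by the transposes of all u_{-1} with u of
   positive weight.  The Jacobi identity of intertwining maps lets one move such a
   u_{-1} from either argument of a functional in B_0 to the other one, lowering
   the total weight; hence an element of B_0 is determined by its values on
   X_1 x X_2, where W_i = C_1(W_i) + X_i with X_i finite dimensional, and B_0 is
   finite dimensional.  Every nonzero homogeneous element of B is moved into
   B_0 \ 0 by finitely many of these transposes, which lower weights by positive
   integers.  So the weights of B lie in (weights of B_0) + N, and B_[n] maps with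
   finite-dimensional kernel to finitely many B_[n-k], k > 0, whence
   dim B_[n] < oo by induction.

   A grading-restricted W is C_1-cofinite because it has finite length: as A_N(V)
   is finite dimensional, powers of the conformal vector satisfy a linear relation
   modulo O_N(V), so all lowest weights of subquotients are roots of one
   polynomial, and the part of W in these finitely many weights, which is finite
   dimensional, bounds the length.  C_1-cofiniteness passes to extensions. *)
Require Import Defs.
From HB Require Import structures.
From mathcomp Require Import all_boot all_order all_algebra.
From mathcomp Require Import boolp classical_sets functions cardinality fsbigop.
From mathcomp Require Import reals.
From mathcomp Require Import complex.
From mathcomp Require Import zify ring lra.
Import Order.TTheory GRing.Theory Num.Theory.
Local Open Scope classical_set_scope.
Local Open Scope ring_scope.

(* mathcomp's vector.v also defines [span]. *)
Local Notation span := Defs.span.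

Set Implicit Arguments.
Unset Strict Implicit.
Unset Printing Implicit Defensive.

(** * Finite sums, subspaces and generalized eigenspaces *)

Section FiniteSums.

(** Every object of the category contributes to B, and neither the lower bounds of the weights nor
    the dimensions are uniform over these objects. So the maps I' transport only what concerns one
    element at a time: module axioms, local finiteness of L(0), a weight bound for the descendants
    of one element. Uniform bounds must come from the fixed pair W_1, W_2.

    The finiteness argument uses plain transposes of modes u_M instead of the modes of Y'_P(z),
    which mix them through e^(xL(1)): the transpose of u_{-1} lowers weights by exactly the weight
    of u. Two families of coefficients of the defining identity suffice: k = 0 moves modes from W_2
    to W_1, and k = -1, m = 0 moves u_{-1} from W_1 to W_2 up to transposes of u_{-1-i}. The latter
    vanish on B_0 because L(-1)u again has positive weight and (L(-1)u)_M = -M u_{M-1}.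

    For lowest weights, powers of the conformal vector are taken with the product of A_0(V), yet
    related modulo O_N(V). This is consistent because zero modes of O_N(V) also annihilate lowest
    weight vectors.

    Weights are complex, so inductions on them use a natural number bounding the real part. *)

Lemma fsumE (I : choiceType) (V : nmodType) (s : seq I) (f : I -> V) :
  uniq s -> (forall i, i \notin s -> f i = 0) ->
  \sum_(i \in [set: I]) f i = \sum_(i <- s) f i.
Proof.
move=> us fs; rewrite (fsbigE s) //; last by move=> i _; exact: fs.
by apply: eq_bigl => i; rewrite in_setT.
Qed.

(** A [fsbigop] sum with infinite support is 0 by convention, so a support has to be bounded before
    a sum can be manipulated. For sums over modes the bound [K] comes from truncation. *)
Lemma fsum_nat (V : nmodType) (K : nat) (f : nat -> V) :
  (forall i, (K <= i)%N -> f i = 0) ->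
  \sum_(i \in [set: nat]) f i = \sum_(i < K) f i.
Proof.
move=> fK; rewrite (@fsumE _ _ (iota 0 K)) ?iota_uniq //.
  by rewrite -[in LHS](subn0 K) -/(index_iota 0 K) big_mkord.
by move=> i; rewrite mem_iota add0n leq0n /= -leqNgt => /fK.
Qed.

Lemma fsum1 (I : choiceType) (V : nmodType) (n : I) (f : I -> V) :
  (forall i, i != n -> f i = 0) -> \sum_(i \in [set: I]) f i = f n.
Proof.
move=> fn; rewrite (@fsumE _ _ [:: n]) ?big_seq1 // => i.
by rewrite inE => /fn.
Qed.

Lemma finite_support_seq (I : choiceType) (V : nmodType) (f : I -> V) :
  finite_set [set n | f n != 0] ->
  exists s : seq I, uniq s /\ forall i, i \notin s -> f i = 0.
Proof.
move=> /finite_seqP[s sE]; exists (undup s); rewrite undup_uniq; split => // i.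
rewrite mem_undup => /negP ins; apply/eqP/negPn/negP => fi; apply: ins.
suff : [set` s] i by [].
by rewrite -sE.
Qed.

End FiniteSums.

Section Linear.
Context {F : fieldType} {V W : lmodType F} (f : V -> W) (lf : linear f).

Lemma lin0 : f 0 = 0.
Proof. by have := lf (-1) 0 0; rewrite scaler0 addr0 scaleN1r addNr. Qed.
Lemma linD x y : f (x + y) = f x + f y.
Proof. by rewrite -[x]scale1r lf !scale1r. Qed.
Lemma linZ a x : f (a *: x) = a *: f x.
Proof. by rewrite -[a *: x]addr0 lf lin0 addr0. Qed.
Lemma linN x : f (- x) = - f x.
Proof. by rewrite -scaleN1r linZ scaleN1r. Qed.
Lemma linB x y : f (x - y) = f x - f y.
Proof. by rewrite linD linN. Qed.
Lemma lin_sum (I : Type) (s : seq I) (P : pred I) (g : I -> V) :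
  f (\sum_(i <- s | P i) g i) = \sum_(i <- s | P i) f (g i).
Proof. exact: (big_morph f linD lin0). Qed.
Lemma lin_fsum (I : choiceType) (s : seq I) (g : I -> V) :
  uniq s -> (forall i, i \notin s -> g i = 0) ->
  f (\sum_(i \in [set: I]) g i) = \sum_(i \in [set: I]) f (g i).
Proof.
move=> us gs; rewrite !(fsumE us) ?lin_sum // => i ins.
by rewrite gs // lin0.
Qed.
Lemma lin_fsum_nat (K : nat) (g : nat -> V) :
  (forall i, (K <= i)%N -> g i = 0) ->
  f (\sum_(i \in [set: nat]) g i) = \sum_(i \in [set: nat]) f (g i).
Proof.
move=> gK; rewrite !(@fsum_nat _ K) ?lin_sum // => i iK.
by rewrite gK // lin0.
Qed.
End Linear.

Lemma lin_comp (F : fieldType) (U V W : lmodType F) (f : V -> W) (g : U -> V) :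
  linear f -> linear g -> linear (fun x => f (g x)).
Proof. by move=> lf lg a x y; rewrite lg lf. Qed.

Section Subspaces.
Context {F : fieldType}.
Implicit Type V : lmodType F.

Definition subspace V (S : set V) :=
  S 0 /\ forall a x y, S x -> S y -> S (a *: x + y).

Section Subspace.
Variables (V : lmodType F) (S : set V).
Hypothesis subS : subspace S.
Lemma ss0 : S 0. Proof. exact: subS.1. Qed.
Lemma ssP a x y : S x -> S y -> S (a *: x + y). Proof. exact: subS.2. Qed.
Lemma ssD x y : S x -> S y -> S (x + y).
Proof. by rewrite -{2}[x]scale1r; exact: ssP. Qed.
Lemma ssZ a x : S x -> S (a *: x).
Proof. by move=> Sx; rewrite -[_ *: _]addr0; apply: ssP => //; exact: ss0. Qed.
Lemma ssN x : S x -> S (- x).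
Proof. by move=> Sx; rewrite -scaleN1r; exact: ssZ. Qed.
Lemma ssB x y : S x -> S y -> S (x - y).
Proof. by move=> Sx Sy; apply: ssD => //; exact: ssN. Qed.
Lemma ss_sum (I : Type) (s : seq I) (P : pred I) (f : I -> V) :
  (forall i, P i -> S (f i)) -> S (\sum_(i <- s | P i) f i).
Proof.
by move=> Sf; elim/big_ind : _ => //; [exact: ss0 | exact: ssD].
Qed.
Lemma ss_sum_seq (I : eqType) (s : seq I) (f : I -> V) :
  (forall i, i \in s -> S (f i)) -> S (\sum_(i <- s) f i).
Proof. by move=> Sf; rewrite big_seq; apply: ss_sum. Qed.
Lemma ss_fsum (I : choiceType) (s : seq I) (f : I -> V) :
  uniq s -> (forall i, i \notin s -> f i = 0) -> (forall i, S (f i)) ->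
  S (\sum_(i \in [set: I]) f i).
Proof. by move=> us fs Sf; rewrite (fsumE us fs); apply: ss_sum. Qed.
Lemma ssDr x y : S x -> S (x + y) -> S y.
Proof. by move=> Sx Sxy; rewrite -(addKr x y) addrC; apply: ssB. Qed.
End Subspace.

Lemma linear_eq_subspace V (W : lmodType F) (f g : V -> W) :
  linear f -> linear g -> subspace [set x | f x = g x].
Proof.
move=> lf lg; split; first exact: etrans (lin0 lf) (esym (lin0 lg)).
by move=> a x y fgx fgy; rewrite /mkset lf lg fgx fgy.
Qed.

Lemma linear_preim_subspace V (W : lmodType F) (f : V -> W) (S : set W) :
  linear f -> subspace S -> subspace [set x | S (f x)].
Proof.
move=> lf sS; split; first by rewrite /mkset (lin0 lf); exact: ss0 sS.
by move=> a x y Sx Sy; rewrite /mkset lf; exact: (ssP sS).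
Qed.

Lemma linear_ker_subspace V (W : lmodType F) (f : V -> W) :
  linear f -> subspace [set x | f x = 0].
Proof.
move=> lf; split; first exact: lin0.
by move=> a x y fx fy; rewrite /mkset lf fx fy scaler0 addr0.
Qed.

Lemma span_sub V (A : set V) x : A x -> span A x.
Proof.
move=> Ax; exists 1%N, (fun=> 1), (fun=> x); split => //.
by rewrite big_ord1 scale1r.
Qed.

Lemma span_subspace V (A : set V) : subspace (span A).
Proof.
have [h0 h1] := span_submod_closed A; split; first exact/asboolP.
move=> a x y xA yA; apply/asboolP; apply: h1; exact/asboolP.
Qed.

Lemma span_min V (A S : set V) : subspace S -> A `<=` S -> span A `<=` S.
Proof.
move=> sS AS _ [n [a [x [Ax ->]]]].
by apply: (ss_sum sS) => i _; apply: (ssZ sS); apply: AS.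
Qed.

Lemma spanS V (A B : set V) : A `<=` B -> span A `<=` span B.
Proof.
move=> AB; apply: span_min; first exact: span_subspace.
by move=> x /AB /span_sub.
Qed.

Lemma span_id V (A : set V) : subspace A -> span A `<=` A.
Proof. by move=> sA; apply: span_min. Qed.

Lemma spanUP V (A B : set V) x : subspace A ->
  span (A `|` B) x -> exists2 y, A y & span B (x - y).
Proof.
move=> sA; move: x; apply: span_min.
  split; first by exists 0; [exact: ss0 | rewrite subr0; exact: ss0 (span_subspace _)].
  move=> a x y [x' Ax' Bx] [y' Ay' By]; exists (a *: x' + y'); first exact: ssP.
  have -> : a *: x + y - (a *: x' + y') = a *: (x - x') + (y - y').
    by rewrite scalerBr opprD addrACA.
  exact: ssP (span_subspace _) _ _ _ _ _.
move=> x [Ax|Bx]; first by exists x => //; rewrite subrr; exact: ss0 (span_subspace _).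
by exists 0; [exact: ss0 | rewrite subr0; exact: span_sub].
Qed.

Lemma span_seqP V (s : seq V) x :
  span [set` s] x -> exists c : 'I_(size s) -> F,
    x = \sum_(i < size s) c i *: s`_i.
Proof.
move: x; apply: span_min.
  split; first by exists (fun=> 0); rewrite big1 // => i _; rewrite scale0r.
  move=> a x y [c ->] [d ->]; exists (fun i => a * c i + d i).
  rewrite scaler_sumr -big_split; apply: eq_bigr => i _ /=.
  by rewrite scalerDl scalerA.
move=> x /= xs.
have h : (index x s < size s)%N by rewrite index_mem.
exists (fun i => (i == Ordinal h)%:R).
rewrite (bigD1 (Ordinal h)) //= eqxx scale1r nth_index // big1 ?addr0 //.
by move=> i /negPf ->; rewrite scale0r.
Qed.

(* Induction on s: subtracting a vector of A whose image lies outside the span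
   of the tail of s trades a generator of the target for one of A. *)
Lemma fin_dim_lin V (W : lmodType F) (A : set V) (f : V -> W) (s : seq W) :
  subspace A -> linear f -> (forall x, A x -> span [set` s] (f x)) ->
  fin_dim (A `&` [set x | f x = 0]) -> fin_dim A.
Proof.
elim: s A => [|y s IH] A sA lf As fk.
  case: fk => t At; exists t => x Ax; apply: At; split => //=.
  have /span_seqP[c ->] := As x Ax.
  by rewrite big_ord0.
pose A' := A `&` [set x | span [set` s] (f x)].
have sA' : subspace A'.
  split; first by split; [exact: ss0 | rewrite /= (lin0 lf); exact: ss0 (span_subspace _)].
  move=> a u v [Au su] [Av sv]; split; first exact: ssP.
  by rewrite /= lf; apply: ssP (span_subspace _) _ _ _ _ _.
have fA' : fin_dim A'.
  apply: (IH A') => //; first by move=> x [].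
  case: fk => t At; exists t => x [[Ax _] fx]; exact: At.
have dec x : A x -> exists c, span [set` s] (f x - c *: y).
  move=> /As h; have [] := @spanUP _ (span [set y]) [set` s] (f x) (span_subspace _).
    apply: spanS h => u /=; rewrite inE => /orP[/eqP ->|us]; last by right.
    by left; apply: span_sub.
  move=> _ [n [a [u [ua ->]]]] h'; exists (\sum_(i < n) a i).
  move: h'; congr (span _ (_ - _)); rewrite scaler_suml; apply: eq_bigr => i _.
  by rewrite (ua i).
have [[x0 [Ax0 nx0]]|nA] := pselect (exists x, A x /\ ~ span [set` s] (f x)).
  have [c0 h0] := dec _ Ax0.
  have c0n : c0 != 0.
    by apply/eqP => c00; move: h0; rewrite c00 scale0r subr0.
  case: fA' => t At; exists (x0 :: t) => x Ax.
  have [c h] := dec _ Ax.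
  have : A' (x - (c / c0) *: x0).
    split; first by apply: (ssB sA) => //; exact: ssZ.
    rewrite /= (linB lf) (linZ lf).
    have -> : f x - (c / c0) *: f x0
      = - (c / c0) *: (f x0 - c0 *: y) + (f x - c *: y).
      by rewrite scalerBr scalerA mulNr divfK // !scaleNr opprK addrACA subrr addr0 addrC.
    exact: ssP (span_subspace _) _ _ _ _ _.
  move=> /At h'.
  rewrite -(subrK ((c / c0) *: x0) x) addrC; apply: ssP (span_subspace _) _ _ _ _ _.
    by apply: span_sub => /=; rewrite inE eqxx.
  by apply: spanS h' => u /=; rewrite inE => ->; rewrite orbT.
case: fA' => t At; exists t => x Ax; apply: At; split => //=.
by apply: contrapT => h; apply: nA; exists x.
Qed.

Lemma fin_dim_sub V (A B : set V) : A `<=` B -> fin_dim B -> fin_dim A.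
Proof. by move=> AB [s Bs]; exists s => x /AB /Bs. Qed.

Lemma fin_dim0 V : fin_dim [set (0 : V)].
Proof. by exists [::] => _ ->; exact: ss0 (span_subspace _). Qed.

(** [A] is cut by one kernel after the other. The maps will be evaluations at finitely many pairs of
    vectors, and later finitely many lowering operators. *)
Lemma fin_dim_lin_seq V (W : lmodType F) (A : set V) (I : eqType) (r : seq I)
    (f : I -> V -> W) :
  subspace A -> (forall i, linear (f i)) ->
  (forall i, i \in r -> exists2 B : set W, fin_dim B & forall x, A x -> B (f i x)) ->
  fin_dim (A `&` [set x | forall i, i \in r -> f i x = 0]) -> fin_dim A.
Proof.
move=> sA lf; elim: r A sA => [|i r IH] A sA fB fk.
  by apply: fin_dim_sub fk => x Ax; split.
have [B [s Bs] AB] := fB i (mem_head _ _).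
apply: (@fin_dim_lin _ _ A (f i) s) => // [x /AB /Bs //|].
apply: IH.
- split; first by split; [exact: ss0 | exact: lin0].
  by move=> a x y [Ax fx] [Ay fy]; split; [exact: ssP | rewrite /= lf fx fy scaler0 addr0].
- move=> j jr; have [B' fB' AB'] := fB j (mem_behead (s := i :: r) jr).
  by exists B' => // x [/AB'].
apply: fin_dim_sub fk => x [[Ax fx] h]; split => // j; rewrite inE.
by move=> /orP[/eqP ->//|]; exact: h.
Qed.

(** The coordinate matrix has more rows than columns, so its left kernel is nonzero. *)
Lemma span_dependent V (s : seq V) (n : nat) (x : 'I_n -> V) :
  (size s < n)%N -> (forall i, span [set` s] (x i)) ->
  exists c : 'I_n -> F, (exists i, c i != 0) /\ \sum_(i < n) c i *: x i = 0.
Proof.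
move=> sn xs.
have [M xM] := choice (fun i => span_seqP (xs i)).
pose A := \matrix_(i < n, j < size s) M i j.
have : kermx A != 0.
  rewrite -mxrank_eq0 -lt0n mxrank_ker subn_gt0.
  by apply: leq_ltn_trans sn; exact: rank_leq_col.
move=> /rowV0Pn[v vA v0]; exists (fun i => v 0 i); split.
  by have /rV0Pn[i vi] := v0; exists i.
under eq_bigr do rewrite xM scaler_sumr.
rewrite exchange_big big1 // => j _ /=.
under eq_bigr do rewrite scalerA.
rewrite -scaler_suml.
have /sub_kermxP/matrixP/(_ 0 j) := vA.
rewrite !mxE => h; rewrite (_ : \sum_(i < n) _ = 0) ?scale0r //.
by rewrite -[RHS]h; apply: eq_bigr => i _; rewrite mxE.
Qed.

End Subspaces.

(** * Gradings, and decompositions into generalized eigenvectors *)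

Section Gradings.
Context {F : fieldType}.

Lemma grading_subspace (I : choiceType) (W : lmodType F) (p : I -> W -> W) n :
  is_grading p -> subspace (homog p n).
Proof.
move=> hp; split; first exact: lin0 (grading_linear hp n).
by rewrite /homog /= => a x y hx hy; rewrite (grading_linear hp n) hx hy.
Qed.

Lemma grading_ind (I : choiceType) (W : lmodType F) (p : I -> W -> W) (S : set W) :
  is_grading p -> subspace S -> (forall n w, homog p n w -> S w) -> forall w, S w.
Proof.
move=> hp sS h w; rewrite -(grading_sum hp w).
have [s [us fs]] := finite_support_seq (grading_finite hp w).
apply: (ss_fsum sS us fs) => n; apply: (h n).
by rewrite /homog /= (grading_orth hp) eqxx.
Qed.

Lemma homog_uniq (I : choiceType) (W : lmodType F) (p : I -> W -> W) m n w :
  is_grading p -> homog p n w -> p m w = if m == n then w else 0.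
Proof.
by rewrite /homog /= => hp hw; rewrite -{1}hw (grading_orth hp) hw.
Qed.

End Gradings.

Section GeneralizedEigenspaces.
Context {F : fieldType} {E : lmodType F} (T : E -> E) (lT : linear T).

Definition shift (n : F) (x : E) := T x - n *: x.

(** Convertible, for T = L(0), to the condition in [gmod_L0]. *)
Definition geig (n : F) (x : E) := exists k, iter k (shift n) x = 0.

Lemma shift_linear n : linear (shift n).
Proof.
move=> a x y; rewrite /shift lT scalerDr scalerBr opprD addrACA !scalerA.
by rewrite (mulrC n).
Qed.

Lemma iter_linear (f : E -> E) k : linear f -> linear (iter k f).
Proof. by move=> lf; elim: k => // k IH a x y; rewrite !iterS IH lf. Qed.

Lemma shiftC m n x : shift m (shift n x) = shift n (shift m x).
Proof.
rewrite /shift !(linB lT) !(linZ lT) !scalerBr !scalerA (mulrC n).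
by rewrite !opprB !addrA -!addrA; congr (_ + _); rewrite addrCA [RHS]addrC -!addrA; congr (_ + _); rewrite addrC.
Qed.

Lemma iter_shiftC k l m n x :
  iter k (shift m) (iter l (shift n) x) = iter l (shift n) (iter k (shift m) x).
Proof.
elim: k => // k IH; rewrite !iterS IH.
by elim: l {IH} => // l IH; rewrite !iterS shiftC IH.
Qed.

Lemma shift_iterC k m n x :
  shift m (iter k (shift n) x) = iter k (shift n) (shift m x).
Proof. exact: (iter_shiftC 1). Qed.

Lemma iter_shift0 k n : iter k (shift n) 0 = 0.
Proof. exact: lin0 (iter_linear k (shift_linear n)). Qed.

Lemma iter_shift_le k l n x : (k <= l)%N ->
  iter k (shift n) x = 0 -> iter l (shift n) x = 0.
Proof. by move=> kl h; rewrite -(subnK kl) iterD h iter_shift0. Qed.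

Section Relative.
Variable S : set E.
Hypotheses (sS : subspace S) (TS : forall x, S x -> S (T x)).

Lemma shift_stable n x : S x -> S (shift n x).
Proof. by move=> Sx; apply: (ssB sS); [exact: TS | exact: ssZ]. Qed.

Lemma iter_shift_stable k n x : S x -> S (iter k (shift n) x).
Proof. by move=> Sx; elim: k => // k IH; rewrite iterS; exact: shift_stable. Qed.

(** By induction both shifts of [x] lie in [S], and their difference is a nonzero multiple of [x].
    The version relative to a stable [S] serves twice: [S] = 0 gives uniqueness of decompositions, a
    submodule [S] gives that it contains the components of its elements. *)
Lemma geig_coprime m n K k x : m != n ->
  S (iter K (shift m) x) -> S (iter k (shift n) x) -> S x.
Proof.
move=> mn; elim: K k x => // K IHK; elim=> // k IHk x hm hn.
have Sm : S (shift m x).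
  apply: (IHK k.+1); first by rewrite -iterSr.
  by have := shift_stable m hn; rewrite shift_iterC.
have Sn : S (shift n x).
  apply: IHk; last by rewrite -iterSr.
  by have := shift_stable n hm; rewrite shift_iterC.
have : S (shift m x - shift n x) by exact: ssB.
rewrite /shift opprB addrC addrA subrK -scalerBl => h.
have := ssZ sS (n - m)^-1 h; rewrite scalerA mulVf ?scale1r //.
by rewrite subr_eq0 eq_sym.
Qed.

Lemma geig_independent (s : seq F) (x : F -> E) : uniq s ->
  (forall n, n \in s -> exists k, S (iter k (shift n) (x n))) ->
  S (\sum_(n <- s) x n) -> forall n, n \in s -> S (x n).
Proof.
elim: s x => // m s IH x /=/andP[ms us] gx.
rewrite big_cons => Sx.
have [K hK] := gx m (mem_head _ _).
have h n : n \in s -> S (x n).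
  move=> ns.
  have nm : m != n by apply: contraNneq ms => ->.
  have [k hk] := gx n (mem_behead (s := m :: s) ns).
  apply: (geig_coprime (K := K) nm _ hk).
  (* Applying [K] shifts by [m] to the whole sum puts its [m] term into [S], which leaves a sum over
     the shorter list. *)
  apply: (IH (fun n => iter K (shift m) (x n))) => //.
    move=> n' n's; have [k' hk'] := gx n' (mem_behead (s := m :: s) n's).
    by exists k'; rewrite iter_shiftC; apply: iter_shift_stable.
  rewrite -(lin_sum (iter_linear K (shift_linear m))).
  apply: (ssDr sS hK).
  by rewrite -(linD (iter_linear K (shift_linear m))); apply: iter_shift_stable.
move=> n; rewrite inE => /orP[/eqP ->|]; last exact: h.
by apply: (ssDr sS _ (_ : S (_ + x m))); [exact: (ss_sum_seq sS h) | rewrite addrC].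
Qed.

End Relative.

Lemma geig_lin n a x y : geig n x -> geig n y -> geig n (a *: x + y).
Proof.
move=> [k hk] [l hl]; exists (maxn k l).
rewrite (iter_linear _ (shift_linear n)).
by rewrite (iter_shift_le (leq_maxl _ _) hk) (iter_shift_le (leq_maxr _ _) hl) scaler0 addr0.
Qed.

Lemma geig0 n : geig n 0.
Proof. by exists 0%N. Qed.

Definition geig_rep (x : E) (f : F -> E) := exists s : seq F,
  [/\ uniq s, forall n, n \notin s -> f n = 0, forall n, geig n (f n)
    & x = \sum_(n <- s) f n].

Lemma geig_rep_lin a x y f g : geig_rep x f -> geig_rep y g ->
  geig_rep (a *: x + y) (fun n => a *: f n + g n).
Proof.
move=> [s [us fs gf ->]] [t [ut gt gg ->]].
exists (undup (s ++ t)); split; first exact: undup_uniq.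
- move=> n; rewrite mem_undup mem_cat negb_or => /andP[/fs -> /gt ->].
  by rewrite scaler0 addr0.
- by move=> n; apply: geig_lin.
rewrite big_split -scaler_sumr /=; congr (_ *: _ + _).
  rewrite -(fsumE us fs); apply: fsumE; first exact: undup_uniq.
  by move=> n; rewrite mem_undup mem_cat negb_or => /andP[/fs].
rewrite -(fsumE ut gt); apply: fsumE; first exact: undup_uniq.
by move=> n; rewrite mem_undup mem_cat negb_or => /andP[_ /gt].
Qed.

Lemma geig_rep_eq0 f : geig_rep 0 f -> forall n, f n = 0.
Proof.
move=> [s [us fs gf /esym f0]] n; have [ns|] := boolP (n \in s); last exact: fs.
have sS : subspace [set (0 : E)].
  by split=> // a x y -> ->; rewrite scaler0 addr0.
have TS x : [set (0 : E)] x -> [set (0 : E)] (T x) by move=> ->; exact: lin0.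
apply: (geig_independent sS TS us (x := f)) => //.
by move=> m _; exact: gf.
Qed.

Lemma geig_rep_uniq x f g : geig_rep x f -> geig_rep x g -> f = g.
Proof.
move=> rf rg; apply/funext => n; apply/eqP.
have := geig_rep_lin (-1) rg rf; rewrite scaleN1r addNr => /geig_rep_eq0/(_ n).
by rewrite scaleN1r addrC => /eqP; rewrite subr_eq0.
Qed.

Lemma geig_rep1 n x : geig n x -> geig_rep x (fun m => if m == n then x else 0).
Proof.
move=> gx; exists [:: n]; split => //.
- by move=> m; rewrite inE => /negPf ->.
- by move=> m; case: eqP => [->//|_]; exact: geig0.
by rewrite big_seq1 eqxx.
Qed.

(** Decompositions are unique, so choosing one for each vector already yields linear projections.
    For box products, submodules and quotients it then suffices to decompose every vector. *)
Lemma geig_grading : (forall x, exists f, geig_rep x f) ->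
  exists pi : F -> E -> E,
    is_grading pi /\ forall n w, homog pi n w <-> geig n w.
Proof.
move=> /choice[p pP]; exists (fun n x => p x n).
have pE x f : geig_rep x f -> p x = f by exact: geig_rep_uniq.
have pg n w : geig n (p w n) by have [s []] := pP w.
split; last first.
  move=> n w; split => [<-//|]; rewrite /homog /= => gw.
  by rewrite (pE _ _ (geig_rep1 gw)) eqxx.
split.
- by move=> n a x y; rewrite (pE _ _ (geig_rep_lin a (pP x) (pP y))).
- by move=> m n w; rewrite (pE _ _ (geig_rep1 (pg n w))).
- move=> w; have [s [us fs _ _]] := pP w.
  apply: (sub_finite_set _ (finite_seq s)) => n /=.
  by apply: contraNT => /fs ->.
- by move=> w; have [s [us fs _ wE]] := pP w; rewrite (fsumE us fs).
Qed.

End GeneralizedEigenspaces.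

(** * Binomial coefficients and modes *)

Section Binomials.
Context {F : numFieldType}.
Implicit Types (a m : int) (i r : nat).
Local Notation binomz := (@binomz F).

Lemma binomz0 a : binomz a 0 = 1.
Proof. by rewrite /Defs.binomz big_ord0 fact0 divr1. Qed.

Lemma natf_neq0 r : r.+1%:R != 0 :> F.
Proof. by rewrite pnatr_eq0. Qed.

Lemma factf_neq0 r : r`!%:R != 0 :> F.
Proof. by rewrite pnatr_eq0 -lt0n fact_gt0. Qed.

Lemma binomz_rec a i :
  i.+1%:R * binomz a i.+1 = (a%:~R - i%:R) * binomz a i.
Proof.
rewrite /Defs.binomz big_ord_recr /= factS natrM invfM.
have := natf_neq0 i; have := factf_neq0 i.
by move: (i.+1%:R) (i`!%:R) => x y y0 x0; field; rewrite x0 y0.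
Qed.

Lemma binomz_recl a i : i.+1%:R * binomz (a + 1) i.+1 = (a + 1)%:~R * binomz a i.
Proof.
rewrite /Defs.binomz big_ord_recl /= factS natrM invfM subr0.
have -> : \prod_(j < i) ((a + 1)%:~R - (bump 0 j)%:R) =
  \prod_(j < i) (a%:~R - j%:R) :> F.
  by apply: eq_bigr => j _; rewrite /bump add1n intrD -natr1 opprD addrACA subrr addr0.
have := natf_neq0 i; have := factf_neq0 i.
by move: (i.+1%:R) (i`!%:R) => x y y0 x0; field; rewrite x0 y0.
Qed.

Lemma binomz_pascal a i : binomz (a + 1) i.+1 = binomz a i.+1 + binomz a i.
Proof.
apply: (mulfI (natf_neq0 i)); rewrite binomz_recl mulrDr binomz_rec -mulrDl.
by congr (_ * _); rewrite intrD -natr1; ring.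
Qed.

Lemma binomz_small (n : nat) i : (n < i)%N -> binomz n%:Z i = 0.
Proof.
move=> ni; rewrite /Defs.binomz (bigD1 (Ordinal ni)) //=.
by rewrite -pmulrn subrr !mul0r.
Qed.

Lemma binomz1 a : binomz a 1 = a%:~R.
Proof.
by have := binomz_rec a 0; rewrite binomz0 mul1r subr0 mulr1.
Qed.

(** Upper negation: reverse the product and change the sign of each factor. It turns the
    coefficients on the right of the Jacobi identity into ordinary binomials. *)
Lemma subx_opp m i : subx F (i%:Z - m - 1) i = binomz m i.
Proof.
rewrite /subx /Defs.binomz mulrA -[in (-1) ^+ i](card_ord i) -prodrN.
congr (_ / _); rewrite [RHS](reindex_inj rev_ord_inj) /=.
apply: eq_bigr => j _.
rewrite natrB ?ltn_ord // -natr1 !intrD !intrN -pmulrn.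
by ring.
Qed.

Lemma subx_rec k i : i.+1%:R * subx F k i.+1 = (i%:R - k%:~R) * subx F k i.
Proof.
by rewrite /subx exprS mulrCA binomz_rec; ring.
Qed.

Lemma subx_k0 k : subx F k 0 = 1.
Proof. by rewrite /subx binomz0 mulr1. Qed.

Lemma subxN1 i : subx F (-1) i = 1.
Proof.
elim: i => [|i IH]; first exact: subx_k0.
apply: (mulfI (natf_neq0 i)); rewrite subx_rec IH -natr1.
by rewrite intrN opprK.
Qed.

Lemma subxN2 i : subx F (-2) i = i.+1%:R.
Proof.
elim: i => [|i IH]; first exact: subx_k0.
apply: (mulfI (natf_neq0 i)); rewrite subx_rec IH -!natr1.
by rewrite intrN opprK; ring.
Qed.

Lemma subx0 i : (0 < i)%N -> subx F 0 i = 0.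
Proof. by move=> i0; rewrite /subx (@binomz_small 0) ?mulr0. Qed.

(** The coefficient of x^r in (1+x)^a (1 - x/(1+x))^m. Since 1 - x/(1+x) = 1/(1+x), it should be
    that of (1+x)^(a-m). *)
Definition binomz_sum m a r : F :=
  \sum_(i < r.+1) (-1) ^+ i * binomz m i * binomz (a - i%:Z) (r - i).

Lemma binomz_sumS m a r :
  binomz_sum (m + 1) a r.+1 = binomz_sum m a r.+1 - binomz_sum m (a - 1) r.
Proof.
rewrite /binomz_sum big_ord_recl [in RHS]big_ord_recl !binomz0 -addrA.
congr (_ + _); rewrite -sumrN -big_split; apply: eq_bigr => i _ /=.
rewrite /bump add1n binomz_pascal subSS exprS.
have -> : a - i.+1%:Z = a - 1 - i%:Z by lia.
by ring.
Qed.

Lemma binomz_sum0 m a : binomz_sum m a 0 = 1.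
Proof. by rewrite /binomz_sum big_ord1 !binomz0 !mulr1. Qed.

Lemma binomz_sumE m a r : binomz_sum m a r = binomz (a - m) r.
Proof.
elim/int_rect: m a r => [|n IH|n IH] a r.
- rewrite /binomz_sum big_ord_recl big1 ?addr0; last first.
    by move=> i _; rewrite (@binomz_small 0) ?mulr0 ?mul0r.
  by rewrite binomz0 subn0 !mul1r.
- case: r => [|r]; first by rewrite binomz_sum0 binomz0.
  have -> : n.+1%:Z = n%:Z + 1 by lia.
  rewrite binomz_sumS !IH.
  have -> : a - n%:Z = (a - (n%:Z + 1)) + 1 by lia.
  have -> : a - 1 - n%:Z = (a - (n%:Z + 1)) by lia.
  by rewrite binomz_pascal addrK.
(* For negative m the recurrence is solved for the smaller m, at the cost of a term with the same m
   and r lowered by one; hence the inner induction. *)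
elim: r a => [|r IHr] a; first by rewrite binomz_sum0 binomz0.
have /eqP := binomz_sumS (- n.+1%:Z) a r.
rewrite IHr [in X in X == _](_ : - n.+1%:Z + 1 = - n%:Z) ?IH; last by lia.
rewrite eq_sym subr_eq => /eqP ->.
have -> : a - - n.+1%:Z = (a - - n%:Z) + 1 by lia.
have -> : a - 1 - - n.+1%:Z = a - - n%:Z by lia.
by rewrite binomz_pascal.
Qed.

End Binomials.

Section Action.
Context {R : realType} (V : voa R) (W : lmodType R[i]).
Variable YW : V -> int -> W -> W.
Local Notation Y := (@voa_Y _ V).
Local Notation om := (voa_om V).
Local Notation vac := (voa_vac V).
Local Notation L n := (Lop om Y n).
Local Notation LW n := (Lop om YW n).
Hypothesis hW : vertex_action Y vac om (voa_c V) YW.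

Lemma act_lin_sum_l (I : Type) (s : seq I) (P : pred I) (g : I -> V) n w :
  YW (\sum_(i <- s | P i) g i) n w = \sum_(i <- s | P i) YW (g i) n w.
Proof. exact: (lin_sum (act_linear_l hW n w)). Qed.

Lemma actZl a v n w : YW (a *: v) n w = a *: YW v n w.
Proof. exact: (linZ (act_linear_l hW n w)). Qed.
Lemma act0l n w : YW 0 n w = 0.
Proof. exact: (lin0 (act_linear_l hW n w)). Qed.
Lemma act0r v n : YW v n 0 = 0.
Proof. exact: (lin0 (act_linear_r hW v n)). Qed.
Lemma actZr a v n w : YW v n (a *: w) = a *: YW v n w.
Proof. exact: (linZ (act_linear_r hW v n)). Qed.
Lemma Lop_linear n : linear (LW n).
Proof. exact: (act_linear_r hW om (n + 1)). Qed.

Lemma act_trunc_nat v w (n : int) : exists K : nat, forall i : nat, (K <= i)%N ->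
  YW v (n + i%:Z) w = 0.
Proof.
have [N hN] := act_truncation hW v w.
exists `|N - n|%N => i Ki; apply: hN; lia.
Qed.

(** The case l = 0 of the Jacobi identity: on the left only the terms i = 0 survive. *)
Lemma act_commutator u v m n w :
  YW u m (YW v n w) - YW v n (YW u m w)
  = \sum_(i \in [set: nat]) binomz _ m i *: YW (Y u i%:Z v) (m + n - i%:Z) w.
Proof.
have := act_jacobi hW u v w 0 m n.
have h (f : nat -> W) : \sum_(i \in [set: nat]) subx _ 0 i *: f i = f 0%N.
  rewrite (@fsum1 _ _ 0%N) /subx ?binomz0 ?expr0 ?mulr1 ?scale1r // => i i0.
  by rewrite (@binomz_small _ 0) ?mulr0 ?scale0r // lt0n.
rewrite !expr0z; under [X in _ - X]eq_fsbigr do rewrite mul1r.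
rewrite [X in X - _ = _]h [X in _ - X = _]h.
have e1 k : k + 0 - 0%:Z = k by lia.
have e2 k : k + 0%:Z = k by lia.
rewrite !e1 !e2 => ->.
by apply: eq_fsbigr => i _; rewrite subx_opp add0r.
Qed.

Lemma fsum_nat3 (E : nmodType) (f : nat -> E) :
  (forall i, (3 <= i)%N -> f i = 0) ->
  \sum_(i \in [set: nat]) f i = f 0%N + (f 1%N + f 2%N).
Proof. by move=> /fsum_nat ->; rewrite !big_ord_recl big_ord0 addr0. Qed.

(** Commutator with the mode om_1: binom(1,i) = 0 for i > 1 leaves L(-1)v and L(0)v, and the
    derivative axiom turns the mode n+1 of L(-1)v into a multiple of v_n. *)
Lemma act_L0 a v n w : homog (@voa_pi _ V) a v ->
  LW 0 (YW v n w) = YW v n (LW 0 w) + (a - n - 1)%:~R *: YW v n w.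
Proof.
move=> hv; apply/eqP; rewrite addrC -subr_eq.
rewrite /Lop act_commutator add0r fsum_nat3 => [|i i3]; last first.
  by rewrite (@binomz_small _ 1) ?scale0r // (leq_trans _ i3).
rewrite binomz0 binomz1 (@binomz_small _ 1 2) // scale0r !scale1r.
have -> : Y om 0%N v = L (-1) v by [].
have -> : Y om 1%N v = L 0 v by [].
rewrite (act_derivative hW) (voa_L0 (voa_axioms V) hv) actZl.
have -> : 1 + n - 0%N%:Z - 1 = n by lia.
have -> : 1 + n - 1%N%:Z = n by lia.
apply/eqP; rewrite !addr0 -scalerDl; congr (_ *: _); rewrite !intrD; ring.
Qed.

Lemma act_L1 a v n w : homog (@voa_pi _ V) a v ->
  LW 1 (YW v n w) = YW (L 1 v) n w + (2 * a - n - 2)%:~R *: YW v (n + 1) w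
                    + YW v n (LW 1 w).
Proof.
move=> hv; apply/eqP; rewrite -subr_eq.
rewrite /Lop act_commutator fsum_nat3 => [|i i3]; last first.
  by rewrite (@binomz_small _ 2) ?scale0r.
rewrite binomz0 binomz1 !scale1r.
have -> : Y om 0%N v = L (-1) v by [].
have -> : Y om 1%N v = L 0 v by [].
have -> : Y om 2%N v = L 1 v by [].
rewrite (act_derivative hW) (voa_L0 (voa_axioms V) hv) actZl scalerA.
have -> : binomz R[i] (1 + 1) 2 = 1.
  apply: (mulfI (natf_neq0 (F := R[i]) 1)).
  by rewrite binomz_rec binomz1 intrD mulr1; ring.
have -> : 1 + 1 + n - 0%N%:Z - 1 = n + 1 by lia.
have -> : 1 + 1 + n - 1%N%:Z = n + 1 by lia.
have -> : 1 + 1 + n - 2%N%:Z = n by lia.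
rewrite scale1r addrA -scalerDl addrC; apply/eqP; congr (_ + _ *: _).
by rewrite !intrD !intrM; ring.
Qed.

End Action.

(** * Weights in V, and the derivative axiom as a case of the Jacobi identity *)

Section VOAFacts.
Context {R : realType} (V : voa R).
Local Notation Y := (@voa_Y _ V).
Local Notation pi := (@voa_pi _ V).
Local Notation om := (voa_om V).
Local Notation vac := (voa_vac V).
Local Notation L n := (Lop om Y n).

Lemma voa_vertex_action : vertex_action Y vac om (voa_c V) Y.
Proof. exact: voa_action (voa_axioms V). Qed.
Local Notation hY := voa_vertex_action.

Lemma voa_is_grading : is_grading pi.
Proof. exact: voa_grading (voa_axioms V). Qed.
Local Notation hpi := voa_is_grading.

Lemma homog_voa_pi n v : homog pi n (pi n v).
Proof. by rewrite /homog /= (grading_orth hpi) eqxx. Qed.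

Lemma voa_ind (S : set V) : subspace S -> (forall n v, homog pi n v -> S v) ->
  forall v, S v.
Proof. exact: grading_ind hpi. Qed.

(** For the converse, L(0)v is computed on each component: a component of weight m other than n is
    killed by the nonzero scalar m - n. With V_(n) known to be a full eigenspace, the weights of
    products follow from [act_L0]. *)
Lemma voa_homogP n v : homog pi n v <-> L 0 v = n%:~R *: v.
Proof.
split; first exact: voa_L0 (voa_axioms V) _ _.
move=> h; rewrite /homog /=.
have [s [us fs]] := finite_support_seq (grading_finite hpi v).
have hm m : pi m (L 0 v) = m%:~R *: pi m v.
  rewrite -[in LHS](grading_sum hpi v) (lin_fsum (Lop_linear hY 0) us fs).
  rewrite (lin_fsum (grading_linear hpi m) us); last first.
    by move=> i /fs ->; exact: lin0 (Lop_linear hY 0).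
  rewrite (fsum1 (n := m)) => [|i im].
    rewrite (voa_L0 (voa_axioms V) (homog_voa_pi m v)) (linZ (grading_linear hpi m)).
    by rewrite homog_voa_pi.
  rewrite (voa_L0 (voa_axioms V) (homog_voa_pi i v)) (linZ (grading_linear hpi m)).
  by rewrite (grading_orth hpi) eq_sym (negPf im) scaler0.
rewrite -[RHS](grading_sum hpi v) (fsum1 (n := n)) // => m mn.
have := hm m; rewrite h (linZ (grading_linear hpi m)) => /eqP.
rewrite -subr_eq0 -scalerBl scaler_eq0 -intrB intr_eq0 subr_eq0 eq_sym (negPf mn).
by move=> /eqP.
Qed.

Lemma homog_Y a b u v n : homog pi a u -> homog pi b v ->
  homog pi (a + b - n - 1) (Y u n v).
Proof.
move=> hu hv; apply/voa_homogP; rewrite (act_L0 hY _ _ hu).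
rewrite (voa_L0 (voa_axioms V) hv) (actZr hY) -scalerDl; congr (_ *: _).
by rewrite !intrD; ring.
Qed.

Lemma homog_om : homog pi 2 om.
Proof. exact: voa_om_weight (voa_axioms V). Qed.
Lemma homog_vac : homog pi 0 vac.
Proof. exact: voa_vac_weight (voa_axioms V). Qed.

Lemma homog_L a v n : homog pi a v -> homog pi (a - n) (L n v).
Proof.
move=> /(homog_Y (n + 1) homog_om); congr (homog _ _ _); lia.
Qed.

Lemma homog_iterL a v n k : homog pi a v -> homog pi (a - k%:Z * n) (iter k (L n) v).
Proof.
move=> hv; elim: k => [|k IH]; first by rewrite mul0r subr0.
rewrite iterS; have := homog_L n IH; congr (homog _ _ _); lia.
Qed.

Lemma voa_homog_small : exists N : int, forall a v, homog pi a v -> a < N -> v = 0.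
Proof.
have [N hN] := voa_trunc (voa_axioms V).
by exists N => a v; rewrite /homog /= => hv aN; rewrite -hv hN.
Qed.

Lemma L_vac n : - 1 <= n -> L n vac = 0.
Proof.
by move=> n1; apply: (voa_creation (voa_axioms V) om).2; lia.
Qed.

Lemma creation1 v : Y v (-1) vac = v.
Proof. exact: (voa_creation (voa_axioms V) v).1. Qed.
Lemma creation2 v : Y v (-2) vac = L (-1) v.
Proof.
have := act_derivative hY v (-1) vac.
by rewrite creation1 opprK scale1r => ->.
Qed.

(** L(1)L(-2) applied to the vacuum is 3L(-1) applied to it, which is 0. Hence e^(xL(1)) fixes the
    conformal vector, and transposition will exchange L(n) and L(-n). *)
Lemma L1_om : L 1 om = 0.
Proof.
have e : L (-2) vac = om by rewrite /Lop creation1.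
have := act_virasoro hY 1 (-2) vac.
rewrite e (L_vac (n := 1)) // (L_vac (n := 1 + -2)) //.
by rewrite (lin0 (Lop_linear hY _)) subr0 scaler0 add0r.
Qed.

(** Jacobi identity for v and the vacuum with l = -2 and m = 0: on the right only v_{-2} of the
    vacuum, that is L(-1)v, remains. This supplies the derivative axiom for all modules constructed
    below. *)
Lemma jacobi_derivative (W : lmodType R[i]) (YW : V -> int -> W -> W) w :
  (forall v n, linear (YW v n)) ->
  (forall n w, YW vac n w = if n == -1 then w else 0) ->
  (forall u v (l m n : int),
    \sum_(i \in [set: nat])
       subx _ l i *: YW u (m + l - i%:Z) (YW v (n + i%:Z) w)
    - \sum_(i \in [set: nat])
       ((-1) ^ l * subx _ l i) *: YW v (n + l - i%:Z) (YW u (m + i%:Z) w)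
    = \sum_(i \in [set: nat])
       subx _ (i%:Z - m - 1) i *: YW (Y u (l + i%:Z) v) (m + n - i%:Z) w) ->
  forall v n, YW (L (-1) v) n w = - n%:~R *: YW v (n - 1) w.
Proof.
move=> linr Yvac jac v n.
have Y0 u k : YW u k 0 = 0 by exact: lin0.
apply: (etrans _ (etrans (esym (jac v vac (-2) 0 n)) _)).
  rewrite (fsum1 (n := 0%N)) => [|i i0].
    by rewrite subx_k0 scale1r addr0 creation2 add0r subr0.
  have -> : i%:Z - 0 - 1 = i.-1%:Z by lia.
  by rewrite /subx (@binomz_small _ i.-1) ?mulr0 ?scale0r //; lia.
(* The vacuum acts only through its mode -1. It selects i = -n-1 in the first sum for n < 0, i = n-1
   in the second for n > 0, and nothing for n = 0. *)
have [n0|n0] := ltP n 0.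
  rewrite (fsum1 (n := absz (n + 1))) => [|i /eqP ni]; last first.
    by rewrite Yvac ifF ?Y0 ?scaler0 //; apply/eqP; lia.
  rewrite Yvac ifT; last by apply/eqP; lia.
  rewrite [X in _ - X]fsbig1 ?subr0 => [|i _]; last first.
    by rewrite Yvac ifF ?scaler0 //; apply/eqP; lia.
  rewrite subxN2; congr (_ *: YW _ _ _); last by lia.
  by rewrite -intrN pmulrn; congr (_%:~R); lia.
rewrite fsbig1 => [|i _]; last first.
  by rewrite Yvac ifF ?Y0 ?scaler0 //; apply/eqP; lia.
rewrite sub0r.
have [->|nn0] := eqVneq n 0.
  rewrite fsbig1 => [|i _]; first by rewrite !oppr0 scale0r.
  by rewrite Yvac ifF ?scaler0 //; apply/eqP; lia.
rewrite (fsum1 (n := absz (n - 1))) => [|i /eqP ni]; last first.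
  by rewrite Yvac ifF ?scaler0 //; apply/eqP; lia.
rewrite Yvac ifT; last by apply/eqP; lia.
rewrite subxN2 -scaleNr; congr (_ *: YW _ _ _); last by lia.
have -> : (-1) ^ (-2) = 1 :> R[i].
  by rewrite (_ : -2 = - (2%:Z)) // -exprnN sqrrN expr1n invr1.
by rewrite mul1r pmulrn; congr (- _%:~R); lia.
Qed.

End VOAFacts.
(** * Conjugation of vertex operators by exp(x L(1)) *)

Section NatSums.
Context {E : zmodType}.

Lemma triangle_exchange t (g : nat -> nat -> E) :
  \sum_(i < t.+1) \sum_(j < (t - i).+1) g i j
  = \sum_(j < t.+1) \sum_(i < (t - j).+1) g i j.
Proof.
have widen (h : nat -> nat -> E) : \sum_(i < t.+1) \sum_(j < (t - i).+1) h i j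
    = \sum_(i < t.+1) \sum_(j < t.+1 | (i + j <= t)%N) h i j.
  apply: eq_bigr => i _.
  rewrite (big_ord_widen t.+1 (h i)); last by rewrite ltnS leq_subr.
  by apply: eq_bigl => j; rewrite ltnS leq_subRL // -ltnS.
rewrite widen (widen (fun i j => g j i)) (exchange_big_dep xpredT) //=.
by apply: eq_bigr => j _; apply: eq_bigl => i; rewrite addnC.
Qed.

Lemma sum_antidiagonal (N M : nat) (g : nat -> nat -> E) :
  (forall j i, (N <= j)%N || (M <= i)%N -> g j i = 0) ->
  \sum_(j < N) \sum_(i < M) g j i
  = \sum_(t < (N + M).+1) \sum_(j < t.+1) g j (t - j)%N.
Proof.
move=> g0.
have -> : \sum_(t < (N + M).+1) \sum_(j < t.+1) g j (t - j)%N
   = \sum_(t < (N + M).+1) \sum_(j < (N + M - t).+1) g j (N + M - t - j)%N.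
  rewrite (reindex_inj rev_ord_inj); apply: eq_bigr => t _ /=.
  by rewrite subSS.
rewrite (triangle_exchange _ (fun t j => g j (N + M - t - j)%N)).
rewrite (big_ord_widen (N + M).+1 (fun j => \sum_(i < M) g j i)); last by lia.
rewrite big_mkcond; apply: eq_bigr => j _.
rewrite [RHS](reindex_inj rev_ord_inj) /=.
case: ifPn => [jN|]; last first.
  by rewrite -leqNgt => jN; rewrite big1 // => i _; rewrite g0 // jN.
rewrite (big_ord_widen (N + M - j).+1 (g j)); last by lia.
rewrite big_mkcond; apply: eq_bigr => i _; rewrite subSS.
have -> : (N + M - (N + M - j - i) - j = i)%N by have := ltn_ord i; lia.
by case: ifPn => //; rewrite -leqNgt => Mi; rewrite g0 // Mi orbT.
Qed.

(** Sum over the triples with j + k + i = s, the degree s part of a product of three power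
    series. *)
Definition trisum (s : nat) (f : nat -> nat -> nat -> E) :=
  \sum_(j < s.+1) \sum_(k < (s - j).+1) f j k (s - j - k)%N.

Lemma eq_trisum s f g :
  (forall j k i, (j + k + i)%N = s -> f j k i = g j k i) ->
  trisum s f = trisum s g.
Proof.
move=> fg; apply: eq_bigr => j _; apply: eq_bigr => k _; apply: fg.
have := ltn_ord j; have := ltn_ord k; lia.
Qed.

Lemma trisumD s f g :
  trisum s (fun j k i => f j k i + g j k i) = trisum s f + trisum s g.
Proof.
by rewrite /trisum -big_split; apply: eq_bigr => j _; rewrite -big_split.
Qed.

Lemma trisumS1 s f : (forall k i, f 0%N k i = 0) ->
  trisum s.+1 f = trisum s (fun j k i => f j.+1 k i).
Proof.
move=> f0; rewrite /trisum big_ord_recl [X in X + _]big1 => [|k _].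
  by rewrite add0r; apply: eq_bigr => j _; rewrite lift0 subSS.
exact: f0.
Qed.

Lemma trisumS2 s f : (forall j i, f j 0%N i = 0) ->
  trisum s.+1 f = trisum s (fun j k i => f j k.+1 i).
Proof.
move=> f0; rewrite /trisum big_ord_recr /= subnn big_ord1 f0 addr0.
apply: eq_bigr => j _; have js : (j <= s)%N by rewrite -ltnS.
rewrite (subSn js) big_ord_recl f0 add0r.
by apply: eq_bigr => k _; rewrite lift0 subSS.
Qed.

Lemma trisumS3 s f : (forall j k, f j k 0%N = 0) ->
  trisum s.+1 f = trisum s (fun j k i => f j k i.+1).
Proof.
move=> f0; rewrite /trisum big_ord_recr /= subnn big_ord1 f0 addr0.
apply: eq_bigr => j _; have js : (j <= s)%N by rewrite -ltnS.
rewrite (subSn js) big_ord_recr /= subnn f0 addr0.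
apply: eq_bigr => k _; have ks : (k <= s - j)%N by rewrite -ltnS.
by rewrite (subSn ks).
Qed.

Lemma trisum_exchange t (f : nat -> nat -> nat -> nat -> E) :
  \sum_(i < t.+1) trisum (t - i) (f i)
  = trisum t (fun j k r => \sum_(i < r.+1) f i j k (r - i)%N).
Proof.
rewrite /trisum (triangle_exchange t (fun i j => \sum_(k < (t - i - j).+1) f i j k (t - i - j - k)%N)).
apply: eq_bigr => j _.
under eq_bigr do rewrite subnAC.
rewrite (triangle_exchange _ (fun i k => f i j k (t - j - i - k)%N)).
by apply: eq_bigr => k _; apply: eq_bigr => i _; rewrite [(t - j - i - k)%N]subnAC.
Qed.

Lemma trisum_total (N M K : nat) (f : nat -> nat -> nat -> E) :
  (forall j k i, [|| (N <= j)%N, (M <= k)%N | (K <= i)%N] -> f j k i = 0) ->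
  \sum_(j < N) \sum_(k < M) \sum_(i < K) f j k i
  = \sum_(t < (N + (M + K).+1).+1) trisum t f.
Proof.
move=> f0; rewrite /trisum.
rewrite -(@sum_antidiagonal _ _ (fun j r => \sum_(k < r.+1) f j k (r - k)%N)).
  apply: eq_bigr => j _; apply: sum_antidiagonal => k i h.
  by apply: f0; rewrite h orbT.
move=> j r h; rewrite big1 // => k _; apply: f0; have := ltn_ord k; lia.
Qed.

Lemma unif_bound (J : nat) (P : nat -> nat -> Prop) :
  (forall j, exists K, forall i, (K <= i)%N -> P j i) ->
  exists K, forall j, (j < J)%N -> forall i, (K <= i)%N -> P j i.
Proof.
move=> h; elim: J => [|J [K hK]]; first by exists 0%N.
have [K' hK'] := h J; exists (maxn K K') => j.
rewrite ltnS leq_eqVlt => /orP[/eqP -> i|jJ i]; rewrite geq_max => /andP[Ki K'i].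
  exact: hK'.
exact: hK.
Qed.

End NatSums.

Lemma fsum_linear (F : fieldType) (V W : lmodType F) (f : nat -> V -> W) :
  (forall i, linear (f i)) ->
  (forall x, exists K, forall i, (K <= i)%N -> f i x = 0) ->
  linear (fun x => \sum_(i \in [set: nat]) f i x).
Proof.
move=> lf tf a x y; have [Kx hx] := tf x; have [Ky hy] := tf y.
have hK i : (maxn Kx Ky <= i)%N -> f i x = 0 /\ f i y = 0.
  by rewrite geq_max => /andP[/hx -> /hy ->].
rewrite (fsum_nat (fun i Ki => (hK i Ki).1)) (fsum_nat (fun i Ki => (hK i Ki).2)).
rewrite (@fsum_nat _ (maxn Kx Ky)) => [|i /hK[fx fy]]; last first.
  by rewrite lf fx fy scaler0 addr0.
by rewrite scaler_sumr -big_split; apply: eq_bigr => i _; rewrite lf.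
Qed.

Lemma trisumZ (F : fieldType) (E : lmodType F) (c : F) s
    (f : nat -> nat -> nat -> E) :
  c *: trisum s f = trisum s (fun j k i => c *: f j k i).
Proof.
by rewrite /trisum scaler_sumr; apply: eq_bigr => j _; rewrite scaler_sumr.
Qed.

Section Theta.
Context {R : realType} (V : voa R).
Local Notation Y := (@voa_Y _ V).
Local Notation pi := (@voa_pi _ V).
Local Notation om := (voa_om V).
Local Notation L n := (Lop om Y n).
Local Notation hY := (voa_vertex_action V).
Local Notation hpi := (voa_is_grading V).

Definition dL (j : nat) (v : V) : V := j`!%:R^-1 *: iter j (L 1) v.

Lemma dL_linear j : linear (dL j).
Proof.
move=> a x y; rewrite /dL (iter_linear j (Lop_linear hY 1)) scalerDr !scalerA.
by rewrite mulrC.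
Qed.

Lemma dL_rec j v : L 1 (dL j v) = j.+1%:R *: dL j.+1 v.
Proof.
rewrite /dL (linZ (Lop_linear hY 1)) scalerA factS natrM invfM mulrA.
by rewrite divff ?mul1r // natf_neq0.
Qed.

Lemma dL0 v : dL 0 v = v.
Proof. by rewrite /dL fact0 invr1 scale1r. Qed.

Lemma homog_dL a v j : homog pi a v -> homog pi (a - j%:Z) (dL j v).
Proof.
move=> hv; apply: (ssZ (grading_subspace _ hpi)).
by have := homog_iterL 1 j hv; rewrite mulr1.
Qed.

Lemma dL_trunc a : exists J : nat, forall j, (J <= j)%N ->
  forall v, homog pi a v -> dL j v = 0.
Proof.
have [N hN] := voa_homog_small V.
exists (absz (a - N + 1)) => j Jj v hv; apply: (hN _ _ (homog_dL j hv)); lia.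
Qed.

Lemma thetaE v a j : theta v a j = (-1) ^ a *: dL j (pi a v).
Proof. by rewrite /theta /dL scalerA. Qed.

(* Coefficients of e^(x L(1)) Y(u,x_0) v
     = Y(e^(x(1-x x_0)L(1)) (1-x x_0)^(-2L(0)) u, x_0/(1-x x_0)) e^(x L(1)) v. *)
Lemma dL_Y a u l v s : homog pi a u ->
  dL s (Y u l v) = trisum s (fun j k i =>
    binomz _ (2 * a - j%:Z - l - 2) i *: Y (dL j u) (l + i%:Z) (dL k v)).
Proof.
move=> hu; elim: s => [|s IH].
  rewrite /trisum big_ord1 subn0 big_ord1 /= binomz0 !dL0 addr0.
  by rewrite scale1r.
apply: (@scalerI _ _ s.+1%:R); first exact: natf_neq0.
rewrite -dL_rec IH.
pose e j k i := Y (dL j u) (l + i%:Z) (dL k v).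
pose A (j : nat) := 2 * a - j%:Z - l - 2.
(* By [act_L1], L(1) raises one of j, i, k by one. [f1], [f2], [f3] are the resulting terms in the
   raised index, hence zero where that index is 0. *)
pose f1 j k i := if j is j'.+1 then (binomz R[i] (A j') i * j%:R) *: e j k i else 0.
pose f2 j k i := if i is i'.+1 then
   (binomz R[i] (A j) i' * (A j - j%:Z - i'%:Z)%:~R) *: e j k i else 0.
pose f3 j k i := if k is k'.+1 then (binomz R[i] (A j) i * k%:R) *: e j k i else 0.
transitivity (trisum s.+1 (fun j k i => f1 j k i + f2 j k i + f3 j k i)).
  rewrite !trisumD (@trisumS1 _ _ f1) // (@trisumS3 _ _ f2) // (@trisumS2 _ _ f3) //.
  rewrite -!trisumD /trisum (lin_sum (Lop_linear hY 1)).
  apply: eq_bigr => j _; rewrite (lin_sum (Lop_linear hY 1)); apply: eq_bigr => k _.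
  move: (s - j - k)%N => i.
  rewrite (linZ (Lop_linear hY 1)) (act_L1 hY _ _ (homog_dL j hu)).
  rewrite !dL_rec (actZl hY) (actZr hY) !scalerDr !scalerA /f1 /f2 /f3 /e.
  congr (_ + _ *: _ + _).
    by congr (_ * _%:~R); rewrite /A; lia.
  by congr (Y _ _ _); lia.
(* The factor s+1 on the other side splits as j + k + i; Pascal's rule and the binomial recurrence
   match the coefficients. *)
rewrite trisumZ; apply: eq_trisum => j k i ijk.
rewrite scalerA -ijk !natrD.
rewrite -/(A j) -/(e j k i).
have -> : f3 j k i = (binomz R[i] (A j) i * k%:R) *: e j k i.
  by case: k {ijk} => //; rewrite mulr0 scale0r.
have -> : f1 j k i = (binomz R[i] (A j + 1) i * j%:R) *: e j k i.
  case: j {ijk} => [|j]; first by rewrite mulr0 scale0r.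
  by rewrite /f1; congr (binomz _ _ _ * _ *: _); rewrite /A; lia.
case: i {ijk} => [|i].
  by rewrite /f2 addr0 -scalerDl !binomz0 addr0 mulr1 !mul1r.
rewrite /f2 -!scalerDl; congr (_ *: _); rewrite binomz_pascal.
move: (A j) => b0; have := binomz_rec (F := R[i]) b0 i.
rewrite !intrD !intrN -!pmulrn -natr1.
move: (binomz _ _ i) (binomz _ _ i.+1) (b0%:~R) => x y b h.
have -> : (b - j%:R - i%:R) = (b - i%:R) - j%:R by rewrite addrAC.
rewrite mulrBr [x * (b - _)]mulrC -h; ring.
Qed.

(* The combination of the previous identities occurring in the Jacobi identity
   of the opposite vertex operators. *)
Lemma dL_Y_twisted a u l v m t : homog pi a u ->
  \sum_(i < t.+1) ((-1) ^+ i * binomz _ m i) *: dL (t - i) (Y u (l + i%:Z) v)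
  = trisum t (fun j k i =>
      binomz _ (2 * a - j%:Z - m - l - 2) i *: Y (dL j u) (l + i%:Z) (dL k v)).
Proof.
move=> hu; under eq_bigr do rewrite (dL_Y _ _ _ hu).
pose f i j k r : V := ((-1) ^+ i * binomz _ m i
   * binomz _ (2 * a - j%:Z - l - 2 - i%:Z) r) *: Y (dL j u) (l + (i + r)%:Z) (dL k v).
transitivity (\sum_(i < t.+1) trisum (t - i) (f i)).
  apply: eq_bigr => i _; rewrite /trisum scaler_sumr; apply: eq_bigr => j _.
  rewrite scaler_sumr; apply: eq_bigr => k _; rewrite scalerA /f.
  congr (_ * binomz _ _ _ *: Y _ _ _); lia.
rewrite trisum_exchange; apply: eq_trisum => j k r _.
have -> : 2 * a - j%:Z - m - l - 2 = 2 * a - j%:Z - l - 2 - m by lia.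
rewrite -binomz_sumE /binomz_sum scaler_suml; apply: eq_bigr => i _.
rewrite /f subnKC //; by rewrite -ltnS.
Qed.

End Theta.
Section ThetaSums.
Context {R : realType} (V : voa R).
Local Notation pi := (@voa_pi _ V).
Local Notation hpi := (voa_is_grading V).

Lemma theta_linear a j : linear (fun v : V => theta v a j).
Proof.
move=> c x y; rewrite !thetaE (grading_linear hpi) dL_linear scalerDr !scalerA.
by rewrite [c * _]mulrC.
Qed.

Definition theta_support (v : V) (s : seq int) (J : nat) :=
  forall a j, (a \notin s) || (J <= j)%N -> theta v a j = 0.

Lemma theta_supportW v s s' J J' : {subset s <= s'} -> (J <= J')%N ->
  theta_support v s J -> theta_support v s' J'.
Proof.
move=> ss JJ h a j haj; apply: h; case/orP: haj => [h|h].
  by rewrite (contra (ss a)).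
by rewrite (leq_trans JJ h) orbT.
Qed.

Lemma theta_supportP v : exists s J, uniq s /\ theta_support v s J.
Proof.
have [s [us hs]] := finite_support_seq (grading_finite hpi v).
suff [J hJ] : exists J, forall a j, a \in s -> (J <= j)%N -> theta v a j = 0.
  exists s, J; split => // a j /orP[/hs pa|Jj].
    by rewrite thetaE pa (lin0 (@dL_linear _ V _)) scaler0.
  have [|/hs pa] := boolP (a \in s); first by move=> /hJ; apply.
  by rewrite thetaE pa (lin0 (@dL_linear _ V _)) scaler0.
elim: s {us hs} => [|a s [J hJ]]; first by exists 0%N.
have [J' hJ'] := dL_trunc V a; exists (maxn J J') => b j.
rewrite inE geq_max => /orP[/eqP ->|bs] /andP[Jj J'j]; last exact: hJ.
by rewrite thetaE hJ' ?scaler0 //; exact: homog_voa_pi.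
Qed.

Section ThetaSum.
Context {E : lmodType R[i]}.
Implicit Type G : V -> int -> nat -> E.

(** The common shape of the opposite modes, of the contragredient action and of the box action,
    which differ only in [G]; finiteness and linearity are settled once. *)
Definition theta_sum G (v : V) : E :=
  \sum_(a \in [set: int]) \sum_(j \in [set: nat]) G (theta v a j) a j.

Lemma theta_sumE G v s J : (forall a j, linear (fun x => G x a j)) ->
  uniq s -> theta_support v s J ->
  theta_sum G v = \sum_(a <- s) \sum_(j < J) G (theta v a j) a j.
Proof.
move=> lG us h; have G0 a j : G 0 a j = 0 by exact: lin0 (lG a j).
rewrite /theta_sum (fsumE us) => [|a nas].
  apply: eq_bigr => a _; rewrite (@fsum_nat _ J) // => j Jj.
  by rewrite h ?Jj ?orbT.
by apply: fsbig1 => j _; rewrite h ?nas.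
Qed.

Lemma theta_sum_linear G : (forall a j, linear (fun x => G x a j)) ->
  linear (theta_sum G).
Proof.
move=> lG c x y.
have [s [J [us hx]]] := theta_supportP x; have [t [K [ut hy]]] := theta_supportP y.
have uc := undup_uniq (s ++ t).
have hx' : theta_support x (undup (s ++ t)) (maxn J K).
  apply: theta_supportW hx; last exact: leq_maxl.
  by move=> a; rewrite mem_undup mem_cat => ->.
have hy' : theta_support y (undup (s ++ t)) (maxn J K).
  apply: theta_supportW hy; last exact: leq_maxr.
  by move=> a; rewrite mem_undup mem_cat orbC => ->.
have hc : theta_support (c *: x + y) (undup (s ++ t)) (maxn J K).
  by move=> a j haj; rewrite theta_linear hx' // hy' // scaler0 addr0.
rewrite (theta_sumE lG uc hx') (theta_sumE lG uc hy') (theta_sumE lG uc hc).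
rewrite scaler_sumr -big_split; apply: eq_bigr => a _.
by rewrite scaler_sumr -big_split; apply: eq_bigr => j _; rewrite theta_linear lG.
Qed.

Lemma theta_sum_homog G a v J : (forall a j, linear (fun x => G x a j)) ->
  homog pi a v -> (forall j, (J <= j)%N -> dL j v = 0) ->
  theta_sum G v = (-1) ^ a *: \sum_(j < J) G (dL j v) a j.
Proof.
move=> lG hv hJ; rewrite (@theta_sumE G v [:: a] J) // ?big_seq1.
  rewrite scaler_sumr; apply: eq_bigr => j _.
  by rewrite thetaE (homog_uniq _ hpi hv) eqxx (linZ (lG a j)).
move=> b j; rewrite inE thetaE (homog_uniq _ hpi hv).
have [->/= Jj|_ _] := eqVneq b a; first by rewrite hJ ?scaler0.
by rewrite (lin0 (@dL_linear _ V _)) scaler0.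
Qed.

Lemma theta_sum_ext G G' v : (forall x a j, G x a j = G' x a j) ->
  theta_sum G v = theta_sum G' v.
Proof.
by move=> GG'; apply: eq_fsbigr => a _; apply: eq_fsbigr => j _; rewrite GG'.
Qed.

End ThetaSum.

Lemma lin_theta_sum (E E' : lmodType R[i]) (f : E -> E') (G : V -> int -> nat -> E) v :
  linear f -> (forall a j, linear (fun x => G x a j)) ->
  f (theta_sum G v) = theta_sum (fun x a j => f (G x a j)) v.
Proof.
move=> lf lG; have [s [J [us h]]] := theta_supportP v.
rewrite (theta_sumE lG us h) (theta_sumE (G := fun x a j => f (G x a j)) _ us h).
  by rewrite (lin_sum lf); apply: eq_bigr => a _; rewrite (lin_sum lf).
by move=> a j; apply: lin_comp.
Qed.

Lemma theta_sum_lin (E E' : lmodType R[i]) (G : V -> int -> nat -> E -> E') v :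
  (forall a j e, linear (fun x => G x a j e)) ->
  (forall x a j, linear (G x a j)) ->
  linear (fun e => theta_sum (fun x a j => G x a j e) v).
Proof.
move=> lG lG' c e e'; have [s [J [us h]]] := theta_supportP v.
rewrite !(theta_sumE (G := fun x a j => G x a j _) _ us h) //.
rewrite scaler_sumr -big_split; apply: eq_bigr => a _.
by rewrite scaler_sumr -big_split; apply: eq_bigr => j _; rewrite lG'.
Qed.

End ThetaSums.

(** * Opposite vertex operators and contragredient modules *)

Section Opposite.
Context {R : realType} (V : voa R) (W : lmodType R[i]).
Variable YW : V -> int -> W -> W.
Local Notation Y := (@voa_Y _ V).
Local Notation pi := (@voa_pi _ V).
Local Notation om := (voa_om V).
Local Notation vac := (voa_vac V).
Local Notation L n := (Lop om Y n).
Local Notation hY := (voa_vertex_action V).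
Hypothesis hW : vertex_action Y vac om (voa_c V) YW.

(* The modes of Y(e^(x L(1)) (-x^-2)^(L(0)) v, x^-1). *)
Definition opp (v : V) (n : int) (w : W) : W :=
  theta_sum (fun x a j => YW x (2 * a - j%:Z - n - 2) w) v.

Lemma opp_linear_l n w : linear (fun v => opp v n w).
Proof. by apply: theta_sum_linear => a j; exact: (act_linear_l hW). Qed.

Lemma opp_linear_r v n : linear (opp v n).
Proof.
apply: theta_sum_lin => [a j w|x a j]; first exact: (act_linear_l hW).
exact: (act_linear_r hW).
Qed.

Lemma opp_homog a v n w J :
  homog pi a v -> (forall j, (J <= j)%N -> dL j v = 0) ->
  opp v n w = (-1) ^ a *: \sum_(j < J) YW (dL j v) (2 * a - j%:Z - n - 2) w.
Proof.
move=> hv hJ; rewrite /opp (theta_sum_homog _ hv hJ) // => b j.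
exact: (act_linear_l hW).
Qed.

(** Truncation now occurs for decreasing index, the reverse of [YW]. So the products in [opp_jacobi]
    give finite sums precisely when the factors are in reversed order. *)
Lemma opp_trunc v w (n : int) : exists K : nat, forall i : nat, (K <= i)%N ->
  opp v (n - i%:Z) w = 0.
Proof.
have [s [J [us h]]] := theta_supportP v.
suff [K hK] : exists K : nat, forall a, a \in s -> forall j, (j < J)%N ->
    forall i : nat, (K <= i)%N -> YW (theta v a j) (2 * a - j%:Z - (n - i%:Z) - 2) w = 0.
  exists K => i Ki; rewrite /opp (theta_sumE _ us h) => [|a j]; last exact: (act_linear_l hW).
  by rewrite big_seq big1 // => a as_; rewrite big1 // => j _; apply: hK.
elim: s {us h} => [|a s [K hK]]; first by exists 0%N.
have [|K' hK'] := @unif_bound J (fun j i =>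
   YW (theta v a j) (2 * a - j%:Z - (n - i%:Z) - 2) w = 0).
  move=> j; have [K' hK'] := act_trunc_nat hW (theta v a j) w (2 * a - j%:Z - n - 2).
  by exists K' => i /hK' <-; congr (YW _ _ _); lia.
exists (maxn K K') => b; rewrite inE => /orP[/eqP ->|bs] j jJ i;
 rewrite geq_max => /andP[Ki K'i]; [exact: hK' | exact: hK].
Qed.

Lemma signzN (n : int) : (-1) ^ (- n) = (-1) ^ n :> R[i].
Proof. by rewrite -exprz_inv invrN1. Qed.

Lemma signz_sq (n : int) : (-1) ^ n * (-1) ^ n = 1 :> R[i].
Proof. by rewrite -[X in X * _]signzN -expfzDr ?addNr // oppr_eq0 oner_eq0. Qed.

(* Each side is a sum over coefficients of e^(x L(1)) u and e^(x L(1)) v; the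
   Jacobi identity turns the left-hand side into iterates, which are then
   regrouped by total degree. *)
Lemma opp_jacobi a b u v (l m n : int) w : homog pi a u -> homog pi b v ->
  \sum_(i \in [set: nat]) subx _ l i *: opp v (n + i%:Z) (opp u (m + l - i%:Z) w)
  - \sum_(i \in [set: nat])
      ((-1) ^ l * subx _ l i) *: opp u (m + i%:Z) (opp v (n + l - i%:Z) w)
  = \sum_(i \in [set: nat])
      subx _ (i%:Z - m - 1) i *: opp (Y u (l + i%:Z) v) (m + n - i%:Z) w.
Proof.
move=> hu hv.
have [N0 hN0] := voa_homog_small V.
have [J [Ju Jv Juv]] : exists J : nat,
  [/\ forall j, (J <= j)%N -> dL j u = 0,
      forall j, (J <= j)%N -> dL j v = 0
    & forall i j, (J <= j)%N -> dL j (Y u (l + i%:Z) v) = 0].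
  exists (absz (a - N0)%R + absz (b - N0)%R + absz (a + b - l - 1 - N0)%R).+1.
  split.
  - by move=> j Jj; apply: (hN0 _ _ (homog_dL j hu)); lia.
  - by move=> j Jj; apply: (hN0 _ _ (homog_dL j hv)); lia.
  - move=> i j Jj.
    by apply: (hN0 _ _ (homog_dL j (homog_Y (l + i%:Z) hu hv))); lia.
(* [N j] and [M k] are chosen so that the Jacobi identity of [YW] at (l, [N j], [M k]), for the
   components of e^(xL(1))u and e^(xL(1))v, produces both sums on the left. *)
pose N j : int := 2 * a - j%:Z - m - l - 2.
pose M k : int := 2 * b - k%:Z - n - l - 2.
have [K [Ku Kv Kuv Kj]] : exists K : nat,
  [/\ forall j, (j < J)%N -> forall i, (K <= i)%N -> YW (dL j u) (N j + i%:Z) w = 0,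
      forall j, (j < J)%N -> forall i, (K <= i)%N -> YW (dL j v) (M j + i%:Z) w = 0,
      forall i, (K <= i)%N -> Y u (l + i%:Z) v = 0
    & forall j k i, (K <= i)%N -> Y (dL j u) (l + i%:Z) (dL k v) = 0].
  have [K1 h1] := unif_bound J (fun j => act_trunc_nat hW (dL j u) w (N j)).
  have [K2 h2] := unif_bound J (fun j => act_trunc_nat hW (dL j v) w (M j)).
  exists (maxn K1 (maxn K2 (absz (a + b - l - 1 - N0)%R).+1)); split.
  - by move=> j jJ i; rewrite geq_max => /andP[? _]; apply: h1.
  - by move=> j jJ i; rewrite !geq_max => /and3P[_ ? _]; apply: h2.
  - move=> i; rewrite !geq_max => /and3P[_ _ Ki].
    by apply: (hN0 _ _ (homog_Y (l + i%:Z) hu hv)); lia.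
  - move=> j k i; rewrite !geq_max => /and3P[_ _ Ki].
    apply: (hN0 _ _ (homog_Y (l + i%:Z) (homog_dL j hu) (homog_dL k hv))); lia.
pose e : R[i] := (-1) ^ a * (-1) ^ b.
pose F j k (i : nat) : W := binomz _ (N j) i *:
  YW (Y (dL j u) (l + i%:Z) (dL k v)) (N j + M k - i%:Z) w.
have lhs1 (i : nat) : opp v (n + i%:Z) (opp u (m + l - i%:Z) w) =
   e *: \sum_(j < J) \sum_(k < J)
     YW (dL k v) (M k + l - i%:Z) (YW (dL j u) (N j + i%:Z) w).
  rewrite (opp_homog _ _ hu Ju) (linZ (opp_linear_r _ _)) (opp_homog _ _ hv Jv).
  rewrite scalerA exchange_big; congr (_ *: _); apply: eq_bigr => k _.
  rewrite (lin_sum (act_linear_r hW _ _)); apply: eq_bigr => j _.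
  by congr (YW _ _ (YW _ _ _)); rewrite /M /N; lia.
have lhs2 (i : nat) : opp u (m + i%:Z) (opp v (n + l - i%:Z) w) =
   e *: \sum_(j < J) \sum_(k < J)
     YW (dL j u) (N j + l - i%:Z) (YW (dL k v) (M k + i%:Z) w).
  rewrite (opp_homog _ _ hv Jv) (linZ (opp_linear_r _ _)) (opp_homog _ _ hu Ju).
  rewrite scalerA mulrC; congr (_ *: _); apply: eq_bigr => j _.
  rewrite (lin_sum (act_linear_r hW _ _)); apply: eq_bigr => k _.
  by congr (YW _ _ (YW _ _ _)); rewrite /M /N; lia.
transitivity (- (e * (-1) ^ l) *: \sum_(j < J) \sum_(k < J) \sum_(i < K) F j k i).
  rewrite (@fsum_nat _ K) => [|i Ki]; last first.
    rewrite lhs1 big1 ?scaler0 // => j _; rewrite big1 // => k _.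
    by rewrite Ku // (act0r hW).
  rewrite (@fsum_nat _ K) => [|i Ki]; last first.
    rewrite lhs2 big1 ?scaler0 // => j _; rewrite big1 // => k _.
    by rewrite Kv // (act0r hW).
  transitivity (\sum_(j < J) \sum_(k < J) \sum_(i < K)
    ((e * subx _ l i) *: YW (dL k v) (M k + l - i%:Z) (YW (dL j u) (N j + i%:Z) w)
     - (e * ((-1) ^ l * subx _ l i)) *:
        YW (dL j u) (N j + l - i%:Z) (YW (dL k v) (M k + i%:Z) w))).
    rewrite -sumrB; under eq_bigr do rewrite lhs1 lhs2 !scalerA ![_ * e]mulrC !scaler_sumr -sumrB.
    rewrite exchange_big; apply: eq_bigr => j _ /=.
    under eq_bigr do rewrite !scaler_sumr -sumrB.
    by rewrite exchange_big.
  rewrite scaler_sumr; apply: eq_bigr => j _.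
  rewrite scaler_sumr; apply: eq_bigr => k _.
  have := act_jacobi hW (dL j u) (dL k v) w l (N j) (M k).
  rewrite (@fsum_nat _ K) => [|i Ki]; last by rewrite Kv // (act0r hW) scaler0.
  rewrite (@fsum_nat _ K) => [|i Ki]; last by rewrite Ku // (act0r hW) scaler0.
  rewrite (@fsum_nat _ K) => [|i Ki]; last by rewrite Kj // (act0l hW) scaler0.
  move=> E; transitivity (- (e * (-1) ^ l) *: \sum_(i < K)
      subx _ (i%:Z - N j - 1) i *: YW (Y (dL j u) (l + i%:Z) (dL k v)) (N j + M k - i%:Z) w).
    rewrite -E scalerBr !scaler_sumr -sumrB; apply: eq_bigr => i _.
    rewrite !scalerA [LHS]addrC -scaleNr; congr (_ *: _ + _).
      by rewrite mulNr mulrA.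
    rewrite -scaleNr; congr (_ *: _).
    move: (subx _ _ _) => x.
    by rewrite mulNr opprK mulrA -(mulrA e) signz_sq mulr1.
  by congr (_ *: _); apply: eq_bigr => i _; rewrite subx_opp.
rewrite trisum_total => [|j k i]; last first.
  rewrite /F; case/or3P => h; first by rewrite Ju // (act0l hY) (act0l hW) scaler0.
    by rewrite Jv // (act0r hY) (act0l hW) scaler0.
  by rewrite Kj // (act0l hW) scaler0.
(* The mode [N j + M k - i] equals [Q] - (j + k + i). It depends only on the total degree, so the
   terms of one degree can be collected inside a single operator. *)
pose Q : int := 2 * a + 2 * b - m - n - 2 * l - 4.
pose g (i s : nat) : W := ((-1) ^+ i * binomz _ m i) *:
  YW (dL s (Y u (l + i%:Z) v)) (Q - (i + s)%N%:Z) w.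
transitivity (- (e * (-1) ^ l) *: \sum_(i < K) \sum_(s < (J + J).+1) g i s).
  congr (_ *: _); rewrite sum_antidiagonal; last first.
    move=> i s /orP[Ki|Js]; rewrite /g.
      by rewrite Kuv // (lin0 (@dL_linear _ V _)) (act0l hW) scaler0.
    by rewrite Juv ?(act0l hW) ?scaler0 //; apply: leq_trans Js; lia.
  have -> : (K + (J + J).+1 = J + (J + K).+1)%N by lia.
  apply: eq_bigr => t _.
  transitivity (YW (trisum t (fun j k i =>
      binomz _ (2 * a - j%:Z - m - l - 2) i *: Y (dL j u) (l + i%:Z) (dL k v)))
        (Q - t%:Z) w).
    rewrite /trisum (act_lin_sum_l hW); apply: eq_bigr => j _.
    rewrite (act_lin_sum_l hW); apply: eq_bigr => k _.
    rewrite (actZl hW) /F; congr (_ *: YW _ _ _).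
    by have := ltn_ord j; have := ltn_ord k; rewrite /N /M /Q; lia.
  rewrite -(dL_Y_twisted _ _ _ _ hu) (act_lin_sum_l hW); apply: eq_bigr => i _.
  by rewrite (actZl hW) /g subnKC // -ltnS.
rewrite [RHS](@fsum_nat _ K) => [|i Ki]; last first.
  by rewrite Kuv // (lin0 (opp_linear_l _ _)) scaler0.
rewrite scaler_sumr; apply: eq_bigr => i _.
rewrite (@opp_homog _ _ _ _ (J + J).+1 (homog_Y (l + i%:Z) hu hv)); last first.
  by move=> s Js; apply: Juv; apply: leq_trans Js; lia.
rewrite subx_opp scalerA !scaler_sumr; apply: eq_bigr => s _.
rewrite /g scalerA; congr (_ *: YW _ _ _); last by rewrite /Q; lia.
(* The sign attached to the weight of u_{l+i}v provides both the (-1)^i of [dL_Y_twisted] and the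
   overall factor -(-1)^l. *)
have -> : a + b - (l + i%:Z) - 1 = a + (b + (- l + (- i%:Z + - 1))) by lia.
rewrite !expfzDr ?oppr_eq0 ?oner_eq0 // !signzN expr1z /e.
by rewrite -exprnP; ring.
Qed.

End Opposite.

(** * Module axioms as vanishing of linear defects *)

Section VertexAxioms.
Context {R : realType} (V : voa R).
Local Notation Y := (@voa_Y _ V).
Local Notation om := (voa_om V).
Local Notation vac := (voa_vac V).
Local Notation hY := (voa_vertex_action V).

Section Pre.
Context (W : lmodType R[i]) (YW : V -> int -> W -> W).

(** Enough to make the sums in the Jacobi identity finite and the defects linear. *)
Record pre_action : Prop := PreAction {
  pre_l : forall n w, linear (fun v => YW v n w);
  pre_r : forall v n, linear (YW v n);
  pre_trunc : forall v w, exists N : int, forall n : int, N <= n -> YW v n w = 0 }.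

Definition jacobi_defect (u v : V) (l m n : int) (w : W) : W :=
  \sum_(i \in [set: nat])
    subx _ l i *: YW u (m + l - i%:Z) (YW v (n + i%:Z) w)
  - \sum_(i \in [set: nat])
    ((-1) ^ l * subx _ l i) *: YW v (n + l - i%:Z) (YW u (m + i%:Z) w)
  - \sum_(i \in [set: nat])
    subx _ (i%:Z - m - 1) i *: YW (Y u (l + i%:Z) v) (m + n - i%:Z) w.

Definition virasoro_defect (m n : int) (w : W) : W :=
  Lop om YW m (Lop om YW n w) - Lop om YW n (Lop om YW m w)
  - ((m - n)%:~R *: Lop om YW (m + n) w
     + (if m + n == 0 then ((m ^+ 3 - m)%:~R / 12%:R * voa_c V) *: w else 0)).

(** Localized at one vector, the axioms can be checked on generators and carried along
    homomorphisms: forward from contragredients to B and from modules to quotients, backward along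
    the inclusion of a submodule. *)
Definition axioms_at (w : W) :=
  [/\ forall n, YW vac n w = if n == -1 then w else 0,
      forall u v l m n, jacobi_defect u v l m n w = 0
    & forall m n, virasoro_defect m n w = 0].

Lemma linear_subf (U T : lmodType R[i]) (f g : U -> T) :
  linear f -> linear g -> linear (fun x => f x - g x).
Proof.
by move=> lf lg a x y; rewrite lf lg scalerBr opprD addrACA.
Qed.

Lemma linear_scalef (U T : lmodType R[i]) (f : U -> T) (c : R[i]) :
  linear f -> linear (fun x => c *: f x).
Proof. by move=> lf a x y; rewrite lf scalerDr !scalerA mulrC. Qed.

Lemma linear_addf (U T : lmodType R[i]) (f g : U -> T) :
  linear f -> linear g -> linear (fun x => f x + g x).
Proof.
by move=> lf lg a x y; rewrite lf lg scalerDr addrACA.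
Qed.

Section WithPre.
Hypothesis hp : pre_action.

Lemma pre0l n w : YW 0 n w = 0.
Proof. exact: (lin0 (pre_l hp n w)). Qed.
Lemma pre0r v n : YW v n 0 = 0.
Proof. exact: (lin0 (pre_r hp v n)). Qed.

Lemma pre_trunc_nat v w (n : int) : exists K : nat, forall i : nat, (K <= i)%N ->
  YW v (n + i%:Z) w = 0.
Proof.
have [N hN] := pre_trunc hp v w.
exists (absz (N - n)) => i Ki; apply: hN; lia.
Qed.

Lemma jacobi_defect_linear_u v l m n w : linear (fun u => jacobi_defect u v l m n w).
Proof.
apply: linear_subf; first apply: linear_subf; apply: fsum_linear.
- by move=> i; apply: linear_scalef => a x y; rewrite (pre_l hp).
- move=> u; have [K hK] := pre_trunc_nat v w n; exists K => i /hK ->.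
  by rewrite pre0r scaler0.
- by move=> i; apply: linear_scalef; apply: lin_comp; [exact: (pre_r hp) | exact: (pre_l hp)].
- move=> u; have [K hK] := pre_trunc_nat u w m; exists K => i /hK ->.
  by rewrite pre0r scaler0.
- move=> i; apply: linear_scalef.
  by apply: (lin_comp (pre_l hp _ _)); exact: (act_linear_l hY).
- move=> u; have [K hK] := act_trunc_nat hY u v l; exists K => i /hK ->.
  by rewrite pre0l scaler0.
Qed.

Lemma jacobi_defect_linear_v u l m n w : linear (fun v => jacobi_defect u v l m n w).
Proof.
apply: linear_subf; first apply: linear_subf; apply: fsum_linear.
- by move=> i; apply: linear_scalef; apply: lin_comp; [exact: (pre_r hp) | exact: (pre_l hp)].
- move=> v; have [K hK] := pre_trunc_nat v w n; exists K => i /hK ->.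
  by rewrite pre0r scaler0.
- by move=> i; apply: linear_scalef => a x y; rewrite (pre_l hp).
- move=> v; have [K hK] := pre_trunc_nat u w m; exists K => i /hK ->.
  by rewrite pre0r scaler0.
- move=> i; apply: linear_scalef.
  by apply: (lin_comp (pre_l hp _ _)); exact: (act_linear_r hY).
- move=> v; have [K hK] := act_trunc_nat hY u v l; exists K => i /hK ->.
  by rewrite pre0l scaler0.
Qed.

Lemma jacobi_defect_linear u v l m n : linear (jacobi_defect u v l m n).
Proof.
apply: linear_subf; first apply: linear_subf; apply: fsum_linear.
- by move=> i; apply: linear_scalef; apply: lin_comp; exact: (pre_r hp).
- move=> w; have [K hK] := pre_trunc_nat v w n; exists K => i /hK ->.
  by rewrite pre0r scaler0.
- by move=> i; apply: linear_scalef; apply: lin_comp; exact: (pre_r hp).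
- move=> w; have [K hK] := pre_trunc_nat u w m; exists K => i /hK ->.
  by rewrite pre0r scaler0.
- by move=> i; apply: linear_scalef; exact: (pre_r hp).
- move=> w; have [K hK] := act_trunc_nat hY u v l; exists K => i /hK ->.
  by rewrite pre0l scaler0.
Qed.

Lemma virasoro_defect_linear m n : linear (virasoro_defect m n).
Proof.
apply: linear_subf; first by apply: linear_subf; apply: lin_comp; exact: (pre_r hp).
apply: linear_addf; first by apply: linear_scalef; exact: (pre_r hp).
case: (m + n == 0) => a x y; last by rewrite scaler0 addr0.
by rewrite scalerDr !scalerA mulrC.
Qed.

Lemma axioms_at_subspace : subspace [set w | axioms_at w].
Proof.
split=> [|a x y [vx jx sx] [vy jy sy]].
  split=> [n|u v l m n|m n].
  - by rewrite pre0r if_same.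
  - exact: lin0 (jacobi_defect_linear u v l m n).
  - exact: lin0 (virasoro_defect_linear m n).
split=> [n|u v l m n|m n].
- rewrite (pre_r hp) vx vy; case: ifP => // _; by rewrite scaler0 addr0.
- by rewrite jacobi_defect_linear jx jy scaler0 addr0.
- by rewrite virasoro_defect_linear sx sy scaler0 addr0.
Qed.

Lemma vertex_action_intro : (forall w, axioms_at w) ->
  vertex_action Y vac om (voa_c V) YW.
Proof.
move=> ax; have jac u v w l m n : jacobi_defect u v l m n w = 0.
  by have [_ ->] := ax w.
split.
- exact: (pre_l hp).
- exact: (pre_r hp).
- exact: (pre_trunc hp).
- by move=> n w; have [] := ax w.
- by move=> u v w l m n; apply/eqP; rewrite -subr_eq0; apply/eqP; exact: jac.
- by move=> m n w; apply/eqP; rewrite -subr_eq0; apply/eqP; have [_ _ h] := ax w; exact: h.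
- move=> v n w; apply: jacobi_derivative; first exact: (pre_r hp).
    by move=> n' w'; have [] := ax w'.
  by move=> u' v' l' m' n'; apply/eqP; rewrite -subr_eq0; apply/eqP; exact: jac.
Qed.

End WithPre.

Lemma vertex_action_pre : vertex_action Y vac om (voa_c V) YW -> pre_action.
Proof. by case. Qed.

Lemma vertex_action_axioms_at w : vertex_action Y vac om (voa_c V) YW -> axioms_at w.
Proof.
move=> h; split; first by move=> n; exact: (act_vacuum h).
- by move=> u v l m n; apply/eqP; rewrite subr_eq0; apply/eqP; exact: (act_jacobi h).
- by move=> m n; apply/eqP; rewrite subr_eq0; apply/eqP; exact: (act_virasoro h).
Qed.

End Pre.

Section Hom.
Context (W W' : lmodType R[i]) (YW : V -> int -> W -> W) (YW' : V -> int -> W' -> W').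
Context (f : W -> W').
Hypotheses (hp : pre_action YW) (hp' : pre_action YW') (lf : linear f)
  (fY : forall v n w, f (YW v n w) = YW' v n (f w)).

Lemma hom_jacobi_defect u v l m n w :
  f (jacobi_defect YW u v l m n w) = jacobi_defect YW' u v l m n (f w).
Proof.
rewrite /jacobi_defect !(linB lf).
have [K1 h1] := pre_trunc_nat hp v w n.
have [K2 h2] := pre_trunc_nat hp u w m.
have [K3 h3] := act_trunc_nat hY u v l.
rewrite (lin_fsum_nat lf (K := K1)) => [|i /h1 ->]; last by rewrite (pre0r hp) scaler0.
rewrite (lin_fsum_nat lf (K := K2)) => [|i /h2 ->]; last by rewrite (pre0r hp) scaler0.
rewrite (lin_fsum_nat lf (K := K3)) => [|i /h3 ->]; last by rewrite (pre0l hp) scaler0.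
by congr (_ - _ - _); apply: eq_fsbigr => i _; rewrite (linZ lf) !fY.
Qed.

Lemma hom_virasoro_defect m n w :
  f (virasoro_defect YW m n w) = virasoro_defect YW' m n (f w).
Proof.
rewrite /virasoro_defect !(linB lf) (linD lf) (linZ lf) /Lop !fY.
by case: ifP => _; rewrite ?(linZ lf) ?(lin0 lf).
Qed.

Lemma hom_axioms_at w : axioms_at YW w -> axioms_at YW' (f w).
Proof.
move=> [h1 h2 h3]; split=> [n|u v l m n|m n].
- by rewrite -fY h1; case: ifP => // _; rewrite (lin0 lf).
- by rewrite -hom_jacobi_defect h2 (lin0 lf).
- by rewrite -hom_virasoro_defect h3 (lin0 lf).
Qed.

Lemma inj_axioms_at w : injective f -> axioms_at YW' (f w) -> axioms_at YW w.
Proof.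
move=> fi [h1 h2 h3]; split=> [n|u v l m n|m n]; apply: fi.
- by rewrite fY h1; case: ifP => // _; rewrite (lin0 lf).
- by rewrite hom_jacobi_defect h2 (lin0 lf).
- by rewrite hom_virasoro_defect h3 (lin0 lf).
Qed.

End Hom.

End VertexAxioms.

(** * Real parts of weights, and weights in generalized modules *)

Section RealParts.
Context {R : realType}.
Implicit Types (x y : R[i]).

Lemma ReD x y : complex.Re (x + y) = complex.Re x + complex.Re y.
Proof. by case: x y => [a b] [c d]. Qed.

Lemma ReN x : complex.Re (- x) = - complex.Re x.
Proof. by case: x. Qed.

Lemma Re_nat (k : nat) : complex.Re (k%:R : R[i]) = k%:R.
Proof. by elim: k => // k IH; rewrite -!natr1 ReD IH. Qed.

Lemma Re_int (k : int) : complex.Re (k%:~R : R[i]) = k%:~R.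
Proof.
case: k => k; first exact: Re_nat.
by rewrite NegzE !mulrNz ReN -!pmulrn Re_nat.
Qed.

(** The Archimedean property supplies the natural number on which the inductions on weights run. *)
Lemma Re_bound (s : seq R[i]) (r : R) :
  exists K : nat, forall q, q \in s -> complex.Re q < r + K%:R.
Proof.
elim: s => [|q s [K hK]]; first by exists 0%N.
have h := archi_boundP (normr_ge0 (complex.Re q - r)).
exists (maxn K (Num.Def.archi_bound `|complex.Re q - r|)) => p.
rewrite inE => /orP[/eqP ->|/hK ps].
  rewrite -ltrBlDl; apply: le_lt_trans (ler_norm _) (lt_le_trans h _).
  by rewrite ler_nat leq_maxr.
by apply: lt_le_trans ps _; rewrite lerD2l ler_nat leq_maxl.
Qed.

End RealParts.

Section Gmodules.
Context {R : realType} (V : voa R).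
Local Notation Y := (@voa_Y _ V).
Local Notation vpi := (@voa_pi _ V).
Local Notation om := (voa_om V).
Local Notation vac := (voa_vac V).

Section OneModule.
Context (W : gmodule V).
Local Notation pi := (@gmod_pi _ _ W).
Local Notation YW := (@gmod_Y _ _ W).
Local Notation L0 := (Lop om YW 0).

Lemma gmod_vertex_action : vertex_action Y vac om (voa_c V) YW.
Proof. exact: gmod_action (gmod_axioms W). Qed.
Local Notation hW := gmod_vertex_action.

Lemma gmod_is_grading : is_grading pi.
Proof. exact: gmod_grading (gmod_axioms W). Qed.
Local Notation hpi := gmod_is_grading.

Lemma homog_pi q w : homog pi q (pi q w).
Proof. by rewrite /homog /= (grading_orth hpi) eqxx. Qed.

Lemma gmod_geig q w : homog pi q w <-> geig L0 q w.
Proof. exact: gmod_L0 (gmod_axioms W) q w. Qed.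

Lemma gmod_weight a v n q w : homog vpi a v -> homog pi q w ->
  homog pi (q + (a - n - 1)%:~R) (YW v n w).
Proof.
move=> hv /gmod_geig[k hk]; apply/gmod_geig; exists k.
suff -> : iter k (shift L0 (q + (a - n - 1)%:~R)) (YW v n w)
  = YW v n (iter k (shift L0 q) w) by rewrite hk (act0r hW).
elim: k {hk} => // k IH; rewrite !iterS IH /shift (act_L0 hW _ _ hv).
rewrite (linB (act_linear_r hW v n)) (actZr hW) scalerDl.
by rewrite opprD addrACA subrr addr0.
Qed.

End OneModule.

Lemma shift_pi (F : fieldType) (E E' : lmodType F) (p : F -> E -> E)
   (p' : F -> E' -> E') (f : E -> E') (s q : F) w :
  is_grading p -> is_grading p' -> linear f ->
  (forall q w, homog p q w -> homog p' (q + s) (f w)) ->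
  p' (q + s) (f w) = f (p q w).
Proof.
move=> hp hp' lf fs; move: w; apply: (grading_ind hp) => [|m w hw].
  split; first by rewrite /= (lin0 lf) (lin0 (grading_linear hp' _)) (lin0 (grading_linear hp _)) (lin0 lf).
  by move=> a x y /= hx hy; rewrite lf (grading_linear hp') hx hy (grading_linear hp) lf.
rewrite /= (homog_uniq _ hp hw) (homog_uniq _ hp' (fs _ _ hw)).
rewrite (inj_eq (addIr s)); case: eqP => // _.
by rewrite (lin0 lf).
Qed.

Lemma gmod_pi_Y (W : gmodule V) a v n q w : homog vpi a v ->
  gmod_pi (q + (a - n - 1)%:~R) (gmod_Y v n w) = gmod_Y v n (gmod_pi q w) :> W.
Proof.
move=> hv; apply: shift_pi.
- exact: gmod_is_grading.
- exact: gmod_is_grading.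
- exact: (act_linear_r (gmod_vertex_action W)).
- by move=> m x; apply: gmod_weight.
Qed.

Lemma homog_opp (W : gmodule V) a v n q (w : W) : homog vpi a v ->
  homog (@gmod_pi _ _ W) q w ->
  homog (@gmod_pi _ _ W) (q + (n + 1 - a)%:~R) (opp (@gmod_Y _ _ W) v n w).
Proof.
move=> hv hw; have [J hJ] := dL_trunc V a.
rewrite (opp_homog (gmod_vertex_action W) n w hv (fun j Jj => hJ j Jj v hv)).
have sH := grading_subspace (q + (n + 1 - a)%:~R) (gmod_is_grading W).
apply: (ssZ sH); apply: (ss_sum sH) => j _.
have := gmod_weight (2 * a - j%:Z - n - 2) (homog_dL j hv) hw.
by congr (homog _ (_ + _%:~R) _); lia.
Qed.

End Gmodules.

Section SpanTypes.
Context {F : fieldType} {W : lmodType F} (A : set W).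

Lemma span_typeP (x : span_type A) : span A (val x).
Proof. by apply/asboolP; exact: (valP x). Qed.

Definition mk_span (x : W) (h : span A x) : span_type A := SpanType (asboolT h).

Lemma val_mk_span x (h : span A x) : val (mk_span h) = x.
Proof. by []. Qed.

Lemma val_span_linear : linear (val : span_type A -> W).
Proof. by move=> a x y; rewrite linearP. Qed.

Lemma span_type_ind (S : set (span_type A)) : subspace S ->
  (forall x (h : A x), S (mk_span (span_sub h))) -> forall x, S x.
Proof.
move=> sS SA x.
suff : exists2 y, S y & val y = val x by move=> [y Sy /val_inj <-].
move: (val x) (span_typeP x); apply: span_min => [|y Ay]; last first.
  by exists (mk_span (span_sub Ay)).
split; first by exists 0 => //; exact: (ss0 sS).
move=> a _ _ [x' Sx' <-] [y' Sy' <-]; exists (a *: x' + y') => //.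
exact: ssP.
Qed.

End SpanTypes.

Section Contragredient.
Context {R : realType} (V : voa R) (W : gmodule V).
Local Notation Y := (@voa_Y _ V).
Local Notation om := (voa_om V).
Local Notation vac := (voa_vac V).
Local Notation pi := (@gmod_pi _ _ W).
Local Notation YW := (@gmod_Y _ _ W).
Local Notation hW := (gmod_vertex_action W).
Local Notation hpi := (gmod_is_grading W).

Lemma contragredientP (f : W -> R[i]^o) : contragredient f <->
  linear f /\ exists s : seq R[i], forall q w, homog pi q w -> q \notin s -> f w = 0.
Proof.
split=> [[lf fin]|[lf [s hs]]]; split => //.
  move: fin => /finite_seqP[s sE]; exists s => q w hw qs; apply/eqP.
  apply: contraNT qs => fw; suff : [set` s] q by [].
  by rewrite -sE; exists w.
apply: (sub_finite_set _ (finite_seq s)) => q [w hw] /=.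
by apply: contraNT => /(hs _ _ hw) ->.
Qed.

Lemma contragredient_subspace : subspace (@contragredient _ _ W).
Proof.
split.
  apply/contragredientP; split; first by move=> a x y; rewrite /= scaler0 addr0.
  by exists [::].
move=> a f g /contragredientP[lf [s hs]] /contragredientP[lg [t ht]].
apply/contragredientP; split.
  apply: linear_addf => //; exact: linear_scalef.
exists (s ++ t) => q w hw; rewrite mem_cat negb_or => /andP[/(hs _ _ hw) fw /(ht _ _ hw) gw].
by rewrite /GRing.add /= /GRing.scale /= fw gw scaler0 addr0.
Qed.

Lemma contragredient_shift (f : W -> R[i]^o) (g : W -> W) (k : R[i]) :
  contragredient f -> linear g ->
  (forall q w, homog pi q w -> homog pi (q + k) (g w)) ->
  contragredient (fun w => f (g w)).
Proof.
move=> /contragredientP[lf [s hs]] lg gk; apply/contragredientP; split.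
  exact: lin_comp.
exists [seq q - k | q <- s] => q w hw qs; apply: (hs _ _ (gk _ _ hw)).
by apply: contra qs => qks; apply/mapP; exists (q + k); rewrite ?addrK.
Qed.

(** A homogeneous [v] shifts all weights by one constant and so preserves finite support; the
    general case is a linear combination. *)
Lemma contragredient_Y f v n : contragredient f -> contragredient (fun w => f (YW v n w)).
Proof.
move=> hf; move: v; apply: voa_ind => [|a v hv].
  have lf := hf.1; split.
    suff -> : (fun w => f (YW 0 n w)) = 0 by exact: (ss0 contragredient_subspace).
    by apply/funext => w; rewrite (act0l hW) (lin0 lf).
  move=> a x y hx hy.
  suff -> : (fun w => f (YW (a *: x + y) n w))
      = a *: (fun w => f (YW x n w)) + (fun w => f (YW y n w)).
    exact: (ssP contragredient_subspace).
  by apply/funext => w; rewrite (act_linear_l hW) lf.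
apply: (contragredient_shift (k := (a - n - 1)%:~R) hf (act_linear_r hW v n)).
by move=> q w; apply: gmod_weight.
Qed.

(** [contragredient] is already a subspace, so the span adds nothing ([dualP]); [span_type] makes it
    a vector space type. *)
Definition dual := span_type (@contragredient _ _ W).

Lemma dualP (f : dual) : contragredient (val f).
Proof. exact: (span_id contragredient_subspace (span_typeP f)). Qed.

Lemma dual_linear (f : dual) : linear (val f).
Proof. by have [] := dualP f. Qed.

Definition transpose (v : V) (n : int) (f : dual) : dual :=
  mk_span (span_sub (contragredient_Y v n (dualP f))).

Lemma transposeE v n f w : val (transpose v n f) w = val f (YW v n w).
Proof. by []. Qed.

Lemma dual_ext (f g : dual) : (forall w, val f w = val g w) -> f = g.
Proof. by move=> fg; apply/val_inj/funext. Qed.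

Lemma eval_linear w : linear (fun f : dual => val f w : R[i]^o).
Proof. by move=> a f g; rewrite val_span_linear. Qed.

Lemma transpose_linear_l n f : linear (fun v => transpose v n f).
Proof.
move=> a x y; apply: dual_ext => w; rewrite transposeE (act_linear_l hW).
by rewrite (dual_linear f) (eval_linear w) !transposeE.
Qed.

Lemma transpose_linear_r v n : linear (transpose v n).
Proof.
move=> a f g; apply: dual_ext => w.
by rewrite transposeE (eval_linear w) (eval_linear (YW v n w)) !transposeE.
Qed.

Definition dual_Y (v : V) (n : int) (f : dual) : dual :=
  theta_sum (fun x a j => transpose x (2 * a - j%:Z - n - 2) f) v.

Lemma dual_YE v n f w : val (dual_Y v n f) w = val f (opp YW v n w).
Proof.
rewrite /dual_Y (lin_theta_sum v (eval_linear w)) => [|a j]; last exact: transpose_linear_l.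
rewrite /opp (lin_theta_sum v (dual_linear f)) //.
by move=> a j; exact: (act_linear_l hW).
Qed.

Hypothesis tW : lower_truncated W.

Lemma dual_pre : pre_action dual_Y.
Proof.
split.
- move=> n f; apply: theta_sum_linear => a j; exact: transpose_linear_l.
- move=> v n; apply: theta_sum_lin => [a j f|x a j]; first exact: transpose_linear_l.
  exact: transpose_linear_r.
- move=> v f; move: v; apply: voa_ind => [|a v hv].
    have l0 n : linear (fun v => dual_Y v n f).
      by apply: theta_sum_linear => a j; exact: transpose_linear_l.
    split; first by exists 0 => n _; exact: (lin0 (l0 n)).
    move=> a x y [N hx] [M hy]; exists (Order.max N M) => n.
    by rewrite ge_max l0 => /andP[/hx -> /hy ->]; rewrite scaler0 addr0.
  have [r hr] := tW.
  have [lf [s hs]] := (contragredientP (val f)).1 (dualP f).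
  have [K hK] := Re_bound s r.
  exists (K%:Z + a) => n Kn; apply: dual_ext => w.
  rewrite dual_YE (lin0 (eval_linear w)).
  move: w; apply: (grading_ind hpi) => [|q w hw].
    exact: linear_ker_subspace (lin_comp lf (opp_linear_r hW v n)).
  have ho := homog_opp n hv hw.
  have [qs|qs] := boolP (q + (n + 1 - a)%:~R \in s); last exact: hs ho qs.
  have -> : w = 0.
    rewrite -hw; apply: hr; have := hK _ qs; rewrite ReD Re_int => h.
    have : (K%:Z%:~R : R) <= (n + 1 - a)%:~R by rewrite ler_int; lia.
    rewrite -pmulrn => h'; lra.
  by rewrite (lin0 (opp_linear_r hW v n)) (lin0 lf).
Qed.

Lemma opp_vac n w : opp YW vac n w = if n == -1 then w else 0.
Proof.
have h j : (1 <= j)%N -> dL j vac = 0.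
  case: j => // j _; rewrite /dL iterSr L_vac //.
  by rewrite (lin0 (iter_linear j (Lop_linear (voa_vertex_action V) 1))) scaler0.
rewrite (opp_homog hW n w (homog_vac V) h) big_ord1 dL0 scale1r (act_vacuum hW).
rewrite (_ : 2 * 0 - (ord0 : 'I_1)%:Z - n - 2 = - n - 2); last by rewrite /=; lia.
have [->|/eqP nn] := eqVneq n (-1); first by [].
by rewrite ifF //; apply/eqP => nn'; apply: nn; lia.
Qed.

(** Since L(1) kills the conformal vector and its weight is 2, L(k) acts on the contragredient as
    the transpose of L(-k). *)
Lemma opp_om n w : opp YW om n w = YW om (2 - n) w.
Proof.
have h j : (1 <= j)%N -> dL j om = 0.
  case: j => // j _; rewrite /dL iterSr L1_om.
  by rewrite (lin0 (iter_linear j (Lop_linear (voa_vertex_action V) 1))) scaler0.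
rewrite (opp_homog hW n w (homog_om V) h) big_ord1 dL0.
rewrite (_ : (-1) ^ 2 = 1) ?scale1r; first by congr (YW _ _ _); rewrite /=; lia.
by rewrite -[2]/(2%N%:Z) -exprnP sqrrN expr1n.
Qed.

Lemma dual_vertex_action : vertex_action Y vac om (voa_c V) dual_Y.
Proof.
apply: (vertex_action_intro dual_pre) => f; split.
- move=> n; apply: dual_ext => w; rewrite dual_YE opp_vac.
  by case: eqP => // _; rewrite (lin0 (dual_linear f)).
- move=> u v l m n; move: u v.
  apply: voa_ind => [|a u hu].
    split=> [v|c x y hx hy v]; first exact: (lin0 (jacobi_defect_linear_u dual_pre v l m n f)).
    by rewrite (jacobi_defect_linear_u dual_pre v l m n f) hx hy scaler0 addr0.
  apply: voa_ind => [|b v hv].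
    split; first exact: (lin0 (jacobi_defect_linear_v dual_pre u l m n f)).
    by move=> c x y hx hy; rewrite /= (jacobi_defect_linear_v dual_pre u l m n f) hx hy scaler0 addr0.
  apply: dual_ext => w; rewrite /jacobi_defect.
  rewrite !(linB (eval_linear w)).
  have [K1 h1] := pre_trunc_nat dual_pre v f n.
  have [K2 h2] := pre_trunc_nat dual_pre u f m.
  have [K3 h3] := act_trunc_nat (voa_vertex_action V) u v l.
  rewrite (lin_fsum_nat (eval_linear w) (K := K1)) => [|i /h1 ->]; last by rewrite (pre0r dual_pre) scaler0.
  rewrite (lin_fsum_nat (eval_linear w) (K := K2)) => [|i /h2 ->]; last by rewrite (pre0r dual_pre) scaler0.
  rewrite (lin_fsum_nat (eval_linear w) (K := K3)) => [|i /h3 ->]; last by rewrite (pre0l dual_pre) scaler0.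
  apply/eqP; rewrite subr_eq0; apply/eqP.
  have lf := dual_linear f.
  (* Functionals compose with operators in reversed order, which is the order of the factors in
     [opp_jacobi]. *)
  have := congr1 (val f) (opp_jacobi hW l m n w hu hv).
  have [K4 h4] := opp_trunc hW u w (m + l).
  have [K5 h5] := opp_trunc hW v w (n + l).
  rewrite (linB lf).
  rewrite (lin_fsum_nat lf (K := K4)) => [|i /h4 ->]; last by rewrite (lin0 (opp_linear_r hW _ _)) scaler0.
  rewrite (lin_fsum_nat lf (K := K5)) => [|i /h5 ->]; last by rewrite (lin0 (opp_linear_r hW _ _)) scaler0.
  rewrite (lin_fsum_nat lf (K := K3)) => [|i /h3 ->]; last by rewrite (lin0 (opp_linear_l hW _ _)) scaler0.
  have T1 i : val (subx _ l i *: dual_Y u (m + l - i%:Z) (dual_Y v (n + i%:Z) f)) w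
      = val f (subx _ l i *: opp YW v (n + i%:Z) (opp YW u (m + l - i%:Z) w)).
    by rewrite (linZ (eval_linear w)) (linZ lf) !dual_YE.
  have T2 i : val (((-1) ^ l * subx _ l i) *:
         dual_Y v (n + l - i%:Z) (dual_Y u (m + i%:Z) f)) w
      = val f (((-1) ^ l * subx _ l i) *:
         opp YW u (m + i%:Z) (opp YW v (n + l - i%:Z) w)).
    by rewrite (linZ (eval_linear w)) (linZ lf) !dual_YE.
  have T3 i : val (subx _ (i%:Z - m - 1) i *:
         dual_Y (Y u (l + i%:Z) v) (m + n - i%:Z) f) w
      = val f (subx _ (i%:Z - m - 1) i *:
         opp YW (Y u (l + i%:Z) v) (m + n - i%:Z) w).
    by rewrite (linZ (eval_linear w)) (linZ lf) !dual_YE.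
  under eq_fsbigr do rewrite -T1; under [X in _ - X]eq_fsbigr do rewrite -T2.
  by under [X in _ = X]eq_fsbigr do rewrite -T3.
- move=> m n; apply: dual_ext => w.
  have lf := dual_linear f.
  have LE k g x : val (Lop om dual_Y k g) x = val g (Lop om YW (- k) x).
    by rewrite /Lop dual_YE opp_om; congr (val g (YW _ _ _)); lia.
  rewrite /virasoro_defect !(linB (eval_linear w)) (linD (eval_linear w)) (linZ (eval_linear w)) !LE.
  (* Transposition reverses the product and negates both indices, so the relation for (-n,-m) is the
     relevant one. The central term occurs only when -n = m and is therefore the same. *)
  have := congr1 (val f) (act_virasoro hW (- n) (- m) w).
  rewrite (linB lf) (linD lf) (linZ lf) => ->.
  have -> : - n - - m = m - n by lia.
  have -> : - n + - m = - (m + n) by lia.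
  apply/eqP; rewrite subr_eq0; apply/eqP; congr (_ + _).
  rewrite oppr_eq0; case: eqP => // mn; last by rewrite (lin0 lf).
  rewrite (linZ lf) (linZ (eval_linear w)).
  by have -> : - n = m by lia.
Qed.

End Contragredient.

(** * The action of L(0) on the contragredient *)

Section DualWeights.
Context {R : realType} (V : voa R) (W : gmodule V).
Local Notation om := (voa_om V).
Local Notation pi := (@gmod_pi _ _ W).
Local Notation YW := (@gmod_Y _ _ W).
Local Notation hW := (gmod_vertex_action W).
Local Notation hpi := (gmod_is_grading W).
Local Notation L0 := (Lop om YW 0).
Local Notation L0' := (Lop om (@dual_Y _ V W) 0).

Lemma dual_L k (g : dual W) x : val (Lop om (@dual_Y _ V W) k g) x = val g (Lop om YW (- k) x).
Proof. by rewrite /Lop dual_YE opp_om; congr (val g (YW _ _ _)); lia. Qed.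

Lemma gmod_L0_weight q w : homog pi q w -> homog pi q (L0 w).
Proof.
move=> hw; have := gmod_weight 1 (homog_om V) hw.
by rewrite (_ : (2 - 1 - 1 : int) = 0) // addr0.
Qed.

Lemma gmod_iter_shift_weight k p q w : homog pi q w -> homog pi q (iter k (shift L0 p) w).
Proof.
move=> hw; elim: k => // k IH; rewrite iterS /shift.
apply: (ssB (grading_subspace q hpi)); first exact: gmod_L0_weight.
exact: (ssZ (grading_subspace q hpi)).
Qed.

Lemma dual_iter_shift k p (g : dual W) w :
  val (iter k (shift L0' p) g) w = val g (iter k (shift L0 p) w).
Proof.
elim: k w => // k IH w.
rewrite iterS [X in val X w]/shift (linB (eval_linear w)) (linZ (eval_linear w)).
rewrite dual_L oppr0 !IH [in RHS]iterSr [in RHS]/shift.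
have li := iter_linear k (shift_linear (Lop_linear hW 0) p).
by rewrite (linB li) (linZ li) (linB (dual_linear g)) (linZ (dual_linear g)).
Qed.

Lemma contragredient_pi (f : dual W) p : contragredient (fun w => val f (pi p w)).
Proof.
apply/contragredientP; split; first exact: lin_comp (dual_linear f) (grading_linear hpi p).
exists [:: p] => q w hw; rewrite inE (homog_uniq _ hpi hw) eq_sym => /negPf ->.
exact: lin0 (dual_linear f).
Qed.

Definition dual_pi (p : R[i]) (f : dual W) : dual W :=
  mk_span (span_sub (contragredient_pi f p)).

Lemma dual_piE p f w : val (dual_pi p f) w = val f (pi p w).
Proof. by []. Qed.

Lemma dual_sum (f : dual W) (s : seq R[i]) : uniq s ->
  (forall q w, homog pi q w -> q \notin s -> val f w = 0) ->
  f = \sum_(p <- s) dual_pi p f.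
Proof.
move=> us hs; apply: dual_ext => w.
rewrite (lin_sum (eval_linear w)); under eq_bigr do rewrite dual_piE.
have [t [ut ht]] := finite_support_seq (grading_finite hpi w).
rewrite -[in LHS](grading_sum hpi w) (lin_fsum (dual_linear f) ut ht).
by apply: fsumE => // p /hs; apply; exact: homog_pi.
Qed.

Lemma dual_support (f : dual W) : exists s : seq R[i], uniq s /\
  forall q w, homog pi q w -> q \notin s -> val f w = 0.
Proof.
have [lf [s hs]] := (contragredientP (val f)).1 (dualP f).
exists (undup s); rewrite undup_uniq; split => // q w hw.
by rewrite mem_undup; exact: hs.
Qed.

(** A functional on W_[p] is a generalized eigenvector only if one exponent works for every vector
    of W_[p] on which it is evaluated. Finite dimension provides it. *)
Lemma homog_nilpotent p : fin_dim (homog pi p) ->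
  exists K : nat, forall w, homog pi p w -> iter K (shift L0 p) w = 0.
Proof.
move=> [s hs]; pose lT := Lop_linear hW 0.
suff [K hK] : exists K : nat, forall x, x \in s -> iter K (shift L0 p) (pi p x) = 0.
  exists K => w hw; have li := iter_linear K (shift_linear lT p).
  rewrite -hw; move: (hs w hw); move: {hw}w; apply: span_min => [|x /= /hK //].
  exact: linear_ker_subspace (lin_comp li (grading_linear hpi p)).
elim: s {hs} => [|x s [K hK]]; first by exists 0%N.
have [k hk] := (gmod_geig p (pi p x)).1 (homog_pi p x).
exists (maxn k K) => y; rewrite inE => /orP[/eqP ->|/hK].
  exact: (iter_shift_le lT (leq_maxl _ _) hk).
exact: (iter_shift_le lT (leq_maxr _ _)).
Qed.

Lemma dual_pi_geig p f : fin_dim (homog pi p) -> geig L0' p (dual_pi p f).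
Proof.
move=> /homog_nilpotent[K hK]; exists K; apply: dual_ext => w.
change (iter K (fun x => L0' x - p *: x) (dual_pi p f))
  with (iter K (shift L0' p) (dual_pi p f)).
rewrite dual_iter_shift dual_piE (lin0 (eval_linear w)).
have li := iter_linear K (shift_linear (Lop_linear hW 0) p).
move: w; apply: (grading_ind hpi) => [|q w hw].
  apply: linear_ker_subspace; apply: (lin_comp (dual_linear f)).
  exact: lin_comp (grading_linear hpi p) li.
rewrite /mkset (homog_uniq _ hpi (gmod_iter_shift_weight K p hw)).
case: eqP => [pq|_]; last exact: lin0 (dual_linear f).
by rewrite hK ?pq // (lin0 (dual_linear f)).
Qed.

Lemma transpose_shift a u M p (f : dual W) : homog (@voa_pi _ V) a u ->
  shift L0' (p - (a - M - 1)%:~R) (transpose u M f) = transpose u M (shift L0' p f).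
Proof.
move=> hu; apply: dual_ext => w; have lf := dual_linear f.
rewrite transposeE /shift !(linB (eval_linear _)) !(linZ (eval_linear _)).
rewrite !dual_L oppr0 !transposeE (act_L0 hW _ _ hu) (linD lf) (linZ lf) scalerBl opprB.
by rewrite addrA.
Qed.

End DualWeights.

(** * Intertwining maps and the module structure on the box product *)

Section Forms.
Context {R : realType} (V : voa R) (z : R[i]) (W1 W2 : gmodule V).
Local Notation form := (W1 -> W2 -> R[i]^o).
Local Notation vpi := (@voa_pi _ V).
Local Notation h1 := (gmod_vertex_action W1).
Local Notation h2 := (gmod_vertex_action W2).

Definition bilinear : set form :=
  [set la | (forall w2, linear (fun w1 => la w1 w2)) /\ forall w1, linear (la w1)].

Lemma form_linE (a : R[i]) (la mu : form) w1 w2 :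
  (a *: la + mu) w1 w2 = a *: la w1 w2 + mu w1 w2.
Proof. by []. Qed.

Lemma bilinear_subspace : subspace bilinear.
Proof.
split; first by split=> w a x y; rewrite /= scaler0 addr0.
move=> a la mu [la1 la2] [mu1 mu2]; split=> w c x y; rewrite !form_linE.
  by rewrite la1 mu1 !scalerDr !scalerA mulrC addrACA.
by rewrite la2 mu2 !scalerDr !scalerA mulrC addrACA.
Qed.

(** By [subx_opp] this is binom(M,i) z^(M-i). *)
Definition Dcoef (M : int) (i : nat) : R[i] :=
  subx _ (i%:Z - M - 1) i * z ^ (M - i%:Z).

(* The action of u_M on W_3 transposed through a P(z)-intertwining map, from
   the residue in x_0 of the Jacobi identity. *)
Definition Dop (u : V) (M : int) (la : form) : form := fun w1 w2 =>
  la w1 (gmod_Y u M w2)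
  + \sum_(i \in [set: nat]) Dcoef M i *: la (gmod_Y u i%:Z w1) w2.

Lemma DopE K u M la w1 w2 : bilinear la ->
  (forall i, (K <= i)%N -> gmod_Y u i%:Z w1 = 0) ->
  Dop u M la w1 w2 = la w1 (gmod_Y u M w2)
    + \sum_(i < K) Dcoef M i *: la (gmod_Y u i%:Z w1) w2.
Proof.
move=> [l1 l2] hK; rewrite /Dop (@fsum_nat _ K) // => i /hK ->.
by rewrite (lin0 (l1 w2)) scaler0.
Qed.

Lemma Y_trunc u w1 : exists K : nat, forall i : nat, (K <= i)%N ->
  gmod_Y u i%:Z w1 = 0 :> W1.
Proof.
have [K hK] := act_trunc_nat h1 u w1 0; exists K => i /hK.
by rewrite add0r.
Qed.

Lemma Dop_linear_u M la w1 w2 : bilinear la ->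
  linear (fun u => Dop u M la w1 w2).
Proof.
move=> [l1 l2]; apply: linear_addf.
  by apply: lin_comp (l2 w1) _; exact: (act_linear_l h2).
apply: fsum_linear => [i|u].
  apply: linear_scalef; apply: (lin_comp (l1 w2)); exact: (act_linear_l h1).
have [K hK] := Y_trunc u w1; exists K => i /hK ->.
by rewrite (lin0 (l1 w2)) scaler0.
Qed.

Lemma Dop_lin u M a la mu : bilinear la -> bilinear mu ->
  Dop u M (a *: la + mu) = a *: Dop u M la + Dop u M mu.
Proof.
move=> hl hm; apply/funext => w1; apply/funext => w2.
have [K hK] := Y_trunc u w1.
rewrite form_linE !(DopE (K := K)) //; last exact: (ssP bilinear_subspace).
rewrite form_linE scalerDr addrACA; congr (_ + _).
rewrite scaler_sumr -big_split; apply: eq_bigr => i _ /=.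
by rewrite form_linE scalerDr !scalerA mulrC.
Qed.

Lemma Dop0 u M : Dop u M 0 = 0.
Proof.
apply/funext => w1; apply/funext => w2; rewrite /Dop fsbig1 ?addr0 // => i _.
exact: scaler0.
Qed.

(** Substituting M = 2a - j - n - 2 identifies the prescribed action with the combination of [Dop]
    that corresponds to the combination of transposes in [dual_Y]. *)
Lemma box_YE v n (la : form) w1 w2 :
  box_Y z v n la w1 w2
  = theta_sum (fun x a j => Dop x (2 * a - j%:Z - n - 2) la w1 w2) v.
Proof.
apply: eq_fsbigr => a _; apply: eq_fsbigr => j _; congr (_ + _).
apply: eq_fsbigr => i _; rewrite /Dcoef.
have -> : i%:Z + j%:Z - 2 * a + n + 1 = i%:Z - (2 * a - j%:Z - n - 2) - 1 by lia.
by have -> : - (i%:Z - (2 * a - j%:Z - n - 2) - 1) - 1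
  = 2 * a - j%:Z - n - 2 - i%:Z by lia.
Qed.

Section IntertwiningMap.
Context (W3 : gmodule V) (I : W1 -> W2 -> R[i] -> W3).
Hypothesis hI : intertwining_map z I.
Implicit Type f : dual W3.

Lemma pairing_dual f : exists s : seq R[i], uniq s /\
  (forall (g : R[i] -> W3), completion g -> forall p, p \notin s -> val f (g p) = 0).
Proof.
have [s [us hs]] := dual_support f; exists s; split => // g hg p ps.
exact: hs (hg p) ps.
Qed.

Definition Imap f : form := fun w1 w2 => pairing (val f) (I w1 w2).

Lemma Imap_linear : linear Imap.
Proof.
move=> a f g; apply/funext => w1; apply/funext => w2; rewrite form_linE /Imap /pairing.
have [s [us hs]] := pairing_dual f; have [t [ut ht]] := pairing_dual g.
have hc := int_completion hI w1 w2.
have uu := undup_uniq (s ++ t).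
have hu p : p \notin undup (s ++ t) -> val f (I w1 w2 p) = 0 /\ val g (I w1 w2 p) = 0.
  by rewrite mem_undup mem_cat negb_or => /andP[/(hs _ hc) -> /(ht _ hc) ->].
rewrite (fsumE uu (fun p ps => (hu p ps).1)) (fsumE uu (fun p ps => (hu p ps).2)).
rewrite (fsumE uu) => [|p /hu[fp gp]]; last first.
  by rewrite (eval_linear _ a f g) fp gp scaler0 addr0.
rewrite scaler_sumr -big_split; apply: eq_bigr => p _.
exact: (eval_linear (I w1 w2 p) a f g).
Qed.

Lemma Imap_bilinear f : bilinear (Imap f).
Proof.
have [s [us hs]] := pairing_dual f.
have E w1 w2 : Imap f w1 w2 = \sum_(p <- s) val f (I w1 w2 p).
  by apply: fsumE => // p; apply: hs; exact: (int_completion hI).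
split=> w a x y; rewrite !E scaler_sumr -big_split; apply: eq_bigr => p _.
  by rewrite (int_linear_l hI) (dual_linear f).
by rewrite (int_linear_r hI) (dual_linear f).
Qed.

Lemma completion_Y_homog a v n (g : R[i] -> W3) p :
  homog vpi a v -> completion g ->
  completion_Y v n g p = gmod_Y v n (g (p - (a - n - 1)%:~R)).
Proof.
move=> hv hg; rewrite /completion_Y.
have E q : gmod_pi p (gmod_Y v n (g q)) =
   if p == q + (a - n - 1)%:~R then gmod_Y v n (g q) else 0.
  exact: (homog_uniq _ (gmod_is_grading W3) (gmod_weight n hv (hg q))).
rewrite (fsum1 (n := p - (a - n - 1)%:~R)) => [|q qp].
  by rewrite E subrK eqxx.
by rewrite E -subr_eq eq_sym (negPf qp).
Qed.

Lemma subx_shift0 (g : nat -> R[i]) (h : nat -> W3) :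
  \sum_(i \in [set: nat]) (subx _ 0 i * g i) *: h i = g 0%N *: h 0%N.
Proof.
rewrite (fsum1 (n := 0%N)) => [|i i0]; first by rewrite subx_k0 mul1r.
by rewrite subx0 ?mul0r ?scale0r // lt0n.
Qed.

(** The case k = 0 of the defining identity; [subx_shift0] leaves one term in two of the three
    sums. *)
Lemma int_commutator v w1 w2 M p :
  completion_Y v M (I w1 w2) p
  = \sum_(i \in [set: nat]) Dcoef M i *: I (gmod_Y v i%:Z w1) w2 p
    + I w1 (gmod_Y v M w2) p.
Proof.
have E := int_jacobi hI v w1 w2 0 M p.
have E1 : \sum_(i \in [set: nat]) (subx _ 0 i * z ^+ i) *:
    completion_Y v (M + 0 - i%:Z) (I w1 w2) p = completion_Y v M (I w1 w2) p.
  rewrite (subx_shift0 (fun i => z ^+ i)) expr0 scale1r.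
  by congr (completion_Y _ _ _ _); lia.
have E2 : \sum_(i \in [set: nat]) ((-1) ^ 0%Z * subx _ 0 i * z ^ (0 - i%:Z)) *:
     I w1 (gmod_Y v (M + i%:Z) w2) p = I w1 (gmod_Y v M w2) p.
  under eq_fsbigr do rewrite expr0z mul1r.
  rewrite (subx_shift0 (fun i => z ^ (0 - i%:Z)%R)) subr0 expr0z scale1r.
  by congr (I _ (gmod_Y _ _ _) _); lia.
rewrite -E1 E E2; congr (_ + _).
Qed.

Lemma pairing_completion a u M f w1 w2 : homog vpi a u ->
  \sum_(p \in [set: R[i]]) (val f (completion_Y u M (I w1 w2) p) : R[i]^o)
  = Imap (transpose u M f) w1 w2.
Proof.
move=> hu; rewrite /Imap /pairing.
rewrite (reindex_fsbigT (fun q => q + (a - M - 1)%:~R)); last first.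
  by exists (fun q => q - (a - M - 1)%:~R) => q; rewrite ?addrK ?subrK.
apply: eq_fsbigr => q _.
by rewrite (completion_Y_homog _ _ hu (int_completion hI w1 w2)) addrK transposeE.
Qed.

(** I' carries the transpose of u_M to [Dop u M]. Stability of B and the homomorphism property of I'
    both come from here. *)
Lemma Dop_Imap u M f : Dop u M (Imap f) = Imap (transpose u M f).
Proof.
apply/funext => w1; apply/funext => w2; move: u.
apply: voa_ind => [|a u hu].
  have l1 := Dop_linear_u M w1 w2 (Imap_bilinear f).
  have l2 : linear (fun u => Imap (transpose u M f) w1 w2).
    move=> a x y; rewrite -form_linE; congr (_ w1 w2).
    by rewrite transpose_linear_l Imap_linear.
  exact: linear_eq_subspace l1 l2.
have [s [us hs]] := pairing_dual f.
have E w1' w2' : Imap f w1' w2' = \sum_(p <- s) val f (I w1' w2' p).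
  by apply: fsumE => // p; apply: hs; exact: (int_completion hI).
have lf := dual_linear f.
rewrite /mkset -(pairing_completion _ _ _ _ hu).
have [K hK] := Y_trunc u w1.
rewrite (DopE M w2 (Imap_bilinear f) hK) E.
rewrite (fsumE us) => [|p ps]; last first.
  apply: (hs (completion_Y u M (I w1 w2))) => // q.
  rewrite (completion_Y_homog _ _ hu (int_completion hI w1 w2)).
  have := gmod_weight M hu (int_completion hI w1 w2 (q - (a - M - 1)%:~R)).
  by rewrite subrK.
under [in RHS]eq_bigr do rewrite int_commutator (linD lf).
rewrite big_split addrC /=; congr (_ + _).
under eq_bigr do rewrite E scaler_sumr.
rewrite exchange_big; apply: eq_bigr => p _ /=.
rewrite (@fsum_nat _ K) => [|i Ki]; last first.
  by rewrite hK // (lin0 (int_linear_l hI w2 p)) scaler0.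
by rewrite (lin_sum lf); apply: eq_bigr => i _; rewrite (linZ lf).
Qed.

End IntertwiningMap.

End Forms.

Section Box.
Context {R : realType} (V : voa R) (z : R[i]) (W1 W2 : gmodule V).
Variable obj : gmodule V -> Prop.
Hypothesis obj_gr : forall W, obj W -> grading_restricted W.
Local Notation vpi := (@voa_pi _ V).
Local Notation om := (voa_om V).
Local Notation B := (box obj z W1 W2).
Local Notation gens := (@box_generators _ V obj z W1 W2).

Section Generators.
Context (W : gmodule V) (oW : obj W) (I : W1 -> W2 -> R[i] -> W).
Hypothesis hI : intertwining_map z I.

Lemma Imap_gens f : gens (Imap I f).
Proof. by exists W, I, (val f); split => //; exact: dualP. Qed.

Definition boxmap (f : dual W) : B := mk_span (span_sub (Imap_gens f)).

Lemma boxmapE f : val (boxmap f) = Imap I f.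
Proof. by []. Qed.

Lemma boxmap_linear : linear boxmap.
Proof.
move=> a f g; apply: val_inj.
by rewrite boxmapE val_span_linear !boxmapE (Imap_linear hI).
Qed.

End Generators.

(** Every generator is a value of some [boxmap], so a linear property of B reduces to the
    contragredient of one object at a time. *)
Lemma box_ind (S : set B) : subspace S ->
  (forall W (oW : obj W) I (hI : intertwining_map z I) f, S (boxmap oW hI f)) ->
  forall x, S x.
Proof.
move=> sS Sg; apply: span_type_ind => // la h.
have [W [I [w' [oW hI cw' laE]]]] := h.
have := Sg W oW I hI (mk_span (span_sub cw')); congr S.
by apply: val_inj; rewrite boxmapE val_mk_span laE.
Qed.

Lemma box_bilinear (x : B) : bilinear (val x).
Proof.
move: x; apply: box_ind => [|W oW I hI f]; last exact: (Imap_bilinear hI f).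
split; first exact: (ss0 (@bilinear_subspace _ V W1 W2)).
move=> a x y hx hy; rewrite /mkset val_span_linear.
exact: (ssP (@bilinear_subspace _ V W1 W2)).
Qed.

Lemma box_Dop u M (x : B) : span gens (Dop z u M (val x)).
Proof.
move: x; apply: box_ind => [|W oW I hI f]; last first.
  by rewrite /mkset boxmapE (Dop_Imap hI); apply: span_sub; exact: Imap_gens.
have sp := span_subspace gens.
split; first by rewrite /mkset (lin0 (@val_span_linear _ _ _)) Dop0; exact: (ss0 sp).
move=> a x y hx hy; rewrite /mkset val_span_linear Dop_lin; first exact: (ssP sp).
  exact: box_bilinear.
exact: box_bilinear.
Qed.

Definition boxD (u : V) (M : int) (x : B) : B := mk_span (box_Dop u M x).

Lemma boxDE u M x : val (boxD u M x) = Dop z u M (val x).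
Proof. by []. Qed.

Lemma box_ext (x y : B) : (forall w1 w2, val x w1 w2 = val y w1 w2) -> x = y.
Proof.
by move=> h; apply: val_inj; apply/funext => w1; apply/funext => w2; exact: h.
Qed.

Lemma box_eval_linear w1 w2 : linear (fun x : B => val x w1 w2 : R[i]^o).
Proof. by move=> a x y; rewrite val_span_linear. Qed.

Lemma boxD_linear_l M x : linear (fun u => boxD u M x).
Proof.
move=> a u v; apply: box_ext => w1 w2.
rewrite (box_eval_linear w1 w2) !boxDE.
by rewrite (Dop_linear_u z M w1 w2 (box_bilinear x)).
Qed.

Lemma boxD_linear_r u M : linear (boxD u M).
Proof.
move=> a x y; apply: val_inj; rewrite val_span_linear !boxDE val_span_linear.
by rewrite Dop_lin //; exact: box_bilinear.
Qed.

Lemma boxD_map u M W (oW : obj W) I (hI : intertwining_map z I) f :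
  boxD u M (boxmap oW hI f) = boxmap oW hI (transpose u M f).
Proof. by apply: val_inj; rewrite boxDE !boxmapE Dop_Imap. Qed.

Definition boxY (v : V) (n : int) (x : B) : B :=
  theta_sum (fun u a j => boxD u (2 * a - j%:Z - n - 2) x) v.

Lemma boxYE v n x : val (boxY v n x) = box_Y z v n (val x).
Proof.
apply/funext => w1; apply/funext => w2; rewrite box_YE.
rewrite /boxY (lin_theta_sum v (box_eval_linear w1 w2)) // => a j.
exact: boxD_linear_l.
Qed.

Lemma boxY_map v n W (oW : obj W) I (hI : intertwining_map z I) f :
  boxY v n (boxmap oW hI f) = boxmap oW hI (dual_Y v n f).
Proof.
rewrite /dual_Y (lin_theta_sum v (boxmap_linear oW hI)) => [|a j]; last exact: transpose_linear_l.
by apply: theta_sum_ext => x a j; rewrite boxD_map.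
Qed.

Lemma boxY_pre : pre_action boxY.
Proof.
have ll n x : linear (fun v => boxY v n x).
  by apply: theta_sum_linear => a j; exact: boxD_linear_l.
have lr v n : linear (boxY v n).
  apply: theta_sum_lin => [a j x|u a j]; first exact: boxD_linear_l.
  exact: boxD_linear_r.
split=> // v; apply: box_ind => [|W oW I hI f].
  split; first by exists 0 => n _; exact: (lin0 (lr v n)).
  move=> a x y [N hx] [M hy]; exists (Order.max N M) => n.
  by rewrite ge_max lr => /andP[/hx -> /hy ->]; rewrite scaler0 addr0.
have [N hN] := pre_trunc (dual_pre (obj_gr oW).1) v f.
by exists N => n /hN; rewrite boxY_map => ->; rewrite (lin0 (boxmap_linear oW hI)).
Qed.

Lemma boxY_vertex_action :
  vertex_action (@voa_Y _ V) (voa_vac V) om (voa_c V) boxY.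
Proof.
apply: (vertex_action_intro boxY_pre); apply: box_ind => [|W oW I hI f].
  exact: axioms_at_subspace boxY_pre.
apply: (hom_axioms_at (dual_pre (obj_gr oW).1) (boxmap_linear oW hI)).
  by move=> v n w; rewrite boxY_map.
exact: vertex_action_axioms_at (dual_vertex_action (obj_gr oW).1).
Qed.

Local Notation LB := (Lop om boxY 0).

Lemma boxmap_iter_shift W (oW : obj W) I (hI : intertwining_map z I) f p k :
  iter k (shift LB p) (boxmap oW hI f)
  = boxmap oW hI (iter k (shift (Lop om (@dual_Y _ V W) 0) p) f).
Proof.
elim: k => // k IH; rewrite !iterS IH /shift (linB (boxmap_linear oW hI)).
by rewrite (linZ (boxmap_linear oW hI)) /Lop boxY_map.
Qed.

Lemma boxmap_geig W (oW : obj W) I (hI : intertwining_map z I) f p :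
  geig LB p (boxmap oW hI (dual_pi p f)).
Proof.
have [k hk] := dual_pi_geig f ((obj_gr oW).2 p); exists k.
transitivity (boxmap oW hI 0); last exact: lin0 (boxmap_linear oW hI).
by rewrite -[in RHS]hk -boxmap_iter_shift.
Qed.

(** The components of I'(f) are the images of the weight components of [f], which are generalized
    eigenvectors because each W_[p] is finite dimensional. *)
Lemma box_geig_rep (x : B) : exists f, geig_rep LB x f.
Proof.
have lL := Lop_linear boxY_vertex_action 0.
move: x; apply: box_ind => [|W oW I hI f].
  split; last by move=> a x y [g hg] [h hh]; eexists; exact: (geig_rep_lin lL a hg hh).
  by exists (fun=> 0), [::]; split=> // [n|]; [exact: geig0 | rewrite big_nil].
have [s [us hs]] := dual_support f.
exists (fun p => if p \in s then boxmap oW hI (dual_pi p f) else 0), s; split => //.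
- by move=> n /negPf ->.
- by move=> n; case: ifP => _; [exact: boxmap_geig | exact: geig0].
rewrite {1}(dual_sum us hs) (lin_sum (boxmap_linear oW hI)) big_seq [RHS]big_seq.
by apply: eq_bigr => p ->.
Qed.

Lemma box_gmodule : exists pi : R[i] -> B -> B, is_gmodule pi boxY.
Proof.
have [pi [hpi hg]] := geig_grading (Lop_linear boxY_vertex_action 0) box_geig_rep.
exists pi; split=> //; exact: boxY_vertex_action.
Qed.

Lemma boxD_shift a u M p x : homog vpi a u ->
  shift LB (p - (a - M - 1)%:~R) (boxD u M x) = boxD u M (shift LB p x).
Proof.
move=> hu; have lL := Lop_linear boxY_vertex_action 0.
move: x; apply: box_ind => [|W oW I hI f].
  have l1 := lin_comp (shift_linear lL (p - (a - M - 1)%:~R)) (boxD_linear_r u M).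
  have l2 := lin_comp (boxD_linear_r u M) (shift_linear lL p).
  exact: linear_eq_subspace l1 l2.
have S g q : shift LB q (boxmap oW hI g) = boxmap oW hI (shift (Lop om (@dual_Y _ V W) 0) q g).
  exact: (boxmap_iter_shift oW hI g q 1).
by rewrite /mkset boxD_map !S (transpose_shift _ _ _ hu) boxD_map.
Qed.

Lemma boxD_geig a u M p x : homog vpi a u -> geig LB p x ->
  geig LB (p - (a - M - 1)%:~R) (boxD u M x).
Proof.
move=> hu [k hk]; exists k.
suff -> : iter k (shift LB (p - (a - M - 1)%:~R)) (boxD u M x)
  = boxD u M (iter k (shift LB p) x) by rewrite hk (lin0 (boxD_linear_r u M)).
by elim: k {hk} => // k IH; rewrite !iterS IH (boxD_shift _ _ _ hu).
Qed.

End Box.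
(** * Finiteness of the box product *)

Section HomogeneousC1.
Context {R : realType} (V : voa R) (W : gmodule V).
Local Notation vpi := (@voa_pi _ V).
Local Notation pi := (@gmod_pi _ _ W).
Local Notation hW := (gmod_vertex_action W).
Local Notation hpi := (gmod_is_grading W).

(** The weight [n] generators of C_1(W), with the weights of both factors recorded for the descent
    in [form_determined]. *)
Definition C1_homog (n : R[i]) : set W := [set x | exists a u q w,
  [/\ homog vpi a u, 0 < a, homog pi q w, n = q + a%:~R & x = gmod_Y u (-1) w]].

Lemma homog_components (s : seq W) :
  exists t : seq W, forall x p, x \in s -> pi p x \in t \/ pi p x = 0.
Proof.
elim: s => [|x s [t ht]]; first by exists [::].
have [r [ur hr]] := finite_support_seq (grading_finite hpi x).
exists ([seq pi p x | p <- r] ++ t) => y p; rewrite inE => /orP[/eqP ->|/ht h].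
  have [pr|/hr] := boolP (p \in r); last by right.
  by left; rewrite mem_cat; apply/orP; left; apply/mapP; exists p.
by case: (h p) => [h'|]; [left; rewrite mem_cat h' orbT | right].
Qed.

(** The finite set consists of all components of the given spanning vectors; projecting an expansion
    of [w] to weight [n] retains only generators of weight [n]. *)
Lemma C1_cofinite_homog : C1_cofinite W -> exists t : seq W, forall n w,
  homog pi n w -> span (C1_homog n `|` [set x | x \in t /\ homog pi n x]) w.
Proof.
move=> [s hs]; have [t ht] := homog_components s; exists t => n w hw.
have lpi := grading_linear hpi n.
set S := span _; have sS : subspace S by exact: span_subspace.
suff h x : span (@C1 _ _ W `|` [set` s]) x -> S (pi n x) by rewrite -hw; apply: h.
move: x; apply: span_min.
  exact: linear_preim_subspace lpi sS.
move=> x [Cx|xs]; last first.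
  have [pt|p0] := ht x n xs; last by rewrite /mkset p0; exact: (ss0 sS).
  by apply: span_sub; right; split => //; exact: homog_pi.
move: x Cx; apply: span_min.
  exact: linear_preim_subspace lpi sS.
move=> _ [u [x [Vu ->]]].
have [ru [uru hu]] := finite_support_seq (grading_finite (voa_is_grading V) u).
rewrite /mkset -[X in gmod_Y X](grading_sum (voa_is_grading V) u) (fsumE uru hu).
rewrite (act_lin_sum_l hW) (lin_sum lpi); apply: (ss_sum sS) => a _.
move: x; apply: (grading_ind hpi) => [|q x hx].
  have l := lin_comp lpi (act_linear_r hW (vpi a u) (-1)).
  exact: linear_preim_subspace l sS.
have [a0|a0] := leP a 0; first by rewrite /mkset Vu // (act0l hW) (lin0 lpi); exact: (ss0 sS).
have hua := homog_voa_pi a u.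
have e : (a - -1 - 1)%:~R = a%:~R :> R[i] by congr _%:~R; lia.
have := gmod_weight (-1) hua hx; rewrite e => hY.
rewrite /mkset (homog_uniq n hpi hY); case: eqP => [nq|_]; last exact: (ss0 sS).
by apply: span_sub; left; exists a, (vpi a u), q, x.
Qed.

End HomogeneousC1.

Section BoxFinite.
Context {R : realType} (V : voa R) (z : R[i]) (W1 W2 : gmodule V).
Variable obj : gmodule V -> Prop.
Hypothesis obj_gr : forall W, obj W -> grading_restricted W.
Local Notation form := (W1 -> W2 -> R[i]^o).
Local Notation vpi := (@voa_pi _ V).
Local Notation om := (voa_om V).
Local Notation B := (box obj z W1 W2).
Local Notation boxY := (@boxY _ V z W1 W2 obj).
Local Notation boxD := (@boxD _ V z W1 W2 obj).
Local Notation LB := (Lop om boxY 0).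

(** Induction on the total real part. In one argument u_{-1} contributes the weight a of u; moved to
    the other as u_i with i >= 0 it contributes a - i - 1. [E1] clears C_1 from the second argument,
    then [E2] from the first, and values on [t1] and [t2] remain. *)
Lemma form_determined (la : form) (t1 : seq W1) (t2 : seq W2) (c : nat -> R[i]) :
  lower_truncated W1 -> lower_truncated W2 ->
  (forall n w, homog (@gmod_pi _ _ W1) n w ->
    span (C1_homog n `|` [set x | x \in t1 /\ homog (@gmod_pi _ _ W1) n x]) w) ->
  (forall n w, homog (@gmod_pi _ _ W2) n w ->
    span (C1_homog n `|` [set x | x \in t2 /\ homog (@gmod_pi _ _ W2) n x]) w) ->
  bilinear la ->
  (forall a u, homog vpi a u -> 0 < a -> Dop z u (-1) la = 0) ->
  (forall a u, homog vpi a u -> 0 < a -> forall w1 w2,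
     la (gmod_Y u (-1) w1) w2
     = \sum_(i \in [set: nat]) c i *: la w1 (gmod_Y u i%:Z w2)) ->
  (forall x1 x2, x1 \in t1 -> x2 \in t2 -> la x1 x2 = 0) ->
  forall w1 w2, la w1 w2 = 0.
Proof.
move=> [r1 tr1] [r2 tr2] ht1 ht2 bla E1 E2 la0; have [l1 l2] := bla.
suff main N n1 n2 w1 w2 : homog (@gmod_pi _ _ W1) n1 w1 ->
    homog (@gmod_pi _ _ W2) n2 w2 ->
    complex.Re n1 + complex.Re n2 < r1 + r2 + N%:R -> la w1 w2 = 0.
  move=> w1 w2; move: w1; apply: (grading_ind (gmod_is_grading W1)) => [|n1 w1 hw1].
    exact: linear_ker_subspace (l1 w2).
  move: w2; apply: (grading_ind (gmod_is_grading W2)) => [|n2 w2 hw2].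
    exact: linear_ker_subspace (l2 w1).
  have [K hK] := Re_bound [:: n2] (r1 + r2 - complex.Re n1).
  apply: (main K n1 n2) => //.
  by rewrite addrC -ltrBrDr addrAC; apply: hK; rewrite inE.
elim: N n1 n2 w1 w2 => [|N IH] n1 n2 w1 w2 hw1 hw2 hN.
  have [n1r|n1r] := ltP (complex.Re n1) r1.
    by rewrite -hw1 (tr1 _ n1r) (lin0 (l1 w2)).
  have n2r : complex.Re n2 < r2 by move: hN; rewrite addr0; lra.
  by rewrite -hw2 (tr2 _ n2r) (lin0 (l2 w1)).
move: (ht2 n2 w2 hw2); move: {hw2} w2; apply: span_min.
  exact: linear_ker_subspace (l2 w1).
have shrink (a : int) (i : nat) (q1 q2 : R[i]) :
   complex.Re (q1 + q2 + a%:~R) < r1 + r2 + N.+1%:R ->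
   complex.Re (q1 + (a - i%:Z - 1)%:~R) + complex.Re q2 < r1 + r2 + N%:R.
  rewrite !ReD !Re_int !intrD !intrN -pmulrn -natr1 => h.
  have : 0 <= i%:R :> R by exact: ler0n.
  by move: h; lra.
move=> w2 [[a [u [q [w [hu a0 hw n2E ->]]]]]|[w2t hw2]].
  have := congr1 (fun g : form => g w1 w) (E1 a u hu a0).
  have [K hK] := Y_trunc u w1.
  rewrite (DopE z (-1) w bla hK) big1 ?addr0 // => i _.
  rewrite (IH _ _ _ _ (gmod_weight i%:Z hu hw1) hw) ?scaler0 //.
  by apply: shrink; rewrite -addrA -n2E ReD.
move: (ht1 n1 w1 hw1); move: {hw1} w1; apply: span_min.
  exact: linear_ker_subspace (l1 w2).
move=> w1 [[a [u [q [w [hu a0 hw n1E ->]]]]]|[w1t hw1]]; last exact: la0.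
rewrite /mkset (E2 a u hu a0); apply: fsbig1 => i _.
rewrite (IH _ _ _ _ hw (gmod_weight i%:Z hu hw2)) ?scaler0 // addrC.
by apply: shrink; rewrite -addrA -n1E ReD addrC.
Qed.

Section Residue.
Context (W3 : gmodule V) (I : W1 -> W2 -> R[i] -> W3).
Hypothesis hI : intertwining_map z I.
Hypothesis tW3 : lower_truncated W3.

(** u_{-1-i} raises weights by a + i, so for large i nothing above the lower bound of W_3 is sent
    into the finite support of [f]. *)
Lemma transpose_trunc a u (f : dual W3) : homog vpi a u ->
  exists K : nat, forall i : nat, (K <= i)%N -> transpose u (- 1 - i%:Z) f = 0.
Proof.
move=> hu; have [s [us hs]] := dual_support f; have [r hr] := tW3.
have [K hK] := Re_bound s (r + a%:~R).
exists K => i Ki; apply: dual_ext => w; rewrite transposeE (lin0 (eval_linear w)).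
have lf := dual_linear f; have l := lin_comp lf (act_linear_r (gmod_vertex_action W3) u (- 1 - i%:Z)).
move: w; apply: (grading_ind (gmod_is_grading W3)) => [|q w hw].
  exact: linear_ker_subspace l.
have hY := gmod_weight (- 1 - i%:Z) hu hw.
have [qs|qs] := boolP (q + (a - (- 1 - i%:Z) - 1)%:~R \in s); last exact: hs hY qs.
have -> : w = 0; last exact: lin0 l.
rewrite -hw; apply: hr; have := hK _ qs.
have -> : a - (- 1 - i%:Z) - 1 = a + i%:Z by lia.
rewrite ReD Re_int intrD -pmulrn => h.
have : K%:R <= i%:R :> R by rewrite ler_nat.
by move: h; lra.
Qed.

(* The case k = -1, m = 0 of the defining identity of intertwining maps. *)
Lemma Imap_residue a u (f : dual W3) w1 w2 : homog vpi a u ->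
  Imap I f (gmod_Y u (-1) w1) w2
  + \sum_(i \in [set: nat]) ((-1) ^ (-1 : int) * z ^ (- 1 - i%:Z))
      *: Imap I f w1 (gmod_Y u i%:Z w2)
  = \sum_(i \in [set: nat]) z ^+ i *: Imap I (transpose u (- 1 - i%:Z) f) w1 w2.
Proof.
move=> hu; have lf := dual_linear f; have [s [us hs]] := pairing_dual f.
have E w1' w2' : Imap I f w1' w2' = \sum_(p <- s) val f (I w1' w2' p).
  by apply: fsumE => // p; apply: hs; exact: (int_completion hI).
have [K hK] := transpose_trunc f hu.
have l2 w1' := (Imap_bilinear hI f).2 w1'.
have [K2 hK2] := Y_trunc u w2.
rewrite [RHS](@fsum_nat _ K) => [|i Ki]; last first.
  by rewrite hK // (lin0 (Imap_linear hI)) scaler0.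
rewrite (@fsum_nat _ K2) => [|i Ki]; last first.
  by rewrite hK2 // (lin0 (l2 w1)) scaler0.
(* The weight p part involves the component of I(w1,w2) at p - a - i, which vanishes for large i;
   this bound depends on p. *)
have Ic p : exists M : nat, forall i, (M <= i)%N ->
    completion_Y u (- 1 - i%:Z) (I w1 w2) p = 0.
  have [M hM] := int_truncation hI w1 w2 (p - a%:~R).
  exists M => i Mi; rewrite (completion_Y_homog _ _ hu (int_completion hI w1 w2)).
  have -> : a - (- 1 - i%:Z) - 1 = a + i%:Z by lia.
  rewrite intrD opprD addrA -pmulrn hM // (act0r (gmod_vertex_action W3)) //.
have J p : \sum_(i \in [set: nat]) z ^+ i *: completion_Y u (- 1 - i%:Z) (I w1 w2) p
    = I (gmod_Y u (-1) w1) w2 p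
    + \sum_(i \in [set: nat]) ((-1) ^ (-1 : int) * z ^ (- 1 - i%:Z))
        *: I w1 (gmod_Y u i%:Z w2) p.
  have := int_jacobi hI u w1 w2 (-1) 0 p.
  rewrite [X in _ = X + _ -> _](fsum1 (n := 0%N)) => [|i i0]; last first.
    by rewrite subx_opp (@binomz_small _ 0) ?mul0r ?scale0r // lt0n.
  rewrite subx_opp binomz0 mul1r subr0 expr0z scale1r addr0 => J.
  transitivity (\sum_(i \in [set: nat])
      (subx _ (-1) i * z ^+ i) *: completion_Y u (0 + -1 - i%:Z) (I w1 w2) p).
    by apply: eq_fsbigr => i _; rewrite subxN1 mul1r add0r.
  rewrite J; congr (_ + _); apply: eq_fsbigr => i _.
  by rewrite subxN1 mulr1 add0r.
(* After pairing with [f] the bounds [K] and [K2] no longer depend on p, so the sums can be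
   exchanged with the sum over p. *)
have fJ p : \sum_(i < K) z ^+ i *: (val f (completion_Y u (- 1 - i%:Z) (I w1 w2) p) : R[i]^o)
  = val f (I (gmod_Y u (-1) w1) w2 p)
   + \sum_(i < K2) ((-1) ^ (-1 : int) * z ^ (- 1 - i%:Z))
        *: val f (I w1 (gmod_Y u i%:Z w2) p).
  have := congr1 (val f) (J p); have [M hM] := Ic p.
  rewrite (linD lf) (lin_fsum_nat lf (K := M)) => [|i /hM ->]; last by rewrite scaler0.
  rewrite (lin_fsum_nat lf (K := K2)) => [|i /hK2 ->]; last first.
    by rewrite (lin0 (int_linear_r hI w1 p)) scaler0.
  rewrite (@fsum_nat _ K) => [|i Ki]; last first.
    rewrite (completion_Y_homog _ _ hu (int_completion hI w1 w2)) (linZ lf).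
    by rewrite -transposeE hK // (lin0 (eval_linear _)) scaler0.
  rewrite (@fsum_nat _ K2) => [|i Ki]; last first.
    by rewrite hK2 // (lin0 (int_linear_r hI w1 p)) scaler0 (lin0 lf).
  under eq_bigr do rewrite (linZ lf); move=> ->; congr (_ + _).
  by apply: eq_bigr => i _; rewrite (linZ lf).
transitivity (\sum_(p <- s) \sum_(i < K)
   z ^+ i *: (val f (completion_Y u (- 1 - i%:Z) (I w1 w2) p) : R[i]^o)).
  under [RHS]eq_bigr do rewrite fJ.
  rewrite big_split -E /=; congr (_ + _).
  by rewrite exchange_big; apply: eq_bigr => i _ /=; rewrite -scaler_sumr -E.
rewrite exchange_big; apply: eq_bigr => i _ /=; rewrite -scaler_sumr; congr (_ *: _).
rewrite -(pairing_completion hI _ _ _ _ hu) (fsumE us) // => p ps.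
apply: (hs (completion_Y u (- 1 - i%:Z) (I w1 w2))) => // q.
rewrite (completion_Y_homog _ _ hu (int_completion hI w1 w2)).
have := gmod_weight (- 1 - i%:Z) hu (int_completion hI w1 w2 (q - (a - (- 1 - i%:Z) - 1)%:~R)).
by rewrite subrK.
Qed.

End Residue.

Lemma boxD_derivative u M (x : B) :
  boxD (Lop om (@voa_Y _ V) (-1) u) M x = - M%:~R *: boxD u (M - 1) x.
Proof.
move: x; apply: box_ind => [|W oW I hI f].
  have l1 : linear (boxD (Lop om (@voa_Y _ V) (-1) u) M) by exact: boxD_linear_r.
  have l2 : linear (fun x => - M%:~R *: boxD u (M - 1) x).
    by apply: linear_scalef; exact: boxD_linear_r.
  exact: linear_eq_subspace l1 l2.
rewrite /mkset !boxD_map -(linZ (boxmap_linear oW hI)); congr (boxmap _ _ _).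
apply: dual_ext => w; have := transposeE (Lop om (@voa_Y _ V) (-1) u) M f w.
rewrite (act_derivative (gmod_vertex_action W)) (linZ (dual_linear f)) => ->.
by rewrite (linZ (eval_linear w)) transposeE.
Qed.

Lemma boxD_trunc a u (x : B) : homog vpi a u ->
  exists K : nat, forall i : nat, (K <= i)%N -> boxD u (- 1 - i%:Z) x = 0.
Proof.
move=> hu; move: x; apply: box_ind => [|W oW I hI f].
  split; first by exists 0%N => i _; exact: (lin0 (boxD_linear_r u _)).
  move=> a' x y [K hK] [K' hK']; exists (maxn K K') => i.
  by rewrite geq_max boxD_linear_r => /andP[/hK -> /hK' ->]; rewrite scaler0 addr0.
have [K hK] := transpose_trunc (obj_gr oW).1 f hu; exists K => i /hK.
by rewrite boxD_map => ->; rewrite (lin0 (boxmap_linear oW hI)).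
Qed.

Lemma box_residue a u (x : B) w1 w2 : homog vpi a u ->
  val x (gmod_Y u (-1) w1) w2
  + \sum_(i \in [set: nat]) ((-1) ^ (-1 : int) * z ^ (- 1 - i%:Z))
      *: val x w1 (gmod_Y u i%:Z w2)
  = \sum_(i \in [set: nat]) z ^+ i *: (val (boxD u (- 1 - i%:Z) x) w1 w2 : R[i]^o).
Proof.
move=> hu; move: x; apply: box_ind => [|W oW I hI f]; last first.
  rewrite /mkset boxmapE (Imap_residue hI (obj_gr oW).1 f w1 w2 hu).
  by apply: eq_fsbigr => i _; rewrite boxD_map boxmapE.
have l1 : linear (fun x : B => val x (gmod_Y u (-1) w1) w2
  + \sum_(i \in [set: nat]) ((-1) ^ (-1 : int) * z ^ (- 1 - i%:Z))
      *: val x w1 (gmod_Y u i%:Z w2) : R[i]^o).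
  apply: linear_addf; first exact: box_eval_linear.
  apply: fsum_linear => [i|x]; first by apply: linear_scalef; exact: box_eval_linear.
  have [K hK] := Y_trunc u w2; exists K => i /hK ->.
  by rewrite (lin0 ((box_bilinear x).2 w1)) scaler0.
have l2 : linear (fun x : B => \sum_(i \in [set: nat])
      z ^+ i *: (val (boxD u (- 1 - i%:Z) x) w1 w2 : R[i]^o)).
  apply: fsum_linear => [i|x].
    by apply: linear_scalef; apply: (lin_comp (box_eval_linear w1 w2)); exact: boxD_linear_r.
  have [K hK] := boxD_trunc x hu; exists K => i /hK ->.
  by rewrite (lin0 (box_eval_linear w1 w2)) scaler0.
exact: linear_eq_subspace l1 l2.
Qed.

(* Functionals annihilating C_1 of the fusion product. *)
Definition lowest : set B :=
  [set x | forall a u, homog vpi a u -> 0 < a -> boxD u (-1) x = 0].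

Lemma lowest_subspace : subspace lowest.
Proof.
split; first by move=> a u _ _; exact: (lin0 (boxD_linear_r u (-1))).
by move=> c x y hx hy a u hu a0; rewrite boxD_linear_r (hx a) // (hy a) // scaler0 addr0.
Qed.

(** L(-1)u has positive weight when u has, and its mode -1-i is (i+1) times the mode -2-i of u; the
    coefficient is nonzero. This annihilates the right-hand side of [box_residue]. *)
Lemma lowest_modes x : lowest x ->
  forall (i : nat) a u, homog vpi a u -> 0 < a -> boxD u (- 1 - i%:Z) x = 0.
Proof.
move=> hx; elim=> [|i IH] a u hu a0; first by rewrite subr0; exact: hx hu a0.
have a1 : 0 < a - -1 by lia.
have := IH _ _ (homog_L (-1) hu) a1; rewrite boxD_derivative => /eqP.
have -> : - 1 - i.+1%:Z = - 1 - i%:Z - 1 by lia.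
rewrite scaler_eq0 oppr_eq0 intr_eq0 => /orP[/eqP|/eqP //].
by lia.
Qed.

Lemma lowest_fin_dim : lower_truncated W1 -> lower_truncated W2 ->
  C1_cofinite W1 -> C1_cofinite W2 -> fin_dim lowest.
Proof.
move=> tr1 tr2 /C1_cofinite_homog[t1 ht1] /C1_cofinite_homog[t2 ht2].
apply: (@fin_dim_lin_seq _ _ _ lowest _ [seq (x1, x2) | x1 <- t1, x2 <- t2]
  (fun x12 (x : B) => val x x12.1 x12.2 : R[i]^o)).
- exact: lowest_subspace.
- by move=> x12; exact: box_eval_linear.
- move=> x12 _; exists [set: R[i]^o] => //; exists [:: (1 : R[i]^o)] => c _.
  have -> : c = c *: (1 : R[i]^o) by rewrite /GRing.scale /= mulr1.
  by apply: (ssZ (span_subspace _)); apply: span_sub; rewrite /= inE.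
apply: fin_dim_sub (fin_dim0 _) => x [hx x0]; apply: box_ext => w1 w2.
rewrite (lin0 (box_eval_linear w1 w2)).
(* With the right-hand side of [box_residue] zero, u_{-1} moves to the second argument with these
   coefficients, which equal z^(-1-i). *)
apply: (form_determined (c := fun i => - ((-1) ^ (-1 : int) * z ^ (- 1 - i%:Z)))
  tr1 tr2 ht1 ht2 (box_bilinear x)).
- by move=> a u hu a0; rewrite -boxDE (hx a u hu a0) (lin0 (@val_span_linear _ _ _)).
- move=> a u hu a0 w1' w2'; have := box_residue x w1' w2' hu.
  rewrite [X in _ = X -> _]fsbig1 => [|i _]; last first.
    by rewrite (lowest_modes hx i hu a0) (lin0 (box_eval_linear w1' w2')) scaler0.
  move=> /eqP; rewrite addr_eq0 => /eqP ->.
  have [K hK] := Y_trunc u w2'.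
  have z0 i : (K <= i)%N -> val x w1' (gmod_Y u i%:Z w2') = 0.
    by move=> /hK ->; exact: (lin0 ((box_bilinear x).2 w1')).
  rewrite (@fsum_nat _ K) => [|i /z0 ->]; last by rewrite scaler0.
  rewrite (@fsum_nat _ K) => [|i /z0 ->]; last by rewrite scaler0.
  by rewrite -sumrN; apply: eq_bigr => i _; rewrite scaleNr.
- move=> x1 x2 x1t x2t; apply: (x0 (x1, x2)).
  by apply/allpairsP; exists (x1, x2).
Qed.

(** The lower bound [r] is chosen for one element and depends on the objects it comes from. It
    survives [boxD], because I'(f) is sent to I' of another functional on the same object. *)
Definition box_ge (r : R) : set B := span [set x |
  exists W (oW : obj W) I (hI : intertwining_map z I) f,
    (forall n, complex.Re n < r -> forall w : W, gmod_pi n w = 0)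
    /\ x = boxmap oW hI f].

Lemma box_ge_exists x : exists r, box_ge r x.
Proof.
move: x; apply: box_ind => [|W oW I hI f].
  split; first by exists 0; exact: (ss0 (span_subspace _)).
  move=> a x y [r hx] [r' hy]; exists (Order.min r r').
  apply: (ssP (span_subspace _)).
    move: x hx; apply: spanS => x [W [oW [I [hI [f [hr ->]]]]]].
    exists W, oW, I, hI, f; split => // n; rewrite lt_min => /andP[nr _]; exact: hr.
  move: y hy; apply: spanS => y [W [oW [I [hI [f [hr ->]]]]]].
  exists W, oW, I, hI, f; split => // n; rewrite lt_min => /andP[_ nr]; exact: hr.
have [r hr] := (obj_gr oW).1; exists r; apply: span_sub.
by exists W, oW, I, hI, f.
Qed.

Lemma box_geD r u M x : box_ge r x -> box_ge r (boxD u M x).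
Proof.
move: x; apply: span_min.
  exact: linear_preim_subspace (boxD_linear_r u M) (span_subspace _).
move=> _ [W [oW [I [hI [f [hr ->]]]]]]; rewrite /mkset boxD_map.
by apply: span_sub; exists W, oW, I, hI, (transpose u M f).
Qed.

Context (pi : R[i] -> B -> B) (hB : is_gmodule pi boxY).
Local Notation hpi := (gmod_grading hB).

Lemma box_homogP p x : homog pi p x <-> geig LB p x.
Proof. exact: (gmod_L0 hB). Qed.

Lemma box_ge_homog r p x : box_ge r x -> complex.Re p < r -> pi p x = 0.
Proof.
move=> hx pr; move: x hx; apply: span_min.
  exact: linear_ker_subspace (grading_linear hpi p).
move=> _ [W [oW [I [hI [f [hr ->]]]]]]; rewrite /mkset.
have [s [us hs]] := dual_support f.
rewrite (dual_sum us hs) (lin_sum (boxmap_linear oW hI)) (lin_sum (grading_linear hpi p)).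
apply: big1 => q _.
have hq : homog pi q (boxmap oW hI (dual_pi q f)).
  by apply/box_homogP; exact: boxmap_geig.
rewrite (homog_uniq p hpi hq); case: eqP => // <-.
have -> : dual_pi p f = 0; last exact: lin0 (boxmap_linear oW hI).
by apply: dual_ext => w; rewrite dual_piE hr // (lin0 (dual_linear f)) (lin0 (eval_linear w)).
Qed.

Lemma boxD_weight a u p x : homog vpi a u -> homog pi p x ->
  homog pi (p - a%:~R) (boxD u (-1) x).
Proof.
move=> hu /box_homogP hx; apply/box_homogP.
have := boxD_geig obj_gr (-1) hu hx.
by rewrite (_ : a - -1 - 1 = a) //; lia.
Qed.

(** As long as the element is not in [lowest], some [boxD u (-1)] keeps it nonzero and lowers its
    weight by an integer of at least 1; [box_ge r] ends the descent. *)
Lemma lowest_exists p x : homog pi p x -> x != 0 ->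
  exists (k : nat) y, [/\ lowest y, y != 0 & homog pi (p - k%:R) y].
Proof.
move=> hx x0; have [r hr] := box_ge_exists x.
have [N hN] := Re_bound [:: p] r; have {hN} := hN p (mem_head _ _).
elim: N p x hx x0 hr => [|N IH] p x hx x0 hr pN.
  move: x0; rewrite -hx (box_ge_homog hr) ?eqxx //.
  by move: pN; rewrite addr0.
have [lx|nlx] := pselect (lowest x); first by exists 0%N, x; rewrite subr0.
move: nlx => /existsNP[a /existsNP[u /not_implyP[hu /not_implyP[a0 /eqP D0]]]].
have [|k [y [ly y0 hy]]] := IH _ _ (boxD_weight hu hx) D0 (box_geD u (-1) hr).
  rewrite ReD ReN Re_int; have : 1%:~R <= a%:~R :> R by rewrite ler_int; lia.
  by move: pN; rewrite -natr1; lra.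
exists (absz a + k)%N, y; split => //.
move: hy; congr (homog _ _ _); rewrite natrD opprD addrA; congr (_ - _ - _).
by rewrite pmulrn; congr (_%:~R); lia.
Qed.

Lemma Re_lower_bound (s : seq R[i]) : exists r, forall q, q \in s -> r <= complex.Re q.
Proof.
elim: s => [|q s [r hr]]; first by exists 0.
exists (Order.min r (complex.Re q)) => p; rewrite inE ge_min => /orP[/eqP ->|/hr ->//].
by rewrite lexx orbT.
Qed.

Lemma box_grading_restricted : lower_truncated W1 -> lower_truncated W2 ->
  C1_cofinite W1 -> C1_cofinite W2 -> grading_restricted (MkGmodule hB).
Proof.
move=> tr1 tr2 c1 c2; have [t ht] := lowest_fin_dim tr1 tr2 c1 c2.
(* A nonzero homogeneous element of [lowest] has a nonzero component at its weight, so that weight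
   occurs in one of the finitely many vectors spanning [lowest]. *)
have [s hs] : exists s : seq R[i], forall p y, lowest y -> y != 0 -> homog pi p y -> p \in s.
  have [s hs] : exists s : seq R[i], forall p x, x \in t -> p \notin s -> pi p x = 0.
    elim: t {ht} => [|x t [s hs]]; first by exists [::].
    have [r [ur hr]] := finite_support_seq (grading_finite hpi x).
    exists (r ++ s) => p y; rewrite inE mem_cat negb_or => /orP[/eqP ->|yt] /andP[pr ps].
      exact: hr.
    exact: hs.
  exists s => p y /ht hy y0 py; apply: contraNT y0 => ps.
  rewrite -py; move: y hy {py}; suff h : span [set` t] `<=` [set y | pi p y = 0].
    by move=> y /h ->.
  apply: span_min => [|y yt]; last exact: hs.
  exact: linear_ker_subspace (grading_linear hpi p).
have [r hr] := Re_lower_bound s.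
have low p x : homog pi p x -> complex.Re p < r -> x = 0.
  move=> hx pr; apply/eqP/negPn/negP => x0.
  have [k [y [ly y0 hy]]] := lowest_exists hx x0.
  have := hr _ (hs _ _ ly y0 hy); rewrite ReD ReN Re_nat.
  have : 0 <= k%:R :> R by exact: ler0n.
  by move: pr; lra.
split.
  exists r => n nr w; apply: (low n) => //.
  by rewrite /homog /= (grading_orth hpi) eqxx.
move=> p /=; have [N hN] := Re_bound [:: p] r; have {hN} := hN p (mem_head _ _).
elim: N p => [|N IH] p pN.
  apply: fin_dim_sub (fin_dim0 _) => x hx; apply: (low p) => //.
  by move: pN; rewrite addr0.
have [tV htV] := choice (voa_fin_dim (voa_axioms V)).
(* For Re p < r + N + 1, vectors u of weight above N + 1 send B_[p] below r, hence to 0. Only the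
   spanning vectors of V_(k) with 1 <= k <= N + 1 need testing: their common kernel lies in
   [lowest], and their targets are covered by induction. *)
pose idx := [seq (k%:Z, x) | k <- iota 1 N.+1, x <- tV k%:Z].
have sH := grading_subspace p hpi.
apply: (@fin_dim_lin_seq _ _ _ (homog pi p) _ idx
  (fun kx (x : B) => boxD (vpi kx.1 kx.2) (-1) x)) => //.
- by move=> kx; exact: boxD_linear_r.
- move=> _ /allpairsPdep[k [x [ki xt ->]]] /=.
  exists (homog pi (p - (k%:Z)%:~R)); last first.
    by move=> y; apply: boxD_weight; exact: homog_voa_pi.
  apply: IH; move: ki; rewrite mem_iota => /andP[k1 _].
  rewrite ReD ReN -pmulrn Re_nat; have : 1 <= k%:R :> R by rewrite ler1n.
  by move: pN; rewrite -natr1; lra.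
apply: fin_dim_sub (_ : fin_dim lowest); last by exists t.
move=> x [hx x0] a u hu a0.
have [aN|aN] := leP a N.+1%:Z; last first.
  apply: (low _ _ (boxD_weight hu hx)); rewrite ReD ReN Re_int.
  have : (N.+1%:Z)%:~R <= a%:~R :> R by rewrite ler_int ltW.
  by move: pN; rewrite -pmulrn; lra.
have [k kE] : exists k : nat, a = k%:Z by exists (absz a); lia.
rewrite -hu; move: (htV a u hu); move: {hu}u; apply: span_min => [|v vt].
  have l := lin_comp (f := fun u => boxD u (-1) x) (boxD_linear_l (-1) x)
    (grading_linear (voa_is_grading V) a).
  exact: linear_ker_subspace l.
apply: (x0 (a, v)); apply/allpairsPdep; exists k, v; split => //.
- by rewrite mem_iota; lia.
- by rewrite -kE.
- by rewrite kE.
Qed.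

End BoxFinite.
(** * Submodules and quotients *)

Section QuotientSpace.
Context {F : fieldType} {W : lmodType F} (S0 : {S : set W | subspace S}).
Local Notation S := (sval S0).
Local Notation sS := (svalP S0).

(** The chosen representative depends only on the coset, so the quotient is the subtype of fixed
    points and inherits its choice structure from [W]. *)
Definition quot_repr (w : W) : W := xget 0 [set y | S (w - y)].

Lemma quot_reprP w : S (w - quot_repr w).
Proof.
apply: (xgetPex 0 (P := [set y | S (w - y)])).
by exists w; rewrite /mkset subrr; exact: (ss0 sS).
Qed.

Lemma quot_repr_eq x y : S (x - y) -> quot_repr x = quot_repr y.
Proof.
move=> Sxy; rewrite /quot_repr; congr xget; apply/seteqP; split => t /= h.
  by rewrite -(subrKA x) addrC -opprB; apply: (ssB sS).
by rewrite -(subrKA y); apply: (ssD sS).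
Qed.

Lemma quot_repr_idem w : quot_repr (quot_repr w) == quot_repr w.
Proof.
by apply/eqP/quot_repr_eq; rewrite -opprB; apply: (ssN sS); exact: quot_reprP.
Qed.

Record quot_space : Type := QuotSpace { quot_val : W; _ : quot_repr quot_val == quot_val }.
HB.instance Definition _ := [isSub for quot_val].
HB.instance Definition _ := [Choice of quot_space by <:].

Definition proj (w : W) : quot_space := QuotSpace (quot_repr_idem w).

Lemma proj_val (a : quot_space) : proj (quot_val a) = a.
Proof. by apply: val_inj => /=; apply/eqP; case: a. Qed.

Lemma projP x y : proj x = proj y <-> S (x - y).
Proof.
split=> [/(congr1 quot_val) /= e|h]; last by apply: val_inj; exact: quot_repr_eq.
have := ssB sS (quot_reprP x) (quot_reprP y).
by rewrite e opprB addrA subrK.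
Qed.

Definition quot_add (a b : quot_space) := proj (quot_val a + quot_val b).
Definition quot_opp (a : quot_space) := proj (- quot_val a).
Definition quot_scale (c : F) (a : quot_space) := proj (c *: quot_val a).

Lemma proj_quot_val x : S (quot_val (proj x) - x).
Proof. by rewrite -opprB; apply: (ssN sS); exact: quot_reprP. Qed.

Lemma quot_addE x y : quot_add (proj x) (proj y) = proj (x + y).
Proof.
apply/projP; rewrite opprD addrACA.
by apply: (ssD sS); exact: proj_quot_val.
Qed.

Lemma quot_oppE x : quot_opp (proj x) = proj (- x).
Proof. by apply/projP; rewrite -opprD; apply: (ssN sS); exact: proj_quot_val. Qed.

Lemma quot_scaleE c x : quot_scale c (proj x) = proj (c *: x).
Proof. by apply/projP; rewrite -scalerBr; apply: (ssZ sS); exact: proj_quot_val. Qed.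

Lemma quot_addA : associative quot_add.
Proof.
by move=> a b c; rewrite -(proj_val a) -(proj_val b) -(proj_val c) !quot_addE addrA.
Qed.
Lemma quot_addC : commutative quot_add.
Proof. by move=> a b; rewrite -(proj_val a) -(proj_val b) !quot_addE addrC. Qed.
Lemma quot_add0 : left_id (proj 0) quot_add.
Proof. by move=> a; rewrite -(proj_val a) quot_addE add0r. Qed.
Lemma quot_addN : left_inverse (proj 0) quot_opp quot_add.
Proof. by move=> a; rewrite -(proj_val a) quot_oppE quot_addE addNr. Qed.

HB.instance Definition _ :=
  GRing.isZmodule.Build quot_space quot_addA quot_addC quot_add0 quot_addN.

Lemma projD x y : proj x + proj y = proj (x + y).
Proof. exact: quot_addE. Qed.

Lemma quot_scaleA c d a : quot_scale c (quot_scale d a) = quot_scale (c * d) a.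
Proof. by rewrite -(proj_val a) !quot_scaleE scalerA. Qed.
Lemma quot_scale1 : left_id 1 quot_scale.
Proof. by move=> a; rewrite -(proj_val a) quot_scaleE scale1r. Qed.
Lemma quot_scaleDr : right_distributive quot_scale +%R.
Proof.
move=> c a b; rewrite -(proj_val a) -(proj_val b).
by rewrite projD !quot_scaleE projD scalerDr.
Qed.
Lemma quot_scaleDl a : {morph quot_scale^~ a : c d / c + d}.
Proof.
by move=> c d; rewrite -(proj_val a) !quot_scaleE projD scalerDl.
Qed.

HB.instance Definition _ :=
  GRing.Zmodule_isLmodule.Build F quot_space quot_scaleA quot_scale1 quot_scaleDr quot_scaleDl.

Lemma proj_linear : linear proj.
Proof.
by move=> c x y; rewrite -projD -quot_scaleE.
Qed.

Lemma proj_eq0 x : proj x = 0 <-> S x.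
Proof. by rewrite -[X in S X]subr0; exact: projP. Qed.

End QuotientSpace.

Section SubQuotientModules.
Context {R : realType} (V : voa R).
Local Notation Y := (@voa_Y _ V).
Local Notation om := (voa_om V).
Local Notation vac := (voa_vac V).

Lemma gmodule_exists (E : lmodType R[i]) (YE : V -> int -> E -> E) :
  vertex_action Y vac om (voa_c V) YE ->
  (forall x, exists f, geig_rep (Lop om YE 0) x f) ->
  exists pi : R[i] -> E -> E, is_gmodule pi YE.
Proof.
move=> hE hx; have [pi [hpi hg]] := geig_grading (Lop_linear hE 0) hx.
by exists pi; split.
Qed.

Lemma gmod_geig_rep (W : gmodule V) (w : W) :
  geig_rep (Lop om (@gmod_Y _ _ W) 0) w (fun n => gmod_pi n w).
Proof.
have hpi := gmod_is_grading W.
have [s [us hs]] := finite_support_seq (grading_finite hpi w).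
exists s; split => //; first by move=> n; apply/gmod_geig; exact: homog_pi.
by rewrite -(fsumE us hs) (grading_sum hpi).
Qed.

Lemma submodule_subspace (W : gmodule V) (A : set W) : submodule A -> subspace A.
Proof. by case. Qed.

Lemma submodule_pi (W : gmodule V) (A : set W) n w : submodule A -> A w -> A (gmod_pi n w).
Proof.
move=> hA Aw; have sA := submodule_subspace hA; have [_ _ AY] := hA.
have lL := Lop_linear (gmod_vertex_action W) 0.
have [s [us hs gw wE]] := gmod_geig_rep w.
have [ns|/hs ->] := boolP (n \in s); last exact: ss0 sA.
apply: (geig_independent lL sA (fun x Ax => AY om (0 + 1) x Ax) us (x := fun n => gmod_pi n w)) => //.
  by move=> m _; have [k hk] := gw m; exists k; rewrite hk; exact: ss0 sA.
by rewrite -wE.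
Qed.

Section Homs.
Context (M W : gmodule V) (f : M -> W) (lf : linear f)
  (fY : forall v n x, f (gmod_Y v n x) = gmod_Y v n (f x)).
Local Notation LM := (Lop om (@gmod_Y _ _ M) 0).
Local Notation LW := (Lop om (@gmod_Y _ _ W) 0).

Lemma hom_iter_shift k n x : f (iter k (shift LM n) x) = iter k (shift LW n) (f x).
Proof.
by elim: k => // k IH; rewrite !iterS -IH /shift (linB lf) (linZ lf) /Lop fY.
Qed.

Lemma hom_homog n x : homog (@gmod_pi _ _ M) n x -> homog (@gmod_pi _ _ W) n (f x).
Proof.
move=> /gmod_geig[k hk]; apply/gmod_geig; exists k.
by rewrite -[LHS](hom_iter_shift k n x) hk (lin0 lf).
Qed.

Lemma hom_pi n x : f (gmod_pi n x) = gmod_pi n (f x).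
Proof.
rewrite -[in RHS](addr0 n); apply/esym; apply: shift_pi.
- exact: gmod_is_grading.
- exact: gmod_is_grading.
- exact: lf.
- by move=> q w hw; rewrite addr0; exact: hom_homog.
Qed.

Lemma grading_restricted_inj : injective f -> grading_restricted W -> grading_restricted M.
Proof.
move=> fi [[r hr] fd]; split.
  by exists r => n nr x; apply: fi; rewrite hom_pi hr // (lin0 lf).
move=> n; have [s hs] := fd n.
apply: (@fin_dim_lin _ _ _ _ f s) => //.
- exact: grading_subspace (gmod_is_grading M).
- by move=> x /hom_homog /hs.
apply: fin_dim_sub (fin_dim0 _) => x [_ /= fx]; apply: fi.
by rewrite fx (lin0 lf).
Qed.

Lemma grading_restricted_surj : (forall y, exists x, f x = y) ->
  grading_restricted M -> grading_restricted W.
Proof.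
move=> fs [[r hr] fd]; split.
  by exists r => n nr y; have [x <-] := fs y; rewrite -hom_pi hr // (lin0 lf).
move=> n; have [s hs] := fd n; exists [seq f x | x <- s] => y.
have [x <-] := fs y; rewrite /homog /= -hom_pi => <-.
move: (gmod_pi n x) (hs _ (homog_pi n x)); apply: span_min => [|t ts].
  exact: linear_preim_subspace lf (span_subspace _).
by apply: span_sub; exact: map_f.
Qed.

End Homs.

Lemma quotient_module (W : gmodule V) (A : set W) : submodule A ->
  exists (Q : gmodule V) (f : W -> Q),
    [/\ linear f, forall v n x, f (gmod_Y v n x) = gmod_Y v n (f x),
        forall y, exists x, f x = y & forall x, f x = 0 <-> A x].
Proof.
move=> hA; have sA := submodule_subspace hA; have [_ _ AY] := hA.
have hW := gmod_vertex_action W.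
pose S0 : {S : set W | subspace S} := exist _ A sA.
have lp := proj_linear S0.
pose YQ (v : V) (n : int) (a : quot_space S0) : quot_space S0 :=
  proj S0 (gmod_Y v n (quot_val a)).
have pY v n x : proj S0 (gmod_Y v n x) = YQ v n (proj S0 x).
  apply/projP; rewrite -(linB (act_linear_r hW v n)); apply: AY.
  by rewrite -opprB; apply: (ssN sA); exact: (proj_quot_val S0 x).
have hp : pre_action YQ.
  split.
  - by move=> n a c u v; rewrite /YQ (act_linear_l hW) lp.
  - move=> v n c a b; rewrite -(proj_val a) -(proj_val b) -lp -!pY.
    by rewrite (act_linear_r hW) lp.
  - move=> v a; have [N hN] := act_truncation hW v (quot_val a).
    by exists N => n /hN h; rewrite /YQ h (lin0 lp).
have hQ : vertex_action Y vac om (voa_c V) YQ.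
  apply: (vertex_action_intro hp) => a; rewrite -(proj_val a).
  apply: (hom_axioms_at (vertex_action_pre hW) lp pY).
  exact: vertex_action_axioms_at hW.
have [|pi hM] := gmodule_exists hQ.
  move=> a; rewrite -(proj_val a); move: (quot_val a) => w.
  have [s [us hs gw wE]] := gmod_geig_rep w.
  exists (fun n => proj S0 (gmod_pi n w)), s; split => //.
  - by move=> n /hs ->; exact: lin0 lp.
  - move=> n; have [k hk] := gw n; exists k.
    transitivity (proj S0 (iter k (shift (Lop om (@gmod_Y _ _ W) 0) n) (gmod_pi n w))).
      by elim: {hk} k => // k IH; rewrite !iterS IH [in RHS]/shift (linB lp) (linZ lp) /Lop pY.
    by rewrite hk (lin0 lp).
  - by rewrite {1}wE (lin_sum lp).
exists (MkGmodule hM), (proj S0); split => //.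
- by move=> a; exists (quot_val a); exact: proj_val.
- by move=> x; exact: proj_eq0.
Qed.

Lemma sub_module (W : gmodule V) (A : set W) : submodule A ->
  exists (M : gmodule V) (f : M -> W),
    [/\ linear f, forall v n x, f (gmod_Y v n x) = gmod_Y v n (f x),
        injective f & forall y, (exists x, f x = y) <-> A y].
Proof.
move=> hA; have sA := submodule_subspace hA; have [_ _ AY] := hA.
have hW := gmod_vertex_action W.
have inA (x : span_type A) : A (val x) by exact: (span_id sA (span_typeP x)).
pose YM (v : V) (n : int) (x : span_type A) : span_type A :=
  mk_span (span_sub (AY v n _ (inA x))).
have lv : linear (val : span_type A -> W) by exact: val_span_linear.
have vY v n x : val (YM v n x) = gmod_Y v n (val x) by [].
have hp : pre_action YM.
  split.
  - by move=> n x c u v; apply: val_inj; rewrite lv !vY (act_linear_l hW).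
  - by move=> v n c x y; apply: val_inj; rewrite lv !vY lv (act_linear_r hW).
  - move=> v x; have [N hN] := act_truncation hW v (val x).
    by exists N => n /hN h; apply: val_inj; rewrite vY h (lin0 lv).
have hM : vertex_action Y vac om (voa_c V) YM.
  apply: (vertex_action_intro hp) => x.
  apply: (inj_axioms_at hp lv vY val_inj).
  exact: vertex_action_axioms_at hW.
have [|pi hMM] := gmodule_exists hM.
  move=> x; have [s [us hs gw wE]] := gmod_geig_rep (val x).
  pose g n : span_type A := mk_span (span_sub (submodule_pi n hA (inA x))).
  have vg n : val (g n) = gmod_pi n (val x) by [].
  exists g, s; split => //.
  - by move=> n /hs h; apply: val_inj; rewrite vg h (lin0 lv).
  - move=> n; have [k hk] := gw n; exists k; apply: val_inj.
    transitivity (iter k (shift (Lop om (@gmod_Y _ _ W) 0) n) (val (g n))).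
      by elim: {hk} k => // k IH; rewrite !iterS -IH [in RHS]/shift (linB lv) (linZ lv) /Lop vY.
    by rewrite vg hk (lin0 lv).
  - by apply: val_inj; rewrite (lin_sum lv).
exists (MkGmodule hMM), val; split; [exact: lv | exact: vY | exact: val_inj |].
move=> y; split=> [[x <-]|Ay]; first exact: inA.
by exists (mk_span (span_sub Ay)).
Qed.

(* L(0) has an eigenvector, and the sums of eigenvectors form a submodule. *)
Lemma irreducible_semisimple (M : gmodule V) : (exists w : M, w != 0) ->
  (forall S : set M, submodule S -> S = [set 0] \/ S = setT) -> L0_semisimple M.
Proof.
move=> [w w0] irr; have hM := gmod_vertex_action M; have hpi := gmod_is_grading M.
pose L0 := Lop om (@gmod_Y _ _ M) 0; have lL : linear L0 by exact: Lop_linear.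
(* Vectors all of whose weight components are eigenvectors. A homogeneous mode preserves this, as it
   shifts weights and L(0)-eigenvalues by the same integer. *)
pose E : set M := [set x | forall p, L0 (gmod_pi p x) = p *: gmod_pi p x].
have sE : subspace E.
  split=> [p|a x y hx hy p].
    by rewrite (lin0 (grading_linear hpi p)) (lin0 lL) scaler0.
  by rewrite (grading_linear hpi p) lL hx hy scalerDr !scalerA mulrC.
have hE : submodule E.
  split; [exact: sE.1 | exact: sE.2 |].
  move=> v n x hx; move: v; apply: voa_ind => [|a v hv].
    split; first by rewrite /mkset (act0l hM); exact: ss0 sE.
    by move=> c u v hu hv; rewrite /mkset (act_linear_l hM); exact: ssP sE _ _ _ hu hv.
  move=> p; rewrite -[p](subrK (a - n - 1)%:~R) (gmod_pi_Y _ _ _ hv).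
  rewrite /L0 (act_L0 hM _ _ hv) -/L0 hx (actZr hM) -scalerDl //.
have [E0|ET] := irr E hE; last first.
  move=> n x hx; have /(_ n) : E x by rewrite ET.
  by rewrite hx.
exfalso; have [p px] : exists p, gmod_pi p w != 0.
  apply: contrapT => /forallNP h; move/eqP: w0; apply.
  rewrite -(grading_sum hpi w); apply: fsbig1 => p _.
  by apply/eqP/negPn/negP => /h.
have [k hk] := (gmod_geig p _).1 (homog_pi p w).
have ex : exists k, iter k (shift L0 p) (gmod_pi p w) == 0 by exists k; apply/eqP.
(* The last nonzero iterate of L(0) - p is an ordinary eigenvector, so [E] is nonzero. *)
case: (ex_minnP ex) => -[|j] /eqP hj jmin; first by move: px; rewrite -[X in X != 0]/(iter 0 (shift L0 p) (gmod_pi p w)) hj eqxx.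
pose y := iter j (shift L0 p) (gmod_pi p w).
have y0 : y != 0 by apply/negP => /jmin; rewrite ltnn.
have hy : homog (@gmod_pi _ _ M) p y by apply: gmod_iter_shift_weight; exact: homog_pi.
have : E y.
  move=> q; rewrite (homog_uniq q hpi hy); case: eqP => [->|_].
    by apply/eqP; rewrite -subr_eq0; apply/eqP.
  by rewrite (lin0 lL) scaler0.
by rewrite E0 => y0'; move: y0; rewrite y0' eqxx.
Qed.

End SubQuotientModules.
(** * Lowest weights and C_1-cofiniteness of grading-restricted modules *)

Section ZeroModes.
Context {R : realType} (V : voa R).
Local Notation Y := (@voa_Y _ V).
Local Notation vpi := (@voa_pi _ V).
Local Notation om := (voa_om V).
Local Notation vac := (voa_vac V).
Local Notation hY := (voa_vertex_action V).
Local Notation hpi := (voa_is_grading V).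
Local Notation LV n := (Lop om Y n).

(* [om] times v in Zhu's algebra A_0(V). *)
Definition zhu_om (v : V) : V := Y om (-1) v + 2%:R *: Y om 0 v + Y om 1 v.

Lemma zhu_om_linear : linear zhu_om.
Proof.
have l n := act_linear_r hY om n.
by apply: linear_addf => //; apply: linear_addf => //; apply: linear_scalef.
Qed.

Lemma circ_homog N a u v : homog vpi a u -> circ N u v =
    \sum_(i \in [set: nat]) binomz _ (a + N%:Z) i *: Y u (i%:Z - (2 * N)%:Z - 2) v.
Proof.
move=> hu; rewrite /circ (fsum1 (n := a)) => [|b ba].
  by apply: eq_fsbigr => i _; rewrite hu.
apply: fsbig1 => i _; rewrite (homog_uniq b hpi hu) (negPf ba) (act0l hY).
exact: scaler0.
Qed.

Lemma circ_sum N u v (s : seq int) : uniq s -> (forall a, a \notin s -> vpi a u = 0) ->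
  circ N u v = \sum_(a <- s) circ N (vpi a u) v.
Proof.
move=> us hs; rewrite [LHS]/circ (fsumE us) => [|a /hs ->]; last first.
  by apply: fsbig1 => i _; rewrite (act0l hY) scaler0.
by apply: eq_bigr => a _; rewrite (circ_homog _ _ (homog_voa_pi a u)).
Qed.

Section Module.
Context (W : gmodule V).
Local Notation YW := (@gmod_Y _ _ W).
Local Notation hW := (gmod_vertex_action W).
Local Notation L0 := (Lop om YW 0).

(** The weight-preserving mode o(v), equal to v_{wt v - 1} for homogeneous v. *)
Definition zero_mode (v : V) (w : W) : W :=
  \sum_(a \in [set: int]) YW (vpi a v) (a - 1) w.

Lemma zero_mode_homog a v w : homog vpi a v -> zero_mode v w = YW v (a - 1) w.
Proof.
move=> hv; rewrite /zero_mode (fsum1 (n := a)) => [|b ba]; first by rewrite hv.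
by rewrite (homog_uniq b hpi hv) (negPf ba) (act0l hW).
Qed.

Lemma zero_mode_linear w : linear (fun v => zero_mode v w).
Proof.
move=> c x y; rewrite /zero_mode.
have [s [us hs]] := finite_support_seq (grading_finite hpi x).
have [t [ut ht]] := finite_support_seq (grading_finite hpi y).
have uu := undup_uniq (s ++ t).
have hu a : a \notin undup (s ++ t) -> vpi a x = 0 /\ vpi a y = 0.
  by rewrite mem_undup mem_cat negb_or => /andP[/hs -> /ht ->].
rewrite (fsumE uu) => [|a /hu[xa ya]]; last first.
  by rewrite (grading_linear hpi) xa ya scaler0 addr0 (act0l hW).
rewrite (fsumE uu) => [|a /hu[xa _]]; last by rewrite xa (act0l hW).
rewrite (fsumE uu) => [|a /hu[_ ya]]; last by rewrite ya (act0l hW).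
rewrite scaler_sumr -big_split; apply: eq_bigr => a _.
by rewrite (grading_linear hpi) (act_linear_l hW).
Qed.

Context (A : set W) (hA : submodule A) (w : W).
Hypothesis low : forall a v (n : int), homog vpi a v -> a - n - 1 < 0 -> A (YW v n w).
Let sA : subspace A := submodule_subspace hA.

(** By [low], w is a lowest weight vector modulo [A]. The zero mode of [circ N u v] is the
    right-hand side of the Jacobi identity at l = -2N-2, m = a+N, n = b+N; on the left each term
    first applies v_{b+N+i} or u_{a+N+i} to w, a mode of weight -N-1-i. *)
Lemma zero_mode_circ N u v : A (zero_mode (circ N u v) w).
Proof.
have [_ _ AY] := hA.
suff main a u' : homog vpi a u' -> A (zero_mode (circ N u' v) w).
  have [s [us hs]] := finite_support_seq (grading_finite hpi u).
  rewrite (circ_sum N v us hs) (lin_sum (zero_mode_linear w)).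
  apply: (ss_sum sA) => a _; apply: (main a); exact: homog_voa_pi.
move: u' => {}u hu; move: v; apply: voa_ind => [|b v hv].
  have l : linear (fun v => zero_mode (circ N u v) w).
    apply: (lin_comp (zero_mode_linear w)).
    have -> : circ N u = (fun v => \sum_(i \in [set: nat])
        binomz _ (a + N%:Z) i *: Y u (i%:Z - (2 * N)%:Z - 2) v).
      by apply/funext => v; exact: circ_homog.
    apply: fsum_linear => [i|v]; first by apply: linear_scalef; exact: (act_linear_r hY).
    have [K hK] := act_trunc_nat hY u v (- (2 * N)%:Z - 2); exists K => i /hK h.
    by rewrite -[RHS](scaler0 _ (binomz _ (a + N%:Z) i)) -h; congr (_ *: Y _ _ _); lia.
  exact: linear_preim_subspace l sA.
pose l : int := - (2 * N)%:Z - 2.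
have [K hK] := act_trunc_nat hY u v l.
rewrite /mkset (circ_homog _ _ hu) (lin_fsum_nat (zero_mode_linear w) (K := K)); last first.
  by move=> i /hK h; rewrite -[RHS](scaler0 _ (binomz _ (a + N%:Z) i)) -h; congr (_ *: Y _ _ _); rewrite /l; lia.
have -> : \sum_(i \in [set: nat])
     zero_mode (binomz _ (a + N%:Z) i *: Y u (i%:Z - (2 * N)%:Z - 2) v) w
   = \sum_(i \in [set: nat]) subx _ (i%:Z - (a + N%:Z) - 1) i
        *: YW (Y u (l + i%:Z) v) (a + N%:Z + (b + N%:Z) - i%:Z) w.
  apply: eq_fsbigr => i _; rewrite (linZ (zero_mode_linear w)) subx_opp.
  rewrite (zero_mode_homog w (homog_Y _ hu hv)).
  by congr (_ *: YW (Y _ _ _) _ _); rewrite /l; lia.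
rewrite -(act_jacobi hW).
have [K1 h1] := act_trunc_nat hW v w (b + N%:Z).
have [K2 h2] := act_trunc_nat hW u w (a + N%:Z).
rewrite (@fsum_nat _ K1) => [|i /h1 ->]; last by rewrite (act0r hW) scaler0.
rewrite (@fsum_nat _ K2) => [|i /h2 ->]; last by rewrite (act0r hW) scaler0.
by apply: (ssB sA); apply: (ss_sum sA) => i _; apply: (ssZ sA); apply: AY;
  [apply: (low hv) | apply: (low hu)]; lia.
Qed.

Lemma zero_mode_O N v : O_ N v -> A (zero_mode v w).
Proof.
move: v; apply: span_min.
  have l := zero_mode_linear w.
  exact: linear_preim_subspace l sA.
move=> _ [[u [v ->]]|[u ->]]; first exact: zero_mode_circ.
suff -> : zero_mode (LV (-1) u + LV 0 u) w = 0 by exact: ss0 sA.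
move: u; apply: voa_ind => [|a u hu].
  apply: linear_ker_subspace; apply: (lin_comp (zero_mode_linear w)).
  by apply: linear_addf; exact: (Lop_linear hY).
rewrite (linD (zero_mode_linear w)) (zero_mode_homog w (homog_L (-1) hu)).
rewrite (zero_mode_homog w (homog_L 0 hu)) (act_derivative hW).
rewrite (voa_L0 (voa_axioms V) hu) (actZl hW).
have -> : a - 0 - 1 = a - 1 by lia.
have -> : a - -1 - 1 - 1 = a - 1 by lia.
have -> : a - -1 - 1 = a by lia.
by rewrite scaleNr addNr.
Qed.

Lemma fsum_subspace (f : nat -> W) : (exists K, forall i, (K <= i)%N -> f i = 0) ->
  (forall i, A (f i)) -> A (\sum_(i \in [set: nat]) f i).
Proof.
by move=> [K fK] Af; rewrite (@fsum_nat _ K) //; apply: (ss_sum sA).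
Qed.

(** Jacobi identity for om and v at l = -1, m = 2, n = b-1: the right has coefficients 1, 2, 1 as in
    [zhu_om]. On the left the leading term is L(0)o(v)w, and all others begin with a lowering mode
    on w. *)
Lemma zero_mode_om v : A (zero_mode (zhu_om v) w - L0 (zero_mode v w)).
Proof.
have [_ _ AY] := hA; have lL : linear L0 by exact: (Lop_linear hW).
have l : linear (fun v => zero_mode (zhu_om v) w - L0 (zero_mode v w)).
  apply: linear_subf; first exact: lin_comp (zero_mode_linear w) zhu_om_linear.
  exact: lin_comp lL (zero_mode_linear w).
move: v; apply: voa_ind => [|b v hv].
  exact: linear_preim_subspace l sA.
rewrite /mkset /zhu_om !(linD (zero_mode_linear w)) (linZ (zero_mode_linear w)).
rewrite !(zero_mode_homog w (homog_Y _ (homog_om V) hv)) (zero_mode_homog w hv).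
have := act_jacobi hW om v w (-1) 2 (b - 1).
rewrite [in RHS]fsum_nat3 => [|i i3]; last first.
  by rewrite subx_opp (@binomz_small _ 2) ?scale0r.
rewrite !subx_opp binomz0 binomz1 (_ : binomz _ 2 2 = 1); last first.
  apply: (mulfI (natf_neq0 (F := R[i]) 1)).
  by rewrite binomz_rec binomz1; ring.
rewrite !scale1r.
have -> : -1 + 0%N%:Z = -1 :> int by [].
have -> : -1 + 1%N%:Z = 0 :> int by [].
have -> : -1 + 2%N%:Z = 1 :> int by [].
have -> : 2 + (b - 1) - 0%N%:Z = b + 1 by lia.
have -> : 2 + (b - 1) - 1%N%:Z = b by lia.
have -> : 2 + (b - 1) - 2%N%:Z = b - 1 by lia.
have -> : 2 + b - -1 - 1 - 1 = b + 1 by lia.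
have -> : 2 + b - 0 - 1 - 1 = b by lia.
have -> : 2 + b - 1 - 1 - 1 = b - 1 by lia.
rewrite addrA => <-.
have [K1 h1] := act_trunc_nat hW v w (b - 1).
have [K2 h2] := act_trunc_nat hW om w 2.
rewrite (@fsum_nat _ K1.+1) => [|i /ltnW /h1 ->]; last by rewrite (act0r hW) scaler0.
rewrite big_ord_recl subx_k0 scale1r.
have -> : YW om (2 + -1 - 0%N%:Z) (YW v (b - 1 + 0%N%:Z) w) = L0 (YW v (b - 1) w).
  by congr (YW _ _ (YW _ _ _)); lia.
set X := L0 _; set S := \sum_(i < K1) _; set T := \sum_(i \in _) _.
have -> : X + S - T - X = S - T by rewrite addrAC [X + S]addrC addrK.
apply: (ssB sA); rewrite /S /T.
  apply: (ss_sum sA) => i _; apply: (ssZ sA); apply: AY; apply: (low hv).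
  by rewrite lift0; lia.
apply: fsum_subspace; first by exists K2 => i /h2 ->; rewrite (act0r hW) scaler0.
by move=> i; apply: (ssZ sA); apply: AY; apply: (low (homog_om V)); lia.
Qed.

Lemma zero_mode_iter k : A (zero_mode (iter k zhu_om vac) w - iter k L0 w).
Proof.
have [_ _ AY] := hA; have lL : linear L0 by exact: (Lop_linear hW).
elim: k => [|k IH].
  rewrite (zero_mode_homog w (homog_vac V)) (act_vacuum hW) /= subrr.
  exact: ss0 sA.
rewrite !iterS -(subrKA (L0 (zero_mode (iter k zhu_om vac) w))).
apply: (ssD sA); first exact: zero_mode_om.
by rewrite -(linB lL); apply: AY.
Qed.

End Module.

(* Finite dimensionality of A_N(V) makes [om] algebraic in the quotient A_0(V);
   hence lowest weights are roots of one fixed polynomial. *)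
Lemma lowest_weight_root N : A_finite_dimensional V N ->
  exists2 P : {poly R[i]}, P != 0 & forall (W : gmodule V) (A : set W) (n : R[i]) (w : W),
    submodule A ->
    (forall a v (m : int), homog vpi a v -> a - m - 1 < 0 -> A (gmod_Y v m w)) ->
    A (Lop om (@gmod_Y _ _ W) 0 w - n *: w) -> ~ A w -> root P n.
Proof.
move=> [s hs]; have sO := span_subspace (fun x => (exists u v, x = circ N u v)
        \/ (exists u, x = LV (-1) u + LV 0 u)).
pose e k := iter k zhu_om vac.
have dec k : exists o, O_ N o /\ span [set` s] (e k - o).
  by have [o Oo h] := spanUP sO (hs (e k)); exists o.
have [o ho] := choice dec.
(* V/O_N(V) is spanned by the classes of [s], so the first |s| + 1 powers of om, counting the
   vacuum, are dependent modulo O_N(V). *)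
have [c [[j cj] c0]] := span_dependent (ltnSn (size s)) (fun i : 'I_(size s).+1 => (ho i).2).
exists (\poly_(k < (size s).+1) c (inord k)).
  apply/negP => /eqP/(congr1 (fun p : {poly _} => p`_j)).
  by rewrite coef0 coef_poly ltn_ord inord_val => h; rewrite h eqxx in cj.
move=> W A n w hA low hn nAw; have sA := submodule_subspace hA.
have [_ _ AY] := hA; set L0 := Lop om _ 0 in hn.
have lL : linear L0 by exact: (Lop_linear (gmod_vertex_action W)).
have lz := zero_mode_linear w.
have hk k : A (iter k L0 w - n ^+ k *: w).
  elim: k => [|k IH]; first by rewrite expr0 scale1r subrr; exact: ss0 sA.
  rewrite iterS -(subrKA (L0 (n ^+ k *: w))); apply: (ssD sA).
    by rewrite -(linB lL); exact: AY.
  by rewrite (linZ lL) exprSr -scalerA -scalerBr; apply: (ssZ sA).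
have h1 : A (zero_mode (\sum_(i < (size s).+1) c i *: e i) w).
  have -> : \sum_(i < (size s).+1) c i *: e i = \sum_(i < (size s).+1) c i *: o i.
    by apply/eqP; rewrite -subr_eq0 -sumrB -[X in _ == X]c0; apply/eqP; apply: eq_bigr => i _; rewrite scalerBr.
  apply: (zero_mode_O (N := N) hA low); apply: (ss_sum sO) => i _.
  by apply: (ssZ sO); exact: (ho i).1.
(* Modulo [A] the zero mode of the k-th power acts on w as L(0)^k, hence as n^k; so the relation
   acts as the value of the polynomial at n. *)
have h2 : A ((\poly_(k < (size s).+1) c (inord k)).[n] *: w).
  have -> : (\poly_(k < (size s).+1) c (inord k)).[n] *: w
     = zero_mode (\sum_(i < (size s).+1) c i *: e i) w
       - \sum_(i < (size s).+1) c i *: (zero_mode (e i) w - n ^+ i *: w).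
    rewrite horner_poly scaler_suml (lin_sum lz) -sumrB; apply: eq_bigr => i _.
    by rewrite (linZ lz) inord_val scalerBr subKr scalerA.
  apply: (ssB sA) => //; apply: (ss_sum sA) => i _; apply: (ssZ sA).
  rewrite -(subrKA (iter i L0 w)); apply: (ssD sA); last exact: hk.
  exact: zero_mode_iter.
apply/negPn/negP => nr; apply: nAw.
move: nr h2; rewrite /root; move: (_.[n]) => x x0 h2.
by have := ssZ sA x^-1 h2; rewrite scalerA mulVf // scale1r.
Qed.

End ZeroModes.

(** * Lowest weight vectors of subquotients *)

Section FiniteLength.
Context {R : realType} (V : voa R).
Local Notation vpi := (@voa_pi _ V).
Local Notation om := (voa_om V).
Context (W : gmodule V) (hW : grading_restricted W).
Local Notation pi := (@gmod_pi _ _ W).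
Local Notation YW := (@gmod_Y _ _ W).
Local Notation hpi := (gmod_is_grading W).
Local Notation L0 := (Lop om YW 0).
Implicit Types A C : set W.

(** A lowest weight eigenvector of A'/A, expressed by conditions modulo [A]. First a weight of A'/A
    is found below which no smaller one differs by a positive integer; then an L(0)-eigenvector
    modulo [A] is found there. *)
Lemma lowest_vector A A' : submodule A -> submodule A' -> A `<=` A' -> ~ (A' `<=` A) ->
  exists p w, [/\ homog pi p w, A' w, ~ A w,
    forall a v (m : int), homog vpi a v -> a - m - 1 < 0 -> A (YW v m w)
    & A (L0 w - p *: w)].
Proof.
move=> hA hA' AA' nA; have sA := submodule_subspace hA.
have [r hr] := hW.1; have [_ _ AY'] := hA'; have [_ _ AY] := hA.
have [p [w [hw A'w nAw lo]]] : exists p w, [/\ homog pi p w, A' w, ~ A w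
    & forall (k : nat) y, (0 < k)%N -> homog pi (p - k%:R) y -> A' y -> A y].
  have [x [A'x nAx]] : exists x, A' x /\ ~ A x.
    by apply: contrapT => h; apply: nA => x A'x; apply: contrapT => nAx; apply: h; exists x.
  have [p npx] : exists p, ~ A (pi p x).
    apply: contrapT => /forallNP h; apply: nAx.
    have [s [us hs]] := finite_support_seq (grading_finite hpi x).
    rewrite -(grading_sum hpi x); apply: (ss_fsum sA us hs) => p.
    exact: contrapT (h p).
  have [K hK] := Re_bound [:: p] r; have {hK} := hK p (mem_head _ _).
  have := submodule_pi p hA' A'x; have := homog_pi p x.
  move: (pi p x) npx => {nAx A'x}y; move: x => _.
  (* Either p has the required minimality, or p - k with k >= 1 is again a weight of A'/A; the lower
     bound r of the weights stops the descent. *)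
  elim: K p y => [|K IH] p y nAy hy A'y pK.
    exfalso; apply: nAy; rewrite -hy hr ?addr0 //; first exact: ss0 sA.
    by move: pK; rewrite addr0.
  have [h|] := pselect (forall (k : nat) y, (0 < k)%N -> homog pi (p - k%:R) y -> A' y -> A y).
    by exists p, y.
  move=> /existsNP[k /existsNP[y' /not_implyP[k0 /not_implyP[hy' /not_implyP[A'y' nAy']]]]].
  apply: (IH (p - k%:R) y') => //.
  rewrite ReD ReN Re_nat; have : 1 <= k%:R :> R by rewrite ler1n.
  by move: pK; rewrite -natr1; lra.
have low y : homog pi p y -> A' y ->
    forall a v (m : int), homog vpi a v -> a - m - 1 < 0 -> A (YW v m y).
  move=> hy A'y a v m hv am; apply: (lo (absz (a - m - 1)%R) (YW v m y)); [lia | | exact: AY'].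
  have := gmod_weight m hv hy; congr (homog _ (_ + _) _).
  by rewrite pmulrn -intrN; congr (_%:~R); lia.
have hwk k : homog pi p (iter k (shift L0 p) w) by exact: gmod_iter_shift_weight.
have A'k k : A' (iter k (shift L0 p) w).
  by apply: (iter_shift_stable (submodule_subspace hA')) => // x; exact: AY'.
have [k hk] := (gmod_geig p w).1 hw.
have ex : exists k, `[< A (iter k (shift L0 p) w) >].
  by exists k; apply/asboolP; rewrite [iter _ _ _]hk; exact: ss0 sA.
(* The last iterate of L(0) - p outside [A] is an eigenvector modulo [A]. *)
case: (ex_minnP ex) => -[|j] /asboolP hj jmin; first by [].
exists p, (iter j (shift L0 p) w); split => //; last exact: low.
by move=> /asboolP/jmin; rewrite ltnn.
Qed.

End FiniteLength.

(** * C_1-cofiniteness along a filtration *)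

Section C1Cofinite.
Context {R : realType} (V : voa R).
Hypothesis hirr : forall M : gmodule V, irreducible_module M -> C1_cofinite M.
Context (W : gmodule V) (hW : grading_restricted W).
Local Notation pi := (@gmod_pi _ _ W).
Local Notation YW := (@gmod_Y _ _ W).
Local Notation hpi := (gmod_is_grading W).
Implicit Types A C : set W.

Definition C1_gens : set W := [set x | exists u y, Vplus u /\ x = YW u (-1) y].

(** C_1 is taken in [W] and not in [A], so the condition for [A] carries over directly to larger
    submodules. *)
Definition C1_cofinite_on A := exists t : seq W,
  forall w, A w -> span (C1_gens `|` [set` t]) w.

(** A'/A is realized as a submodule M of W/A; a submodule of M pulls back to some [C] between A and
    A', so M is irreducible. Generators u_{-1}m of C_1(M) lift to u_{-1} of a lift of m, and the
    remaining error lies in [A]. *)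
Lemma irreducible_subquotient A A' : submodule A -> submodule A' -> A `<=` A' ->
  ~ (A' `<=` A) ->
  (forall C, submodule C -> A `<=` C -> C `<=` A' -> C `<=` A \/ A' `<=` C) ->
  C1_cofinite_on A -> C1_cofinite_on A'.
Proof.
move=> hA hA' AA' nA irr [tA htA]; have sA := submodule_subspace hA.
have [sA'0 sA'P A'Y] := hA'.
have [Q [f [lf fY fs f0]]] := quotient_module hA.
have hfA' : submodule [set y | exists2 x, A' x & f x = y].
  split; first by exists 0 => //; exact: lin0 lf.
    by move=> a _ _ [x Ax <-] [y Ay <-]; exists (a *: x + y); [exact: sA'P | exact: lf].
  by move=> v n _ [x Ax <-]; exists (gmod_Y v n x); [exact: A'Y | exact: fY].
have [M [g [lg gY gi gA']]] := sub_module hfA'.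
have gr : grading_restricted M.
  by apply: (grading_restricted_inj lg gY gi); exact: (grading_restricted_surj lf fY fs).
have /choice[lift liftP] (m : M) : exists x, A' x /\ f x = g m.
  by have [x Ax fx] := (gA' (g m)).1 (ex_intro _ m erefl); exists x.
have ne : exists m : M, m != 0.
  have [x [A'x nAx]] : exists x, A' x /\ ~ A x.
    by apply: contrapT => h; apply: nA => x A'x; apply: contrapT => nAx; apply: h; exists x.
  have [m gm] := (gA' (f x)).2 (ex_intro2 _ _ x A'x erefl).
  exists m; apply/eqP => m0; apply: nAx; apply/f0.
  by rewrite -gm m0 (lin0 lg).
have simple (S : set M) : submodule S -> S = [set 0] \/ S = setT.
  move=> [S0 SP SY].
  pose C : set W := [set x | A' x /\ exists2 m, S m & g m = f x].
  have hC : submodule C.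
    split.
    - by split => //; exists 0 => //; rewrite (lin0 lf) (lin0 lg).
    - move=> a x y [Ax [m Sm gm]] [Ay [m' Sm' gm']]; split; first exact: sA'P.
      by exists (a *: m + m'); [exact: SP | rewrite lg lf gm gm'].
    - move=> v n x [Ax [m Sm gm]]; split; first exact: A'Y.
      by exists (gmod_Y v n m); [exact: SY | rewrite gY gm fY].
  have AC : A `<=` C.
    move=> x Ax; split; first exact: AA'.
    by exists 0 => //; rewrite (lin0 lg); apply/esym/f0.
  have [CA|A'C] := irr C hC AC (fun x Cx => Cx.1).
    left; apply/seteqP; split => [m Sm|_ -> //].
    have [Al fl] := liftP m; apply: gi; rewrite (lin0 lg) -fl; apply/f0.
    by apply: CA; split => //; exists m.
  right; apply/seteqP; split => // m _; have [Al fl] := liftP m.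
  by have [_ [m' Sm' gm']] := A'C _ Al; rewrite -(gi m' m) // gm' fl.
have [sM hsM] : C1_cofinite M.
  apply: hirr; split => //; split => //.
  exact: irreducible_semisimple ne simple.
exists (tA ++ map lift sM) => w A'w.
set T := span _; have sT : subspace T by exact: span_subspace.
have [m gm] := (gA' (f w)).2 (ex_intro2 _ _ w A'w erefl).
have [w' Tw' fw'] : exists2 w', T w' & f w' = g m.
  move: m (hsM m) {gm}; apply: span_min.
    split; first by exists 0; [exact: ss0 sT | rewrite (lin0 lf) (lin0 lg)].
    move=> a m m' [x Tx fx] [y Ty fy]; exists (a *: x + y); first exact: ssP sT _ _ _ Tx Ty.
    by rewrite lf lg fx fy.
  move=> m [Cm|ms]; last first.
    exists (lift m); last exact: (liftP m).2.
    by apply: span_sub; right; rewrite /= mem_cat map_f ?orbT.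
  move: m Cm; apply: span_min.
    split; first by exists 0; [exact: ss0 sT | rewrite (lin0 lf) (lin0 lg)].
    move=> a m m' [x Tx fx] [y Ty fy]; exists (a *: x + y); first exact: ssP sT _ _ _ Tx Ty.
    by rewrite lf lg fx fy.
  move=> _ [u [m [Vu ->]]]; exists (YW u (-1) (lift m)).
    by apply: span_sub; left; exists u, (lift m).
  by rewrite fY gY (liftP m).2.
rewrite -(subrK w' w); apply: (ssD sT) => //.
have : A (w - w') by apply/f0; rewrite (linB lf) fw' gm subrr.
move=> /htA; apply: spanS => x [Cx|xt]; first by left.
by right; rewrite /= mem_cat xt.
Qed.

Section Rank.
Context (rs : seq R[i]).

Definition weights_in A : set W := [set w | A w /\ forall n, n \notin rs -> pi n w = 0].

(** States that the part of [A] in the weights [rs] has dimension at least [n]; the largest such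
    [n], from [rank_exists], is its dimension. *)
Definition independent_in A (n : nat) := exists x : 'I_n -> W,
  (forall i, weights_in A (x i)) /\
  forall c : 'I_n -> R[i], \sum_(i < n) c i *: x i = 0 -> forall i, c i = 0.

(** A vector outside [A] is independent of any family in [A], so the rank grows strictly as soon as
    a vector with weights in [rs] is gained. *)
Lemma independent_inS A C n w : submodule A -> A `<=` C -> weights_in C w -> ~ A w ->
  independent_in A n -> independent_in C n.+1.
Proof.
move=> hA AC Cw nAw [x [Ax ix]]; have sA := submodule_subspace hA.
exists (fun i => if unlift ord0 i is Some j then x j else w); split.
  move=> i; case: (unlift ord0 i) => // j; have [Aj xj] := Ax j.
  by split => //; exact: AC.
move=> c; rewrite big_ord_recl unlift_none.
under eq_bigr do rewrite liftK.
move=> c0; have cw : c ord0 = 0.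
  apply/eqP/negPn/negP => n0; apply: nAw.
  have -> : w = - (c ord0)^-1 *: \sum_(i < n) c (lift ord0 i) *: x i.
    move/eqP: c0; rewrite addrC addr_eq0 => /eqP ->.
    by rewrite scalerN scaleNr opprK scalerA mulVf // scale1r.
  apply: (ssZ sA); apply: (ss_sum sA) => i _; apply: (ssZ sA); exact: (Ax i).1.
move: c0; rewrite cw scale0r add0r => /ix h i.
by case: (unliftP ord0 i) => [j ->|->].
Qed.

Lemma rank_exists A : exists d, independent_in A d /\
  forall n, independent_in A n -> (n <= d)%N.
Proof.
have [t ht] := choice hW.2.
pose T := flatten [seq t n | n <- rs].
have span_T w : (forall n, n \notin rs -> pi n w = 0) -> span [set` T] w.
  move=> hw; rewrite -(grading_sum hpi w) (fsumE (undup_uniq rs)); last first.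
    by move=> n; rewrite mem_undup; exact: hw.
  apply: (ss_sum_seq (span_subspace _)) => n; rewrite mem_undup => nrs.
  have := ht n _ (homog_pi n w); apply: spanS => x /= xt.
  by apply/flattenP; exists (t n) => //; exact: map_f.
have bound n : independent_in A n -> (n <= size T)%N.
  move=> [x [Ax ix]]; rewrite leqNgt; apply/negP => Tn.
  have [c [[i ci] c0]] := span_dependent Tn (fun i => span_T _ (Ax i).2).
  by move: ci; rewrite (ix c c0) eqxx.
have ex : exists n, `[< independent_in A n >].
  exists 0%N; apply/asboolP; exists (fun=> 0); split=> [[]//|c _ []//].
have ub n : `[< independent_in A n >] -> (n <= size T)%N by move=> /asboolP/bound.
case: (ex_maxnP ex ub) => d /asboolP hd hmax; exists d; split => // n hn.
by apply: hmax; apply/asboolP.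
Qed.

End Rank.

(* Refine the filtration: over A, a submodule of least rank among those strictly
   containing A yields an irreducible subquotient. *)
Lemma grading_restricted_C1_cofinite N : A_finite_dimensional V N -> C1_cofinite W.
Proof.
move=> /lowest_weight_root[P P0 rootP].
have [rs hrs] : exists rs : seq R[i], forall n, root P n -> n \in rs.
  have [rs Prs] := closed_field_poly_normal P; exists rs => n.
  rewrite Prs rootZ ?lead_coef_eq0 //.
  by rewrite root_prod_XsubC.
have [d hd] := choice (rank_exists rs).
(* The lowest weight of C/A is a root of [P], so a strict inclusion is already visible in the
   weights [rs] and raises the rank. *)
have step A C : submodule A -> submodule C -> A `<=` C -> ~ (C `<=` A) ->
    exists w, [/\ weights_in rs C w, ~ A w & (d A < d C)%N].
  move=> hA hC AC nCA; have [p [w [hw Cw nAw low Lw]]] := lowest_vector hW hA hC AC nCA.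
  have pr := hrs p (rootP W A p w hA low Lw nAw).
  have ww : weights_in rs C w.
    split=> // n nrs; rewrite (homog_uniq n hpi hw); case: eqP => // np.
    by rewrite np pr in nrs.
  exists w; split => //; apply: (hd C).2.
  exact: independent_inS hA AC ww nAw (hd A).1.
have hT : submodule (setT : set W) by [].
(* [k] bounds how much rank is still missing from [A]; the filtration is climbed from 0 until none
   is. *)
suff main k A : submodule A -> C1_cofinite_on A -> (d setT <= d A + k)%N ->
    C1_cofinite_on setT.
  have h0 : submodule ([set 0] : set W).
    split=> // [a _ _ -> ->|v n _ ->]; first by rewrite scaler0 addr0.
    exact: act0r (gmod_vertex_action W) v n.
  have [|t ht] := main (d setT) _ h0 _ (leq_addl _ _).
    by exists [::] => _ ->; exact: ss0 (span_subspace _).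
  exists t => w; have := ht w I; apply: spanS => x [[u [y uy]]|xt]; last by right.
  by left; apply: span_sub; exists u, y.
elim: k A => [|k IH] A hA cA dA.
  have [TA|nTA] := pselect ((setT : set W) `<=` A).
    by have [t ht] := cA; exists t => w /TA; exact: ht.
  have [w [_ _]] := step A setT hA hT (fun _ _ => I) nTA.
  by rewrite ltnNge -(addn0 (d A)) dA.
have [TA|nTA] := pselect ((setT : set W) `<=` A).
  by have [t ht] := cA; exists t => w /TA; exact: ht.
have ex : exists n, `[< exists C, [/\ submodule C, A `<=` C, ~ (C `<=` A) & d C = n] >].
  by exists (d setT); apply/asboolP; exists setT; split.
case: (ex_minnP ex) => m /asboolP[C [hC AC nCA dC]] mmin.
have minC D : submodule D -> A `<=` D -> ~ (D `<=` A) -> (d C <= d D)%N.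
  by move=> hD AD nDA; rewrite dC; apply: mmin; apply/asboolP; exists D.
have [w [Cw nAw dAC]] := step A C hA hC AC nCA.
(* The submodule generated by [A] and the lowest vector [w] of [C]; D/A, unlike C/A, will be
   irreducible. *)
pose D : set W := [set x | forall E, submodule E -> A `<=` E -> E w -> E x].
have hD : submodule D.
  split.
  - by move=> E [E0 _ _].
  - by move=> a x y Dx Dy E hE AE Ew; have [_ EP _] := hE; apply: EP; [exact: Dx | exact: Dy].
  - by move=> v n x Dx E hE AE Ew; have [_ _ EY] := hE; apply: EY; exact: Dx.
have AD : A `<=` D by move=> x Ax E _ AE _; exact: AE.
have Dw : D w by [].
have nDA : ~ (D `<=` A) by move=> DA; apply: nAw; exact: DA.
have DC : D `<=` C by move=> x Dx; apply: Dx => //; exact: Cw.1.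
apply: (IH D hD).
  apply: (irreducible_subquotient hA hD AD nDA) => // E hE AE ED.
  have [|nEA] := pselect (E `<=` A); [by left | right => x Dx].
  apply: Dx => //; apply: contrapT => nEw.
  (* If E missed w, adjoining w would make the rank of [C] exceed that of [E], against the
     minimality of [C]. *)
  have := minC E hE AE nEA; apply/negP; rewrite -ltnNge.
  have EC : E `<=` C by move=> y /ED/DC.
  by have := (hd C).2 _ (independent_inS hE EC Cw nEw (hd E).1).
have := minC D hD AD nDA => dCD.
by apply: leq_trans dA _; rewrite addnS -addSn leq_add2r; exact: leq_trans dAC dCD.
Qed.

End C1Cofinite.

Theorem theorem4p5 (R : realType) (V : voa R)
  (hV : voa_C1_cofinite V)
  (hN : exists N : nat,
     [/\ (0 < N)%N,
         forall (M1 M2 : gmodule V) (n1 n2 : R[i]),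
           irreducible_module M1 -> irreducible_module M2 ->
           lowest_weight M1 n1 -> lowest_weight M2 n2 ->
           `|complex.Re n1 - complex.Re n2| <= N%:R
       & A_finite_dimensional V N])
  (hirr : forall M : gmodule V, irreducible_module M ->
     real_graded M /\ C1_cofinite M)
  (z : R[i]) (hz : z != 0)
  (W1 W2 : gmodule V)
  (hW1 : grading_restricted W1) (hW2 : grading_restricted W2) :
  let B := box (@grading_restricted R V) z W1 W2 in
  exists (pi : R[i] -> B -> B) (Y : V -> int -> B -> B)
         (hB : is_gmodule pi Y),
    (forall (v : V) (n : int) (la : B), val (Y v n la) = box_Y z v n (val la))
    /\ grading_restricted (MkGmodule hB).
Proof.
have [N [_ _ AN]] := hN.
have C1irr (M : gmodule V) (hM : irreducible_module M) := (hirr M hM).2.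
have C1W (W : gmodule V) (hW : grading_restricted W) :=
  grading_restricted_C1_cofinite C1irr hW AN.
have [pi hB] := box_gmodule z W1 W2 (fun (W : gmodule V) (hW : grading_restricted W) => hW).
exists pi, (@boxY _ V z W1 W2 _), hB; split; first exact: boxYE.
apply: box_grading_restricted => //.
- exact: hW1.1.
- exact: hW2.1.
- exact: C1W.
- exact: C1W.
Qed.
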